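(* Let $\mu_-\le0\le\mu_+$ and let $X$ be of class $sSL_{\mu_-,\mu_+}$ with Lévy density $$f(x)=\mathbf{1}_{(-\infty,0)}(x)\int_{(0,+\infty)}e^{tx}\mathcal{G}_-(dt)+\mathbf{1}_{(0,+\infty)}(x)\int_{(0,+\infty)}e^{-tx}\mathcal{G}_+(dt)$$ ($\mathcal{G}_-\in\mathrm{sSLM}_{\mu_+}$, $\mathcal{G}_+\in\mathrm{sSLM}_{-\mu_-}$) and characteristic exponent $\psi$. Write $f_+=\mathbf{1}_{(0,+\infty)}f$, $f_-=\mathbf{1}_{(-\infty,0)}f$. Then: (a) for any $\theta\in(\mu_-,\mu_+)$ and $x>0$, $$f_\pm(\pm x)=\frac1\pi\lim_{\epsilon\to0+}\int_{\mp\theta}^{+\infty}e^{-tx}\,\Im\psi(\mp(it+\epsilon))\,dt;$$ (b) for any $u,v\in U_\pm$, $0<u<v$, $$\mathcal{G}_\pm((u,v])=\lim_{\epsilon\to0+}\frac1\pi\int_u^v\Im\psi(\mp(it+\epsilon))\,dt;$$ (c) if $\mathcal{G}_\pm(\{\mp\mu_\mp\})=0$, then the formula in (a) for $f_\pm(\pm x)$ holds with $\mp\mu_\mp$ in place of the lower limit $\mp\theta$. (In every formula either all upper signs or all lower signs are taken.)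
   Context: Characteristic exponent: $\mathbb{E}[e^{i\xi X_t}]=e^{-t\psi(\xi)}$; $\psi$ also denotes its analytic continuation to $\mathbb{C}\setminus i((-\infty,\mu_-]\cup[\mu_+,+\infty))$, which exists for these processes. $\mathrm{SM}_0$: non-negative measures $\mathcal{G}$ on $(0,+\infty)$ with $\int(1+t)^{-1}\mathcal{G}(dt)<\infty$; $\mathrm{SM}_\mu$ ($\mu>0$): those supported on $[\mu,+\infty)$. $\mathrm{SLM}_\mu$ ($\mu\ge0$): measures $\mathcal{G}$ for which there exist $a_2,a_1\ge0$, $a_2+a_1>0$, with $(a_2t^2+a_1t)^{-1}\mathcal{G}(dt)\in\mathrm{SM}_\mu$. $\mathrm{sSLM}_\mu$: signed measures $\mathcal{G}=\mathcal{G}_1-\mathcal{G}_2$, $\mathcal{G}_j\in\mathrm{SLM}_\mu$, with Laplace transform non-negative on $(0,+\infty)$. A Lévy process is of class $sSL_{\mu_-,\mu_+}$ if its Lévy density has the form in the claim with $\mathcal{G}_-\in\mathrm{sSLM}_{\mu_+}$ and $\mathcal{G}_+\in\mathrm{sSLM}_{-\mu_-}$. Let $\mathcal{G}_+=\mathcal{G}_{+;+}-\mathcal{G}_{+;-}$ and $\mathcal{G}_-=\mathcal{G}_{-;+}-\mathcal{G}_{-;-}$ be the Jordan decompositions. $U_+$ is the set of common points of continuity of $t\mapsto\mathcal{G}_{+;+}((-\infty,t))$ and $t\mapsto\mathcal{G}_{+;-}((-\infty,t))$; $U_-$ is defined in the same way from $\mathcal{G}_{-;\pm}$. *)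

(* Defs.v *)
From HB Require Import structures.
From mathcomp Require Import all_boot all_order all_algebra complex.
From mathcomp Require Import all_classical all_reals all_analysis.

Set Implicit Arguments.
Unset Strict Implicit.
Unset Printing Implicit Defensive.

Import Order.TTheory GRing.Theory Num.Theory.
Import numFieldNormedType.Exports.

Local Open Scope classical_set_scope.
Local Open Scope ring_scope.
Local Open Scope complex_scope.

Section Complex.
Context {R : realType}.

Definition cexp (z : R[i]) : R[i] :=
  (expR (complex.Re z) * cos (complex.Im z))
    +i* (expR (complex.Re z) * sin (complex.Im z)).

Definition analytic_at (f : R[i] -> R[i]) (z0 : R[i]) : Prop :=
  exists (a : nat -> R[i]) (r : R), 0 < r /\
    forall z : R[i], `|z - z0| < r%:C ->
      series (fun k => a k * (z - z0) ^+ k : R[i]^o) @ \oo --> (f z : R[i]^o).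

Definition analytic_on (f : R[i] -> R[i]) (D : set R[i]) : Prop :=
  forall z, D z -> analytic_at f z.

(* C \ i((-oo, mum] `|` [mup, +oo)) *)
Definition cut_plane (mum mup : R) : set R[i] :=
  [set z | ~ (complex.Re z = 0 /\
              (complex.Im z <= mum \/ mup <= complex.Im z))].

End Complex.

Section LevyProcess.
Context {R : realType} {d : measure_display} {Omega : measurableType d}.
Variable P : probability Omega R.

Record is_levy_process (X : R -> {RV P >-> R}) : Prop := {
  levy_start : {ae P, forall w, X 0 w = 0} ;
  levy_indep : forall (n : nat) (t : nat -> R) (B : nat -> set R),
    0 <= t 0%N -> (forall k, t k <= t k.+1) ->
    (forall k, measurable (B k)) ->
    P [set w | forall k, (k < n)%N -> B k (X (t k.+1) w - X (t k) w)]
    = (\prod_(k < n) P [set w | B k (X (t k.+1) w - X (t k) w)%R])%E ;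
  levy_stationary : forall (s t : R) (B : set R),
    0 <= s -> 0 <= t -> measurable B ->
    P [set w | B (X (s + t) w - X s w)] = P [set w | B (X t w - X 0 w)] ;
  levy_stoch_continuous : forall t eps : R, 0 <= t -> 0 < eps ->
    P [set w | eps < `|X s w - X t w|]
      @[s --> within [set s | 0 <= s] (nbhs t)] --> 0%E ;
  levy_cadlag : {ae P, forall w,
    (forall t : R, 0 <= t -> X s w @[s --> t^'+] --> X t w) /\
    (forall t : R, 0 < t -> cvg (X s w @[s --> t^'-]))} }.

(* E[exp(i xi Y)] *)
Definition char_fun (Y : Omega -> R) (xi : R) : R[i] :=
  fine ('E_P[fun w => cos (xi * Y w)])%E
    +i* fine ('E_P[fun w => sin (xi * Y w)])%E.

(* Only the values of [psi] on the real axis matter here. *)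
Definition is_char_exponent (X : R -> {RV P >-> R}) (psi : R[i] -> R[i]) :
    Prop :=
  forall t xi : R, 0 <= t -> char_fun (X t) xi = cexp (- (t%:C * psi xi%:C)).

Definition is_levy_measure (nu : {measure set (measurableTypeR R) -> \bar R}) :
    Prop :=
  nu [set 0] = 0%E /\
  (\int[nu]_x (Num.min 1 (x ^+ 2))%:E < +oo)%E.

(* sigma^2 xi^2 / 2 - i b xi
     + \int (1 - exp (i xi x) + i xi x 1_{|x| <= 1}) nu(dx) *)
Definition levy_khintchine (sigma2 b : R)
    (nu : {measure set (measurableTypeR R) -> \bar R}) (xi : R) : R[i] :=
  (sigma2 / 2 * xi ^+ 2 + \int[nu]_x (1 - cos (xi * x)))
    +i* (- (b * xi)
         + \int[nu]_x (xi * x * \1_`[-1, 1] x - sin (xi * x))).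

Definition levy_measure_of (X : R -> {RV P >-> R})
    (nu : {measure set (measurableTypeR R) -> \bar R}) : Prop :=
  is_levy_measure nu /\
  exists sigma2 b : R, 0 <= sigma2 /\
    forall t xi : R, 0 <= t ->
      char_fun (X t) xi = cexp (- (t%:C * levy_khintchine sigma2 b nu xi)).

Definition is_levy_density (X : R -> {RV P >-> R}) (f : R -> R) : Prop :=
  measurable_fun [set: R] f /\ (forall x, 0 <= f x) /\
  exists nu : {measure set (measurableTypeR R) -> \bar R},
    levy_measure_of X nu /\
    forall A : set (measurableTypeR R), measurable A ->
      nu A = (\int[lebesgue_measure]_(x in A) (f x)%:E)%E.

End LevyProcess.

Section StieltjesLevy.
Context {R : realType}.
Notation meas := {measure set (measurableTypeR R) -> \bar R}.

(* Measures on (0, +oo) are measures on the line that do not charge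
   (-oo, 0]. *)
Definition SM (mu : R) (G : meas) : Prop :=
  [/\ G `]-oo, 0]%classic = 0%E, G `]-oo, mu[%classic = 0%E &
      (\int[G]_(t in `]0%R, +oo[) ((1 + t)^-1)%:E < +oo)%E].

Definition SLM (mu : R) (G : meas) : Prop :=
  G `]-oo, 0]%classic = 0%E /\
  exists a2 a1 : R, [/\ 0 <= a2, 0 <= a1, 0 < a2 + a1 &
    exists H : meas, SM mu H /\
      forall A : set (measurableTypeR R), measurable A ->
        H A = (\int[G]_(t in A `&` `]0%R, +oo[%classic)
                 ((a2 * t ^+ 2 + a1 * t)^-1)%:E)%E].

(* The signed measure [spos - sneg].  Both parts may have infinite total mass
   (in SLM they are finite on bounded sets), so the library's charges do not
   apply, and the representation is not unique: [spos] and [sneg] need not be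
   mutually singular. *)
Record smeasure := SMeasure { spos : meas ; sneg : meas }.

Definition smeas (G : smeasure) (A : set R) : \bar R :=
  (spos G A - sneg G A)%E.

(* \int_(0, +oo) g(t) G(dt) *)
Definition sint (G : smeasure) (g : R -> R) : R :=
  \int[spos G]_(t in `]0, +oo[) g t - \int[sneg G]_(t in `]0, +oo[) g t.

Definition sSLM (mu : R) (G : smeasure) : Prop :=
  [/\ SLM mu (spos G), SLM mu (sneg G) &
      forall x : R, 0 < x -> 0 <= sint G (fun t => expR (- (t * x)))].

(* [J] is mutually singular and [spos J - sneg J = spos G - sneg G]; the
   equation is written without subtraction because of infinite values. *)
Definition jordan_decomposition_of (G J : smeasure) : Prop :=
  (exists D : set (measurableTypeR R),
     [/\ measurable D, spos J (~` D) = 0%E & sneg J D = 0%E]) /\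
  forall A : set (measurableTypeR R), measurable A ->
    (spos G A + sneg J A = sneg G A + spos J A)%E.

Definition continuity_points (J : smeasure) : set R :=
  [set t | {for t, continuous (fun s : R => spos J `]-oo, s[%classic)} /\
           {for t, continuous (fun s : R => sneg J `]-oo, s[%classic)}].

Definition sSL_density (Gm Gp : smeasure) (x : R) : R :=
  \1_`]-oo, 0[ x * sint Gm (fun t => expR (t * x))
  + \1_`]0, +oo[ x * sint Gp (fun t => expR (- (t * x))).

Record is_sSL (mum mup : R) {d : measure_display} {Omega : measurableType d}
    (P : probability Omega R) (X : R -> {RV P >-> R}) (Gm Gp : smeasure) :
    Prop := {
  sSL_levy : is_levy_process X ;
  sSL_Gm : sSLM mup Gm ;
  sSL_Gp : sSLM (- mum) Gp ;
  sSL_levy_density : is_levy_density X (sSL_density Gm Gp) }.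

End StieltjesLevy.

(* Main.v *)
Require Import Defs.
From HB Require Import structures.
From mathcomp Require Import all_boot all_order all_algebra complex.
From mathcomp Require Import all_classical all_reals all_analysis.
From mathcomp Require Import measurable_realfun.
From mathcomp Require Import ring lra.
Import Order.TTheory GRing.Theory Num.Theory.
Import numFieldNormedType.Exports.
Local Open Scope classical_set_scope.
Local Open Scope ring_scope.
Local Open Scope complex_scope.

(** Off the imaginary axis,
      psi z = a z^2 - i b z + Phi_{G+}(z) + Phi_{G-}(- z),
      Phi_G(z) = \int (1/t - 1/(t - i z) + i z / (1 + t^2)) G(dt).
    On the real axis this is the Levy-Khintchine formula, in which the
    truncation x 1_{|x| <= 1} is traded for sin x (whose Laplace transform is
    1 / (1 + t^2)) and Fubini is applied to the Laplace representation of the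
    density.  Both sides are analytic off the imaginary axis, so the identity
    extends along vertical lines.  Now Im Phi_G(- (e + i t)) is the integral
    against G(ds) of the Poisson kernel e / ((s - t)^2 + e^2) minus
    e / (1 + s^2), whereas G- only contributes kernels with t replaced by - t.
    Integrating in t against g = O((1 + t^2)^-2), exchanging the integrals and
    letting e -> 0 by dominated convergence (the inner integrals are
    O(1 / (s (1 + s)^2)), which is G-integrable) gives
    pi \int (g(s-) + g(s+)) / 2 G(ds).  Parts (a) and (c) are the case
    g(t) = e^(- t x) 1_[a, +oo[(t), part (b) is the case g = 1_[u, v]; the
    half masses produced at the end points vanish because the signed measure
    does not charge them. *)

(** * Complex power series and the identity theorem *)

(** The class SLM controls G only through the weight 1 / (t (1 + t)^2), whatever [a1] and [a2] are,
    and this shapes every estimate: a kernel must decay like t^-3. The difference 1/t - 1/(t - i z)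
    is only O(t^-2); the term i z / (1 + t^2) is there to cancel its leading part. Likewise the
    Poisson kernel must keep its companion e / (1 + s^2) until the integral in t has been bounded.
    Extracting the weight from that difference costs a factor (1 + t^2)^2, which is why g has to be
    O((1 + t^2)^-2). The two half planes are disjoint, so the identity for psi starts from every
    nonzero real point; a vertical line through such a point never meets the cuts. The two parts of
    a signed measure may share mass. At a jump of g neither part need be free of atoms: the half
    masses cancel only in the difference of the two integrals. *)

Section Modulus.
Context {R : realType}.
Implicit Types z w : R[i].

(** The norm on [R[i]] takes its values in [R[i]]; this real copy can be used in real estimates and
    real limits. *)
Definition cmod z : R := complex.Re `|z|.

Lemma cmodE z : `|z| = (cmod z)%:C.
Proof. by rewrite /cmod normc_def. Qed.

Lemma cmod_sqrt z : cmod z = Num.sqrt (complex.Re z ^+ 2 + complex.Im z ^+ 2).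
Proof. by rewrite /cmod normc_def. Qed.

Lemma cmod_ge0 z : 0 <= cmod z.
Proof. by rewrite -lecR -cmodE normr_ge0. Qed.

Lemma cmodM z w : cmod (z * w) = cmod z * cmod w.
Proof. by apply: (@complexI R); rewrite rmorphM/= -!cmodE normrM. Qed.

Lemma cmodX z n : cmod (z ^+ n) = cmod z ^+ n.
Proof. by apply: (@complexI R); rewrite rmorphXn/= -!cmodE normrX. Qed.

Lemma cmod0 : cmod 0 = 0 :> R.
Proof. by rewrite /cmod normr0. Qed.

Lemma cmodN z : cmod (- z) = cmod z.
Proof. by rewrite /cmod normrN. Qed.

Lemma cmodB z w : cmod (z - w) = cmod (w - z).
Proof. by rewrite /cmod distrC. Qed.

Lemma cmodD z w : cmod (z + w) <= cmod z + cmod w.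
Proof. by rewrite -lecR rmorphD/= -!cmodE ler_normD. Qed.

Lemma cmod_eq0 z : (cmod z == 0) = (z == 0).
Proof. by rewrite -(inj_eq (@complexI R)) -cmodE normr_eq0. Qed.

Lemma cmod_gt0 z : (0 < cmod z) = (z != 0).
Proof. by rewrite lt_def cmod_ge0 andbT cmod_eq0. Qed.

Lemma cmodV z : cmod z^-1 = (cmod z)^-1.
Proof. by apply: (@complexI R); rewrite fmorphV/= -!cmodE normfV. Qed.

Lemma cmod_real (x : R) : cmod x%:C = `|x|.
Proof. by rewrite cmod_sqrt/= expr0n/= addr0 sqrtr_sqr. Qed.

Lemma cmod_imag (x : R) : cmod (0 +i* x) = `|x|.
Proof. by rewrite cmod_sqrt/= expr0n/= add0r sqrtr_sqr. Qed.

Lemma Re_le_cmod z : `|complex.Re z| <= cmod z.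
Proof. by rewrite cmod_sqrt -sqrtr_sqr ler_wsqrtr// lerDl sqr_ge0. Qed.

Lemma Im_le_cmod z : `|complex.Im z| <= cmod z.
Proof. by rewrite cmod_sqrt -sqrtr_sqr ler_wsqrtr// lerDr sqr_ge0. Qed.

Lemma cmod_le z : cmod z <= `|complex.Re z| + `|complex.Im z|.
Proof.
case: z => a b; have -> : a +i* b = a%:C + (0 +i* b).
  by apply/eqP; rewrite eq_complex/= add0r addr0 !eqxx.
by rewrite (le_trans (cmodD _ _))// cmod_real cmod_imag/= add0r addr0.
Qed.

Lemma ReD z w : complex.Re (z + w) = complex.Re z + complex.Re w.
Proof. by case: z w => [a b] [c d]. Qed.

Lemma ImD z w : complex.Im (z + w) = complex.Im z + complex.Im w.
Proof. by case: z w => [a b] [c d]. Qed.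

Lemma cvg_cmodP (u : nat -> R[i]) (l : R[i]) :
  u @ \oo --> (l : R[i]^o) <-> cmod (u n - l) @[n --> \oo] --> (0 : R).
Proof.
split => [/(@cvgrPdist_lt R[i] R[i]^o) ul|/cvgrPdist_lt ul].
- apply/cvgrPdist_lt => e e0; have := ul e%:C; rewrite ltcR => /(_ e0); apply: filterS => n.
  rewrite cmodE ltcR sub0r normrN ger0_norm ?cmod_ge0//.
  by rewrite -cmodN opprB.
(* A positive element of [R[i]] has imaginary part zero, so real radii are enough. *)
- apply/(@cvgrPdist_lt R[i] R[i]^o) => -[a b]; rewrite ltcE/= => /andP[/eqP b0 a0].
  have := ul _ a0; apply: filterS => n.
  rewrite sub0r normrN ger0_norm ?cmod_ge0// => un.
  by rewrite b0 complexr0 cmodE ltcR cmodB.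
Qed.

End Modulus.

Section PowerSeries.
Context {R : realType}.
Implicit Types (f g : R[i] -> R[i]) (z : R[i]).

Lemma eq_series_cvg (u v : nat -> R[i]) (l : R[i]) : u =1 v ->
  series (u : nat -> R[i]^o) @ \oo --> (l : R[i]^o) ->
  series (v : nat -> R[i]^o) @ \oo --> (l : R[i]^o).
Proof. by move=> /funext ->. Qed.

Lemma cvgC_mull (c : R[i]) (u : nat -> R[i]) (l : R[i]) :
  u @ \oo --> (l : R[i]^o) -> (fun n => c * u n) @ \oo --> (c * l : R[i]^o).
Proof.
move=> /cvg_cmodP ul; apply/cvg_cmodP.
rewrite (_ : (fun n => _) = (fun n => cmod c * cmod (u n - l))); last first.
  by apply/funext => n; rewrite -mulrBr cmodM.
by rewrite -(mulr0 (cmod c)); exact: cvgMl_tmp ul.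
Qed.

Lemma cvg_eq_shift (u v : nat -> R[i]) (l : R[i]) : (forall n, u n.+1 = v n) ->
  v @ \oo --> (l : R[i]^o) -> u @ \oo --> (l : R[i]^o).
Proof. by move=> /funext <-; rewrite (@cvg_shiftS R[i]^o). Qed.

Lemma analytic_atD f g z :
  analytic_at f z -> analytic_at g z -> analytic_at (fun x => f x + g x) z.
Proof.
move=> [a [r [r0 fa]]] [b [s [s0 gb]]].
exists (fun k => a k + b k), (Num.min r s); split; first by rewrite lt_min r0.
move=> x; rewrite cmodE ltcR lt_min => /andP[xr xs].
have := fa x; rewrite cmodE ltcR => /(_ xr) {}fa.
have := gb x; rewrite cmodE ltcR => /(_ xs) {}gb.
have := @cvgD _ R[i]^o _ _ eventually_filter _ _ _ _ fa gb.
rewrite -seriesD; refine (@eq_series_cvg _ _ (f x + g x) _).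
by move=> k; rewrite /= mulrDl.
Qed.

Lemma analytic_atN f z : analytic_at f z -> analytic_at (fun x => - f x) z.
Proof.
move=> [a [r [r0 fa]]]; exists (fun k => - a k), r; split; [exact: r0|move=> x xr].
have {}fa := fa x xr.
have := @cvgC_mull (- 1) _ _ fa; rewrite mulN1r.
rewrite (_ : (fun n => _) = series (fun k => - a k * (x - z) ^+ k : R[i]^o))//.
apply/funext => n; rewrite /series/= mulr_sumr; apply: eq_bigr => k _.
by rewrite mulN1r mulNr.
Qed.

Lemma analytic_at_cst (c : R[i]) z : analytic_at (fun=> c) z.
Proof.
exists (fun k => if k is 0%N then c else 0), 1; split; [exact: ltr01|move=> x _].
refine (@cvg_eq_shift _ (cst c) c _ _); last exact: (@cvg_cst R[i]^o).
move=> n; rewrite /series/= big_nat_recl//= expr0 mulr1 big1 ?addr0//.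
by move=> i _; rewrite mul0r.
Qed.

(* With x = (x - z) + z, multiplying the expansion of f at z by x sends the
   coefficients a_k to a_(k-1) + z a_k. *)
Lemma analytic_at_mulX f z : analytic_at f z -> analytic_at (fun x => x * f x) z.
Proof.
move=> [a [r [r0 fa]]].
exists (fun k => (if k is k'.+1 then a k' else 0) + z * a k), r; split; [exact: r0|move=> x xr].
have {}fa := fa x xr.
have E n : series (fun k => ((if k is k'.+1 then a k' else 0) + z * a k)
      * (x - z) ^+ k : R[i]^o) n.+1 =
    (x - z) * series (fun k => a k * (x - z) ^+ k : R[i]^o) n
    + z * series (fun k => a k * (x - z) ^+ k : R[i]^o) n.+1.
  rewrite /series/= (eq_bigr (fun k => (if k is k'.+1 then a k' else 0)
    * (x - z) ^+ k + z * (a k * (x - z) ^+ k))); last first.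
    by move=> i _; rewrite mulrDl mulrA.
  rewrite big_split/= -mulr_sumr; congr (_ + _).
  rewrite big_nat_recl//= mul0r add0r mulr_sumr; apply: eq_bigr => i _.
  by rewrite exprS mulrCA.
rewrite (_ : x * f x = (x - z) * f x + z * f x); last by rewrite -mulrDl subrK.
refine (@cvg_eq_shift _ _ _ E _).
apply: (@cvgD _ R[i]^o _ _ eventually_filter); first exact: cvgC_mull fa.
by apply: cvgC_mull; rewrite (@cvg_shiftS R[i]^o).
Qed.

Lemma analytic_at_comp_opp f z :
  analytic_at f (- z) -> analytic_at (fun x => f (- x)) z.
Proof.
move=> [a [r [r0 fa]]].
exists (fun k => a k * (- 1) ^+ k), r; split; [exact: r0|move=> x xz].
have := fa (- x); rewrite opprK addrC distrC => /(_ xz).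
refine (@eq_series_cvg _ _ (f (- x)) _) => k.
by rewrite -mulrA -exprMn mulN1r opprB.
Qed.

Lemma eq_analytic_at f g z : f =1 g -> analytic_at f z -> analytic_at g z.
Proof. by move=> /funext ->. Qed.

Lemma series_term_bounded (u : nat -> R[i]) (l : R[i]) :
  series (u : nat -> R[i]^o) @ \oo --> (l : R[i]^o) ->
  exists2 M : R, 0 <= M & forall k, cmod (u k) <= M.
Proof.
move=> /cvg_cmodP /cvgrPdist_lt /(_ _ ltr01)[N _ Nl].
(* The sum covers the terms before [N]; a later term is the difference of two partial sums at
   distance less than 1 from [l], whence the 2. *)
exists (\sum_(0 <= k < N) cmod (u k) + 2).
  by rewrite addr_ge0// sumr_ge0// => i _; exact: cmod_ge0.
move=> k; have [kN|Nk] := ltnP k N.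
  rewrite (bigD1_seq k)//= ?iota_uniq ?mem_index_iota// -addrA lerDl.
  by rewrite addr_ge0// sumr_ge0// => i _; exact: cmod_ge0.
have := Nl k Nk; have := Nl k.+1 (leqW Nk).
rewrite /= !sub0r !normrN !ger0_norm ?cmod_ge0// => s1 s2.
rewrite (_ : u k = (series (u : nat -> R[i]^o) k.+1 - l)
  - (series (u : nat -> R[i]^o) k - l)); last first.
  by rewrite /series/= big_nat_recr//= opprB addrA subrK addrAC subrr add0r.
rewrite (le_trans (cmodD _ _))// cmodN.
have : 0 <= \sum_(0 <= k0 < N) cmod (u k0).
  by rewrite sumr_ge0// => i _; exact: cmod_ge0.
lra.
Qed.

Lemma sum_nat_split (V : nmodType) (u : nat -> V) (m n : nat) :
  (forall j, (j < m)%N -> u j = 0) ->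
  \sum_(0 <= k < m.+1 + n) u k = u m + \sum_(m.+1 <= k < m.+1 + n) u k.
Proof.
move=> u0; rewrite (@big_cat_nat _ _ _ m)//=; last by rewrite addSnnS leq_addr.
rewrite big_nat big1 ?add0r; last by move=> i /andP[_ im]; rewrite u0.
by rewrite big_ltn// ltnS leq_addr.
Qed.

(* If the coefficients below m vanish, a zero at distance d from the centre
   forces |a_m| <= C d. *)
Lemma ps_first_coef (a : nat -> R[i]) (h : R[i]) (M rho : R) (m : nat) :
  0 < rho -> 0 <= M -> (forall k, cmod (a k) * rho ^+ k <= M) ->
  (forall j, (j < m)%N -> a j = 0) ->
  h != 0 -> cmod h <= rho / 2 ->
  series (fun k => a k * h ^+ k : R[i]^o) @ \oo --> (0 : R[i]^o) ->
  cmod (a m) <= 2 * M / rho ^+ m.+1 * cmod h.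
Proof.
move=> rho0 M0 aM aj h0 hrho sa.
pose q := cmod h / rho.
have h_gt0 : 0 < cmod h by rewrite cmod_gt0.
have q0 : 0 <= q by rewrite divr_ge0 ?cmod_ge0 ?ltW.
have q2 : q <= 2^-1 by rewrite /q ler_pdivrMr// mulrC.
have ak k : cmod (a k * h ^+ k) <= M * q ^+ k.
  rewrite cmodM cmodX /q exprMn exprVn mulrA [leRHS]mulrAC.
  by rewrite ler_wpM2r ?exprn_ge0 ?cmod_ge0// ler_pdivlMr ?exprn_gt0.
(* Since [q <= 1/2], the terms after [m] are dominated by [M * q ^+ m.+1] times 1, 1/2, 1/4, and so
   on; the first [n] of these factors add up to exactly 2 - 2 / 2^n, a form that the induction can
   carry. *)
have T n : cmod (\sum_(m.+1 <= k < m.+1 + n) a k * h ^+ k)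
    <= M * q ^+ m.+1 * (2 - 2 * 2^-1 ^+ n).
  elim: n => [|n IH].
    by rewrite addn0 big_geq// cmod0 expr0 mulr1 subrr mulr0.
  rewrite addnS big_nat_recr//= ?leq_addr//.
  rewrite (le_trans (cmodD _ _))//.
  have : cmod (a (m.+1 + n)%N * h ^+ (m.+1 + n)) <= M * q ^+ m.+1 * 2^-1 ^+ n.
    rewrite (le_trans (ak _))// exprD mulrA ler_wpM2l//.
      by rewrite mulr_ge0 ?exprn_ge0.
    by rewrite lerXn2r ?nnegrE ?invr_ge0.
  set A := M * _; rewrite exprS mulrA mulfV ?pnatr_eq0// mul1r.
  move: IH; rewrite -/A; lra.
have S n : series (fun k => a k * h ^+ k : R[i]^o) (m.+1 + n)%N =
    a m * h ^+ m + \sum_(m.+1 <= k < m.+1 + n) a k * h ^+ k.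
  apply: (@sum_nat_split R[i] (fun k => a k * h ^+ k)) => j /aj ->.
  by rewrite mul0r.
have le1 : cmod (a m * h ^+ m) <= 2 * (M * q ^+ m.+1).
  apply/ler_addgt0Pr => e e0.
  move: sa => /cvg_cmodP /cvgrPdist_lt /(_ _ e0)[N _ /(_ (m.+1 + N)%N)].
  rewrite /= leq_addl => /(_ isT); rewrite sub0r normrN ger0_norm ?cmod_ge0//.
  rewrite subr0 S => /ltW sN.
  rewrite -[X in cmod X](addrK (\sum_(m.+1 <= k < m.+1 + N) a k * h ^+ k)).
  rewrite (le_trans (cmodD _ _))// addrC cmodN lerD//.
  rewrite (le_trans (T _))// mulrC ler_wpM2r ?mulr_ge0 ?exprn_ge0//.
  by rewrite gerBl mulr_ge0 ?exprn_ge0 ?invr_ge0.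
move: le1; rewrite cmodM cmodX -ler_pdivlMr ?exprn_gt0//.
move=> /le_trans; apply; rewrite /q exprMn exprVn exprS.
rewrite (_ : _ / _ = 2 * M / rho ^+ m.+1 * cmod h)//.
by field; rewrite ?expf_neq0// ?gt_eqF.
Qed.

(** All coefficients vanish by strong induction: once those below [m] do, [ps_first_coef] at zeros
    ever closer to [z] makes [a m] smaller than any positive number. *)
Lemma ps_accumulating_zeros g z (a : nat -> R[i]) (r : R) : 0 < r ->
  (forall x, cmod (x - z) < r ->
     series (fun k => a k * (x - z) ^+ k : R[i]^o) @ \oo --> (g x : R[i]^o)) ->
  (forall e : R, 0 < e -> exists2 x, x != z & cmod (x - z) < e /\ g x = 0) ->
  forall x, cmod (x - z) < r -> g x = 0.
Proof.
move=> r0 ga gz.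
(* Convergence at the interior point [z + rho%:C] bounds the terms there, which is the growth bound
   on the coefficients that [ps_first_coef] asks for. *)
pose rho := r / 2; have rho0 : 0 < rho by rewrite divr_gt0.
have [M M0 aM] : exists2 M : R, 0 <= M & forall k, cmod (a k) * rho ^+ k <= M.
  have := ga (z + rho%:C); rewrite addrC addKr cmod_real gtr0_norm// => gr.
  have [|M M0 kM] := series_term_bounded _ _ (gr _).
    by rewrite /rho; lra.
  exists M => // k; rewrite (le_trans _ (kM k))//.
  by rewrite cmodM cmodX cmod_real gtr0_norm.
have a0 m : a m = 0.
  have [n] := ubnP m; elim: n m => // n IH m mn.
  have am (j : nat) : (j < m)%N -> a j = 0.
    by move=> jm; apply: IH; rewrite (leq_trans jm).
  apply/eqP; rewrite -cmod_eq0 eq_le cmod_ge0 andbT.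
  apply/ler_addgt0Pr => e e0; rewrite add0r.
  pose C := 2 * M / rho ^+ m.+1.
  have C0 : 0 <= C by rewrite divr_ge0 ?mulr_ge0 ?exprn_ge0// ltW.
  (* [C + 1] rather than [C] since [C] may be zero. *)
  have [|x xz [xe gx0]] := gz (Num.min (rho / 2) (e / (C + 1))).
    by rewrite lt_min !divr_gt0// ltr_wpDl.
  move: xe; rewrite lt_min => /andP[x1]; rewrite ltr_pdivlMr ?ltr_wpDl// => x2.
  have := @ps_first_coef a (x - z) M rho m rho0 M0 aM am.
  rewrite subr_eq0 => /(_ xz (ltW x1)) amx.
  have xr : cmod (x - z) < r by apply: (lt_trans x1); rewrite /rho; lra.
  have := ga _ xr; rewrite gx0 => /amx /le_trans; apply.
  by rewrite -/C (le_trans _ (ltW x2))// mulrC ler_wpM2l ?cmod_ge0// lerDl ler01.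
move=> x xr; have := ga x xr; rewrite (_ : series _ = cst 0); last first.
  by apply/funext => n; rewrite /series/= big1// => i _; rewrite a0 mul0r.
move=> /cvg_cmodP; rewrite (_ : (fun n => _) = cst (cmod (- g x))); last first.
  by apply/funext => n; rewrite /= add0r.
move=> /(cvg_lim (@Rhausdorff R)); rewrite lim_cst; last exact: Rhausdorff.
by move=> /eqP; rewrite cmod_eq0 oppr_eq0 => /eqP.
Qed.

End PowerSeries.

Section IdentityTheorem.
Context {R : realType}.

(** A continuation argument on the segment [p] from the real point [x] to [x +i* y]. Its real part
    is constant, so [g] has a power series at each of its points; the one at the supremum of the
    range where [g] vanishes pushes that range further. *)
Lemma half_plane_identity (g : R[i] -> R[i]) :
  (forall z : R[i], complex.Re z != 0 -> analytic_at g z) ->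
  (forall x : R, x != 0 -> g x%:C = 0) ->
  forall z : R[i], complex.Re z != 0 -> g z = 0.
Proof.
move=> ga gR [x y] /= x0.
have [->|y0] := eqVneq y 0; first by rewrite complexr0 gR.
pose p (s : R) : R[i] := x +i* (s * y).
have pB s t : cmod (p s - p t) = `|s - t| * `|y|.
  rewrite (_ : p s - p t = 0 +i* ((s - t) * y)) ?cmod_imag ?normrM//.
  by apply/eqP; rewrite eq_complex/= subrr mulrBl !eqxx.
pose A := [set s : R | 0 <= s <= 1 /\ forall t : R, 0 <= t <= s -> g (p t) = 0].
have p0 : g (p 0) = 0 by rewrite /p mul0r complexr0 gR.
have A0 : A 0.
  split; first by rewrite lexx ler01.
  by move=> t /andP[t0 t0']; rewrite (_ : t = 0)//; apply/le_anti/andP.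
have supA : has_sup A by split; [exists 0|exists 1 => s [/andP[]]].
have s0 : 0 <= sup A by apply: ub_le_sup => //; case: supA.
have s1 : sup A <= 1 by apply: ge_sup; [exists 0|move=> s [/andP[]]].
have lts (t : R) : 0 <= t -> t < sup A -> g (p t) = 0.
  move=> t0 ts; have ts0 : 0 < sup A - t by rewrite subr_gt0.
  have [a [_ ga0] ta] := sup_adherent ts0 supA.
  by apply: ga0; rewrite t0/= ltW//; move: ta; rewrite subKr.
have [a [r [r0 gr]]] := ga (p (sup A)) x0.
have {}gr z : cmod (z - p (sup A)) < r ->
    series (fun k => a k * (z - p (sup A)) ^+ k : R[i]^o) @ \oo --> (g z : R[i]^o).
  by move=> zr; apply: gr; rewrite cmodE ltcR.
have ny0 : 0 < `|y| by rewrite normr_gt0.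
(* If [sup A > 0], zeros accumulate at [p (sup A)] along the segment. If [sup A = 0] no earlier
   point exists and the zeros are taken on the real axis, at [x + h]; the bound [h <= |x| / 2] keeps
   them away from the origin, where [g] is not assumed to vanish. *)
have acc (e : R) : 0 < e ->
    exists2 z, z != p (sup A) & cmod (z - p (sup A)) < e /\ g z = 0.
  move=> e0; have [s00|sn0] := eqVneq (sup A) 0; last first.
    have sgt0 : 0 < sup A by rewrite lt_def sn0.
    pose t := Num.max (sup A / 2) (sup A - e / (2 * `|y|)).
    have ey : 0 < e / (2 * `|y|) by rewrite divr_gt0// mulr_gt0.
    have ts : t < sup A.
      by rewrite gt_max; apply/andP; split; [lra|rewrite ltrBlDr ltrDl].
    have t0 : 0 <= t by rewrite le_max divr_ge0.
    exists (p t).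
      rewrite -subr_eq0 -cmod_eq0 pB mulf_neq0 ?gt_eqF// normr_gt0 subr_eq0.
      by rewrite lt_eqF.
    split; last exact: lts.
    rewrite pB distrC gtr0_norm ?subr_gt0//.
    apply: (@le_lt_trans _ _ (e / (2 * `|y|) * `|y|)).
      rewrite ler_wpM2r// lerBlDr -lerBlDl /t le_max lexx orbT//.
    by rewrite invfM mulrA mulfVK ?gt_eqF//; lra.
  rewrite s00.
  pose h := Num.min (e / 2) (`|x| / 2).
  have h0 : 0 < h by rewrite lt_min !divr_gt0// normr_gt0.
  exists ((x + h)%:C).
    apply/eqP => -[/eqP]; rewrite -subr_eq0 addrAC subrr add0r => /eqP hh.
    by rewrite hh ltxx in h0.
  split.
    rewrite /p mul0r complexr0 -rmorphB/= cmod_real addrAC subrr add0r.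
    by rewrite gtr0_norm// gt_min; apply/orP; left; lra.
  rewrite gR//; apply/negP => /eqP xh.
  have hx : h <= `|x| / 2 by rewrite ge_min lexx orbT.
  move: hx; rewrite (_ : x = - h) ?normrN ?(gtr0_norm h0); last lra.
  by lra.
have gz := @ps_accumulating_zeros _ _ _ _ _ r0 gr acc.
pose del := r / (2 * `|y|).
have del0 : 0 < del by rewrite divr_gt0// mulr_gt0.
have gdel (t : R) : `|t - sup A| <= del -> g (p t) = 0.
  move=> tdel; apply: gz; rewrite pB.
  apply: (@le_lt_trans _ _ (del * `|y|)); first by rewrite ler_wpM2r.
  by rewrite /del invfM mulrA mulfVK ?gt_eqF//; lra.
have [sA1|sA1] := eqVneq (sup A) 1.
  have := gdel 1; rewrite sA1 subrr normr0 => /(_ (ltW del0)).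
  by rewrite /p mul1r.
(* As [sup A < 1] here, [m] lies beyond [sup A], so its membership in [A] is absurd. *)
pose m := Num.min 1 (sup A + del).
suff : A m.
  move=> /(ub_le_sup (proj2 supA)); rewrite ge_min.
  have : sup A < 1 by rewrite lt_neqAle sA1.
  by move=> sA /orP[|]; [rewrite leNgt sA|rewrite gerDl leNgt del0].
split; first by rewrite le_min ler01 addr_ge0 ?(ltW del0)// ge_min lexx.
move=> t /andP[t0]; rewrite le_min => /andP[t1 ts].
have [/lts|st] := ltP t (sup A); first exact.
by apply: gdel; rewrite ger0_norm ?subr_ge0// lerBlDl.
Qed.

End IdentityTheorem.

(** * Integrals with respect to sigma-finite measures *)

Section Density.
Local Open Scope ereal_scope.
Context d (T : measurableType d) (R : realType).
Import HBNNSimple.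

(** For simple functions this is the hypothesis on level sets combined with additivity; monotone
    convergence along the same approximating sequence on both sides does the rest. *)
Lemma ge0_integral_density (m n : {measure set T -> \bar R}) (h : T -> R)
    (g : T -> \bar R) :
  measurable_fun setT h -> (forall x, 0 <= h x)%R ->
  measurable_fun setT g -> (forall x, 0 <= g x) ->
  (forall A, measurable A -> n A = \int[m]_(x in A) (h x)%:E) ->
  \int[n]_x g x = \int[m]_x (g x * (h x)%:E).
Proof.
move=> mh h0 mg g0 nE.
have mhE : measurable_fun setT (EFin \o h) by exact/measurable_EFinP.
pose u := nnsfun_approx measurableT mg.
have u_nd x : {homo (fun k => u k x) : a b / (a <= b)%N >-> (a <= b)%R}.
  by move=> a b ab; exact/lefP/nd_nnsfun_approx.
have simple k : \int[n]_x (u k x)%:E = \int[m]_x ((u k x)%:E * (h x)%:E).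
  rewrite integral_nnsfun//= patch_setT sintegralE.
  rewrite (eq_integral (fun x => \sum_(r \in range (u k))
    ((r * \1_(u k @^-1` [set r]) x)%:E * (h x)%:E))); last first.
    move=> x _; rewrite {1}fimfunE -fsumEFin// ge0_mule_fsuml// => r.
    exact: nnfun_muleindic_ge0.
  have mind r : measurable_fun setT
      (fun x => (r * \1_(u k @^-1` [set r]) x)%:E : \bar R).
    by apply/measurable_EFinP; exact: measurable_funM.
  rewrite ge0_integral_fsum//; last 2 first.
  - by move=> r; apply: emeasurable_funM.
  - by move=> r x _; rewrite mule_ge0 ?lee_fin// -lee_fin nnfun_muleindic_ge0.
  apply: eq_fsbigr => r /[!inE] -[x _ <-].
  under eq_integral do rewrite EFinM -muleA.
  rewrite ge0_integralZl//; last 3 first.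
  - by apply: emeasurable_funM => //; exact/measurable_EFinP.
  - by move=> y _; rewrite mule_ge0 ?lee_fin.
  - by rewrite lee_fin.
  congr (_ * _); rewrite nE// -[in LHS](setTI (u k @^-1` _)) integral_mkcondr/=.
  by apply: eq_integral => y _; rewrite epatch_indic muleC.
have cvg_u x : (u k x)%:E @[k --> \oo] --> g x by exact: cvg_nnsfun_approx.
transitivity (limn (fun k => \int[n]_x (u k x)%:E)).
  rewrite -monotone_convergence//; last 3 first.
  - by move=> k; exact/measurable_EFinP.
  - by move=> k x _; rewrite lee_fin.
  - by move=> x _ a b ab; rewrite lee_fin u_nd.
  by apply: eq_integral => x _; exact/esym/cvg_lim.
under eq_fun do rewrite simple.
rewrite -monotone_convergence//; last 3 first.
- by move=> k; apply: emeasurable_funM => //; exact/measurable_EFinP.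
- by move=> k x _; rewrite mule_ge0 ?lee_fin.
- by move=> x _ a b ab; rewrite lee_wpmul2r ?lee_fin ?u_nd.
by apply: eq_integral => x _; apply/cvg_lim => //; exact: cvgeZr.
Qed.

Lemma Rintegral_density (m n : {measure set T -> \bar R}) (h g : T -> R) :
  measurable_fun setT h -> (forall x, 0 <= h x)%R ->
  (forall A, measurable A -> n A = \int[m]_(x in A) (h x)%:E) ->
  n.-integrable setT (EFin \o g) ->
  m.-integrable setT (fun x => (g x * h x)%:E) /\
  (\int[n]_x g x = \int[m]_x (g x * h x))%R.
Proof.
move=> mh h0 nE /[dup] /measurable_int mg /integrableP[_ gfin].
have mhE : measurable_fun setT (EFin \o h) by exact/measurable_EFinP.
have mgh : measurable_fun setT (fun x => (g x * h x)%:E).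
  by apply/measurable_EFinP/measurable_funM => //; exact/measurable_EFinP.
split.
  apply/integrableP; split => //; apply: le_lt_trans gfin.
  rewrite [leRHS](@ge0_integral_density m n h)//; last exact: measurableT_comp.
  by under eq_integral do rewrite EFinM abseM [`|(h _)%:E|]gee0_abs ?lee_fin//.
rewrite /Rintegral; congr fine; rewrite integralE [RHS]integralE.
rewrite (@ge0_integral_density m n h)//; last exact: measurable_funepos.
rewrite (@ge0_integral_density m n h _^\-)//; last exact: measurable_funeneg.
congr (_ - _); apply: eq_integral => x _.
  by rewrite !funeposE/= -!EFin_max -EFinM maxr_pMl// mul0r.
by rewrite !funenegE/= -!EFin_max -EFinM maxr_pMl// mul0r mulNr.
Qed.

End Density.

Section SigmaFiniteAlias.
Context d (T : measurableType d) (R : realType).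

(* A copy of [m] that carries the sigma-finite structure given by the proof. *)
Definition sf_measure (m : {measure set T -> \bar R})
  of sigma_finite [set: T] m : set T -> \bar R := m.

Context (m : {measure set T -> \bar R}) (hm : sigma_finite [set: T] m).

HB.instance Definition _ := Measure.on (sf_measure m hm).
HB.instance Definition _ :=
  @Measure_isSigmaFinite.Build d T R (sf_measure m hm) hm.

End SigmaFiniteAlias.
Arguments sf_measure {d T R m}.

Section Fubini.
Context d1 d2 (T1 : measurableType d1) (T2 : measurableType d2) (R : realType).

(** Tonelli and the bound [B] on the integrals in the first variable give integrability on the
    product. The last hypothesis makes the other inner integral finite at every [x] of [D1], not
    just almost everywhere, so that taking [fine] inside the iterated integral changes nothing. *)
Lemma Rintegral_Fubini (m1 : {measure set T1 -> \bar R})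
    (m2 : {measure set T2 -> \bar R}) (D1 : set T1) (D2 : set T2)
    (k : T1 -> T2 -> R) (B : T2 -> R) :
  sigma_finite setT m1 -> sigma_finite setT m2 ->
  measurable D1 -> measurable D2 ->
  measurable_fun setT (fun z : T1 * T2 => k z.1 z.2) ->
  m2.-integrable D2 (EFin \o B) ->
  (forall y, D2 y -> (\int[m1]_(x in D1) `|k x y|%:E <= (B y)%:E)%E) ->
  (forall x, D1 x -> m2.-integrable D2 (fun y => (k x y)%:E)) ->
  [/\ m1.-integrable D1 (fun x => (\int[m2]_(y in D2) k x y)%:E),
      m2.-integrable D2 (fun y => (\int[m1]_(x in D1) k x y)%:E) &
      \int[m1]_(x in D1) \int[m2]_(y in D2) k x y =
      \int[m2]_(y in D2) \int[m1]_(x in D1) k x y].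
Proof.
move=> sf1 sf2 mD1 mD2 mk iB kB ik.
have mkx x : measurable_fun setT (k x).
  exact: (measurableT_comp mk (pair1_measurable x)).
have mky y : measurable_fun setT (k ^~ y).
  exact: (measurableT_comp mk (pair2_measurable y)).
have ik1 y : D2 y -> m1.-integrable D1 (fun x => (k x y)%:E).
  move=> D2y; apply/integrableP; split.
    exact/measurable_EFinP/measurable_funTS.
  exact: le_lt_trans (kB _ D2y) (ltry _).
(* Cutting off by the rectangle reduces the claim to Fubini on the whole product space. *)
pose f (z : T1 * T2) : \bar R := ((k z.1 z.2)%:E * (\1_(D1 `*` D2) z)%:E)%E.
have mf : measurable_fun setT f.
  apply: emeasurable_funM; first exact/measurable_EFinP.
  by apply/measurable_EFinP/measurable_indic; exact: measurableX.
have fE x y : f (x, y) = ((k x y * \1_D1 x * \1_D2 y)%:E)%E.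
  rewrite /f/= -EFinM -mulrA; congr (_ * _)%:E.
  by rewrite !indicE in_setX/= -natrM mulnb.
have fE1 x : (fun y => f (x, y)) = (fun y => (k x y * \1_D1 x)%:E) \_ D2.
  apply/funext => y; rewrite fE patchE [\1_D2 y]indicE.
  by case: ifPn => _; rewrite ?mulr1 ?mulr0.
have fE2 y : (fun x => f (x, y)) = (fun x => (k x y * \1_D2 y)%:E) \_ D1.
  apply/funext => x; rewrite fE patchE mulrAC [\1_D1 x]indicE.
  by case: ifPn => _; rewrite ?mulr1 ?mulr0.
pose n1 : {sigma_finite_measure set T1 -> \bar R} := sf_measure sf1.
pose n2 : {sigma_finite_measure set T2 -> \bar R} := sf_measure sf2.
have intf : (n1 \x n2)%E.-integrable setT f.
  apply/integrable21ltyP => //.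
  apply: (@le_lt_trans _ _ (\int[m2]_(y in D2) (`|B y|)%:E)%E); last first.
    by move/integrableP : iB => [].
  rewrite [leRHS]integral_mkcond; apply: ge0_le_integral => //.
  - by move=> y _; apply: integral_ge0 => x _; exact: abse_ge0.
  - apply: (@measurable_fun_fubini_tonelli_G _ _ _ _ _ n1 (abse \o f));
      [by apply: measurableT_comp|by move=> z; exact: abse_ge0].
  - apply/(measurable_restrictT _ mD2)/measurable_EFinP.
    by apply: measurableT_comp => //; apply/measurable_EFinP/(measurable_int m2).
  move=> y _; rewrite patchE; case: ifPn => [/[!inE] D2y|yD2].
    apply: (@le_trans _ _ (B y)%:E); last by rewrite lee_fin ler_norm.
    apply: le_trans (kB _ D2y); rewrite [leRHS]integral_mkcond.
    apply: ge0_le_integral => //.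
    - apply: measurableT_comp => //; rewrite fE2.
      by apply/(measurable_restrictT _ mD1)/measurable_EFinP/measurable_funTS/measurable_funM.
    - by apply/(measurable_restrictT _ mD1)/measurable_EFinP/measurable_funTS/measurableT_comp.
    move=> x _; rewrite (congr1 (@^~ x) (fE2 y)) !patchE.
    case: ifPn => _; last by rewrite abse0.
    by rewrite /= indicE mem_set// mulr1.
  rewrite (eq_integral (cst 0%E)) ?integral0// => x _.
  by rewrite fE [X in (_ * X)%:E]indicE (negbTE yD2) mulr0 /= normr0.
have F1 x : D1 x -> fubini_F n2 f x = (\int[m2]_(y in D2) k x y)%:E.
  move=> D1x; rewrite /fubini_F fE1 -integral_mkcond /Rintegral fineK; last first.
    by apply: integrable_fin_num => //; exact: ik.
  by apply: eq_integral => y _; rewrite indicE mem_set// mulr1.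
have F2 y : D2 y -> fubini_G n1 f y = (\int[m1]_(x in D1) k x y)%:E.
  move=> D2y; rewrite /fubini_G fE2 -integral_mkcond /Rintegral fineK; last first.
    by apply: integrable_fin_num => //; exact: ik1.
  by apply: eq_integral => x _; rewrite indicE mem_set// mulr1.
have F10 x : ~ D1 x -> fubini_F n2 f x = 0%E.
  move=> D1x; rewrite /fubini_F fE1 -integral_mkcond; apply: integral0_eq => y _.
  by rewrite indicE memNset// mulr0.
have F20 y : ~ D2 y -> fubini_G n1 f y = 0%E.
  move=> D2y; rewrite /fubini_G fE2 -integral_mkcond; apply: integral0_eq => x _.
  by rewrite indicE memNset// mulr0.
have FD1 : (fun x => (\int[m2]_(y in D2) k x y)%:E) \_ D1 = fubini_F n2 f.
  by apply/funext => x; rewrite patchE; case: ifPn => [/set_mem/F1|/negP xD];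
    [move=> ->|rewrite F10// => /mem_set].
have FD2 : (fun y => (\int[m1]_(x in D1) k x y)%:E) \_ D2 = fubini_G n1 f.
  by apply/funext => x; rewrite patchE; case: ifPn => [/set_mem/F2|/negP xD];
    [move=> ->|rewrite F20// => /mem_set].
split.
- by apply/(integrable_mkcond _ mD1); rewrite FD1; exact: (integrable_fubini_F intf).
- apply/(integrable_mkcond _ mD2); rewrite FD2 /fubini_G.
  apply/integrableP; split; first exact: (measurable_fubini_G intf).
  have /integrable21ltyP : (n1 \x n2)%E.-integrable setT f by [].
  move=> /(_ mf); apply: le_lt_trans; apply: ge0_le_integral => //.
  + by apply: measurableT_comp => //; exact: (measurable_fubini_G intf).
  + apply: (@measurable_fun_fubini_tonelli_G _ _ _ _ _ n1 (abse \o f));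
      [by apply: measurableT_comp|by move=> z; exact: abse_ge0].
  + move=> y _; apply: le_abse_integral => //.
    exact: (measurableT_comp mf (pair2_measurable y)).
- rewrite /Rintegral; congr fine.
  transitivity (\int[n1]_x fubini_F n2 f x)%E.
    by rewrite -FD1 -integral_mkcond.
  transitivity (\int[n2]_y fubini_G n1 f y)%E.
    exact: Fubini.
  by rewrite -FD2 -integral_mkcond.
Qed.

End Fubini.

(** * Stieltjes-Levy measures *)

Section Measurability.
Context d (T : measurableType d) (R : realType).
Implicit Types f g : T -> R.

Lemma measurable_fun_inv f :
  measurable_fun setT f -> measurable_fun setT (fun x => (f x)^-1).
Proof.
(* valid at zeros of [f] too, since [0^-1 = 0] *)
move=> mf; rewrite (_ : (fun x => _) = (fun x => f x * (f x ^+ 2) `^ (- 1))).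
  have mf2 : measurable_fun setT (fun x => f x ^+ 2) by exact: measurable_funX.
  apply: measurable_funM => //.
  exact: (measurableT_comp (@measurable_powR R (- 1)) mf2).
apply/funext => x; have [->|fx0] := eqVneq (f x) 0; first by rewrite invr0 mul0r.
by rewrite powR_inv1 ?sqr_ge0// expr2 invfM mulrA mulfV// mul1r.
Qed.

Lemma measurable_fun_expR f :
  measurable_fun setT f -> measurable_fun setT (fun x => expR (f x)).
Proof. by move=> mf; exact: (measurableT_comp (@measurable_expR R) mf). Qed.

Lemma measurable_fun_sin f :
  measurable_fun setT f -> measurable_fun setT (fun x => sin (f x)).
Proof.
move=> mf; refine (measurableT_comp _ mf).
by apply: continuous_measurable_fun; exact: continuous_sin.
Qed.

Lemma measurable_fun_cos f :
  measurable_fun setT f -> measurable_fun setT (fun x => cos (f x)).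
Proof.
move=> mf; refine (measurableT_comp _ mf).
by apply: continuous_measurable_fun; exact: continuous_cos.
Qed.

End Measurability.

Ltac meas_tac := repeat first
  [ assumption | exact: measurable_cst | exact: measurable_id
  | exact: measurable_fst | exact: measurable_snd
  | apply: measurable_fun_inv | apply: measurable_fun_expR
  | apply: measurable_fun_sin | apply: measurable_fun_cos
  | apply: measurable_funX | apply: measurable_funM
  | apply: measurable_funB | apply: measurable_funD | apply: measurable_funN ].

Section StieltjesWeight.
Context {R : realType}.
Notation meas := {measure set (measurableTypeR R) -> \bar R}.
Notation pos := (`]0%R, +oo[%classic : set (measurableTypeR R)).
Implicit Types (G : meas) (t : R).

(** As (a2 t^2 + a1 t) (1 + t) <= (a1 + a2) t (1 + t)^2, this single weight is integrable for every
    measure in [SLM], independently of [a1] and [a2]. *)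
Definition slm_weight t : R := (t * (1 + t) ^+ 2)^-1.

Lemma slm_weight_gt0 t : 0 < t -> 0 < slm_weight t.
Proof. by move=> t0; rewrite invr_gt0 mulr_gt0 ?exprn_gt0 ?addr_gt0. Qed.

Lemma measurable_slm_weight : measurable_fun setT slm_weight.
Proof. by rewrite /slm_weight; meas_tac. Qed.

(** What is left of [SLM] when [a1], [a2] and [mu] are forgotten; the integrability estimates rest
    on it, while the support condition is used only to place the limits of integration. *)
Definition slm_measure G :=
  G `]-oo, 0]%classic = 0%E /\ G.-integrable pos (EFin \o slm_weight).

Lemma pos_itv t : pos t = (0 < t) :> Prop.
Proof. by rewrite /= in_itv/= andbT. Qed.

Lemma slm_integrable G (h : R -> R) (C : R) : slm_measure G ->
  measurable_fun setT h -> (forall t, 0 < t -> `|h t| <= C * slm_weight t) ->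
  G.-integrable pos (EFin \o h).
Proof.
move=> [_ iw] mh hC; apply: (le_integrable _ _ _ (integrableZl _ C iw)) => //.
- by apply/measurable_EFinP; exact: measurable_funTS.
- move=> t; rewrite pos_itv => t0; rewrite lee_fin (le_trans (hC _ t0))//.
  by rewrite ler_norm.
Qed.

Lemma slm_Rintegral_bound G (h : R -> R) (C : R) : slm_measure G ->
  measurable_fun setT h -> (forall t, 0 < t -> `|h t| <= C * slm_weight t) ->
  `|\int[G]_(t in pos) h t| <= C * \int[G]_(t in pos) slm_weight t.
Proof.
move=> Gw mh hC; have ih := slm_integrable _ _ _ Gw mh hC.
have [_ iw] := Gw.
rewrite (le_trans (le_normr_Rintegral _ ih))//.
rewrite -RintegralZl//; apply: le_Rintegral => //.
- exact: integrable_norm.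
- by have := integrableZl _ C iw; apply.
- by move=> t; rewrite pos_itv; exact: hC.
Qed.

(** The weight decreases on the positive half line, so it is at least [slm_weight v] on []0, v]],
    and infinite mass there would make its integral infinite. *)
Lemma slm_finite_itv G (v : R) : slm_measure G -> (G `]-oo, v]%classic < +oo)%E.
Proof.
move=> [G0 iw]; have [v0|v0] := leP v 0.
  apply: (@le_lt_trans _ _ (G `]-oo, 0]%classic)).
    by apply: le_measure; rewrite ?inE//; exact: subset_itvl.
  by rewrite G0.
have -> : `]-oo, v]%classic = `]-oo, 0]%classic `|` `]0, v]%classic.
  by rewrite -itv_bndbnd_setU// bnd_simp ltW.
apply: (le_lt_trans (measureU2 _ _ _)) => //.
rewrite [X in (X + _)%E]G0 add0e.
have v'0 := slm_weight_gt0 _ v0.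
have : (\int[G]_(t in `]0%R, v]) (slm_weight v)%:E < +oo)%E.
  have [mw iwoo] := (integrableP _ _ _ iw).
  apply: le_lt_trans iwoo.
  apply: (@le_trans _ _ (\int[G]_(t in `]0%R, v]) `|(EFin \o slm_weight) t|)%E).
    apply: ge0_le_integral => //.
    - by move=> t _; rewrite lee_fin ltW.
    - apply: measurableT_comp => //; apply/measurable_EFinP/measurable_funTS.
      exact: measurable_slm_weight.
    - move=> t /=; rewrite in_itv/= => /andP[t0 tv].
      rewrite lee_fin ger0_norm ?(ltW (slm_weight_gt0 _ _))//.
      rewrite lef_pV2 ?posrE ?mulr_gt0 ?exprn_gt0 ?addr_gt0//.
      apply: ler_pM; rewrite ?exprn_ge0 ?addr_ge0// ?(ltW t0)//.
      by rewrite lerXn2r ?nnegrE ?addr_ge0 ?(ltW t0) ?(ltW v0)// lerD2l.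
  apply: ge0_subset_integral => //.
  - exact: measurableT_comp.
  - by apply: subset_itvl; rewrite bnd_simp.
rewrite integral_cst// !ltey; apply: contra => /eqP Goo.
by rewrite [X in (_ * X)%E]Goo gt0_muley ?lte_fin.
Qed.

Lemma slm_sigma_finite G : slm_measure G -> sigma_finite setT G.
Proof.
move=> Gw; exists (fun n => `]-oo, n%:R]%classic).
  apply/seteqP; split => // t _; exists (Num.Def.archi_bound (t : R)) => //=.
  by rewrite in_itv/=; exact/ltW/unstable.ltr_bound.
by move=> n; split => //; exact: slm_finite_itv.
Qed.

Lemma slm_fin_num G (A : set (measurableTypeR R)) (v : R) : slm_measure G ->
  measurable A -> A `<=` `]-oo, v]%classic -> G A \is a fin_num.
Proof.
move=> Gw mA Av; rewrite ge0_fin_numE//.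
apply: le_lt_trans (slm_finite_itv _ v Gw).
by apply: le_measure; rewrite ?inE.
Qed.

(** [H] has density [h] on [pos] with respect to [G]. Rewriting the integrability condition on [H]
    with this density gives the first claim by comparison of weights; positivity of the density
    transfers the null set []-oo, mu[] from [H] back to [G]. *)
Lemma SLM_slm_measure (mu : R) G : SLM mu G ->
  slm_measure G /\ G `]-oo, mu[%classic = 0%E.
Proof.
move=> [G0 [a2 [a1 [a20 a10 a21 [H [[H0 Hmu iH] HE]]]]]].
pose h t := (a2 * t ^+ 2 + a1 * t)^-1.
have den_gt0 t : 0 < t -> 0 < a2 * t ^+ 2 + a1 * t.
  move=> t0; rewrite expr2 mulrA -mulrDl mulr_gt0//.
  have [a1p|] := ltP 0 a1; first by rewrite ltr_wpDl// mulr_ge0// ltW.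
  move=> a1n; rewrite ltr_pwDl// mulr_gt0//.
  by move: a21; rewrite (_ : a1 = 0) ?addr0//; apply/le_anti; rewrite a1n.
have mh : measurable_fun setT h by rewrite /h; meas_tac.
have HE' A : measurable A -> H A = (\int[G]_(t in A) (h t * \1_pos t)%:E)%E.
  move=> mA; rewrite HE// integral_mkcondr; apply: eq_integral => t _.
  rewrite patchE indicE; case: ifPn => _; rewrite ?mulr1 ?mulr0//.
have h0 t : 0 <= h t * \1_pos t.
  rewrite indicE; case: (boolP (t \in _)) => [/set_mem|_]; last by rewrite mulr0.
  by rewrite pos_itv mulr1 => t0; rewrite invr_ge0 ltW ?den_gt0.
have mhp : measurable_fun setT (fun t => h t * \1_pos t).
  by apply: measurable_funM => //; exact: measurable_indic.
have mq : measurable_fun setT (fun t : R => (1 + t)^-1) by meas_tac.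
have mqE : measurable_fun setT ((fun t : R => ((1 + t)^-1)%:E) \_ pos).
  apply/(measurable_restrictT (fun t : R => ((1 + t)^-1)%:E : \bar R) (measurable_itv `]0, +oo[)).
  by apply/measurable_EFinP; exact: measurable_funTS.
split; first split => //.
  apply/integrableP; split.
    by apply/measurable_EFinP/measurable_funTS; exact: measurable_slm_weight.
  rewrite integral_mkcond in iH.
  rewrite (@ge0_integral_density _ _ _ G H (fun t => h t * \1_pos t)) in iH => //.
    2: by move=> t; rewrite patchE; case: ifPn => // /set_mem; rewrite pos_itv => t0;
       rewrite lee_fin invr_ge0 addr_ge0// ltW.
  apply: (@le_lt_trans _ _ (\int[G]_t ((a1 + a2)%:E *
      ((((fun t : R => ((1 + t)^-1)%:E) \_ pos) t) * (h t * \1_pos t)%:E)))%E); last first.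
    rewrite ge0_integralZl//.
    - by apply: lte_mul_pinfty => //; rewrite lee_fin addr_ge0.
    - apply: emeasurable_funM; last exact/measurable_EFinP.
      exact: mqE.
    - move=> t _; rewrite patchE; case: ifPn => [/set_mem|_]; last by rewrite mul0e.
      by rewrite pos_itv => t0; rewrite -EFinM lee_fin mulr_ge0// invr_ge0 addr_ge0// ltW.
    - by rewrite lee_fin addr_ge0.
  rewrite integral_mkcond; apply: ge0_le_integral => //.
  - by move=> t _; rewrite patchE; case: ifPn.
  - apply/(measurable_restrictT (fun t : measurableTypeR R => `|(EFin \o slm_weight) t|%E) (measurable_itv `]0, +oo[)).
    apply: measurable_funTS; apply: measurableT_comp => //.
    by apply/measurable_EFinP; exact: measurable_slm_weight.
  - apply: measurable_funeM; apply: emeasurable_funM; last exact/measurable_EFinP.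
    exact: mqE.
  move=> t _; rewrite !patchE indicE; case: ifPn => [/set_mem|_]; last first.
    by rewrite mul0e mule0.
  rewrite pos_itv mulr1 => t0; rewrite -!EFinM lee_fin.
  rewrite gtr0_norm ?slm_weight_gt0// /slm_weight /h -invfM.
  rewrite ler_pdivlMr ?mulr_gt0 ?den_gt0 ?addr_gt0// ler_pdivrMl ?mulr_gt0 ?exprn_gt0 ?addr_gt0//.
  (* With the denominators cleared, the difference of the two sides is t (1 + t) (a2 + a1 t), split
     here into its two nonnegative summands. *)
  have : 0 <= a1 * t * t * (1 + t) by rewrite !mulr_ge0 ?addr_ge0// ltW.
  have : 0 <= a2 * t * (1 + t) by rewrite !mulr_ge0 ?addr_ge0// ltW.
  nra.
pose A : set (measurableTypeR R) := `]-oo, mu[%classic `&` pos.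
have mA : measurable A by exact: measurableI.
(* The integral of the positive function [h] over [A] is at most [H] of []-oo, mu[], hence zero, so
   [A] itself is null. *)
have A0 : G A = 0%E.
  have : (\int[G]_(t in A) `|(h t)%:E| = 0)%E.
    apply/eqP; rewrite eq_le integral_ge0 ?andbT; last by move=> t _; exact: abse_ge0.
    rewrite -Hmu HE//; apply: ge0_le_integral => //.
    - by apply: measurableT_comp => //; apply/measurable_EFinP/measurable_funTS.
    - by apply/measurable_EFinP/measurable_funTS.
    - by move=> t [_]; rewrite pos_itv => t0; rewrite gee0_abs// lee_fin invr_ge0 ltW ?den_gt0.
  move/ae_eq_integral_abs => /(_ mA) [|N [mN N0 AN]].
    by apply/measurable_EFinP/measurable_funTS.
  apply: (subset_measure0 _ _ _ N0) => // t At; apply: AN => /= /(_ At).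
  have [_] := At; rewrite pos_itv => t0 [] /eqP.
  by rewrite gt_eqF// invr_gt0 den_gt0.
have [mu0|mu0] := leP mu 0.
  apply: (subset_measure0 _ _ _ G0) => // t /=; rewrite !in_itv/= => /ltW/le_trans; exact.
have -> : `]-oo, mu[%classic = `]-oo, 0]%classic `|` A.
  apply/seteqP; split => t /=; rewrite /A /= !in_itv/= ?andbT.
    by move=> tm; have [t0|t0] := leP t 0; [left|right].
  by move=> [t0|[]//]; exact: le_lt_trans t0 mu0.
exact: null_set_setU.
Qed.

End StieltjesWeight.

(** * Complex-valued integrals dominated by the weight *)

Section ComplexIntegral.
Context {R : realType}.
Notation meas := {measure set (measurableTypeR R) -> \bar R}.
Notation pos := (`]0%R, +oo[%classic : set (measurableTypeR R)).
Implicit Types (G : meas) (t : R) (h k : R -> R[i]).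

Definition cmeasurable h :=
  measurable_fun setT (fun t => complex.Re (h t)) /\
  measurable_fun setT (fun t => complex.Im (h t)).

Lemma cmeasurable_cst (c : R[i]) : cmeasurable (fun=> c).
Proof. by split; meas_tac. Qed.

Lemma cmeasurableM h k : cmeasurable h -> cmeasurable k ->
  cmeasurable (fun t => h t * k t).
Proof.
move=> [h1 h2] [k1 k2]; split.
  rewrite (_ : (fun t => _) = (fun t => complex.Re (h t) * complex.Re (k t)
    - complex.Im (h t) * complex.Im (k t))); first by meas_tac.
  by apply/funext => t; case: (h t) (k t) => [? ?] [? ?].
rewrite (_ : (fun t => _) = (fun t => complex.Re (h t) * complex.Im (k t)
  + complex.Im (h t) * complex.Re (k t))); first by meas_tac.
by apply/funext => t; case: (h t) (k t) => [? ?] [? ?].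
Qed.

Lemma cmeasurableX h n : cmeasurable h -> cmeasurable (fun t => h t ^+ n).
Proof.
move=> mh; elim: n => [|n IH].
  by rewrite (_ : (fun t => _) = (fun=> 1)); [exact: cmeasurable_cst|].
rewrite (_ : (fun t => _) = (fun t => h t * h t ^+ n)).
  exact: cmeasurableM.
by apply/funext => t; rewrite exprS.
Qed.

Lemma cmeasurableV h : cmeasurable h -> cmeasurable (fun t => (h t)^-1).
Proof.
move=> [h1 h2]; split.
  rewrite (_ : (fun t => _) = (fun t => complex.Re (h t) *
    (complex.Re (h t) ^+ 2 + complex.Im (h t) ^+ 2)^-1)); first by meas_tac.
  by apply/funext => t; case: (h t).
rewrite (_ : (fun t => _) = (fun t => - (complex.Im (h t) *
    (complex.Re (h t) ^+ 2 + complex.Im (h t) ^+ 2)^-1))); first by meas_tac.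
by apply/funext => t; case: (h t).
Qed.

Lemma cmeasurable_real (f : R -> R) :
  measurable_fun setT f -> cmeasurable (fun t => (f t)%:C).
Proof. by move=> mf; split => //; meas_tac. Qed.

Lemma cmeasurable_affine (c : R[i]) : cmeasurable (fun t => t%:C - c).
Proof.
case: c => a b; split.
  by rewrite (_ : (fun t => _) = (fun t : R => t - a)); [meas_tac|exact/funext].
by rewrite (_ : (fun t => _) = (fun t : R => 0 - b)); [meas_tac|exact/funext].
Qed.

Definition cint G h : R[i] :=
  (\int[G]_(t in pos) complex.Re (h t)) +i*
  (\int[G]_(t in pos) complex.Im (h t)).

Definition slm_dominated h (C : R) :=
  cmeasurable h /\ forall t, 0 < t -> cmod (h t) <= C * slm_weight t.

Lemma slm_dominated_Re G h C : slm_measure G -> slm_dominated h C ->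
  G.-integrable pos (EFin \o (fun t => complex.Re (h t))).
Proof.
move=> Gw [[mh _] hC]; apply: (slm_integrable G _ C) => // t t0.
exact: le_trans (Re_le_cmod _) (hC _ t0).
Qed.

Lemma slm_dominated_Im G h C : slm_measure G -> slm_dominated h C ->
  G.-integrable pos (EFin \o (fun t => complex.Im (h t))).
Proof.
move=> Gw [[_ mh] hC]; apply: (slm_integrable G _ C) => // t t0.
exact: le_trans (Im_le_cmod _) (hC _ t0).
Qed.

(** Real and imaginary parts are bounded separately, whence the factor 2; it is harmless because
    only the rate in [C] matters for convergence. *)
Lemma cint_bound G h C : slm_measure G -> slm_dominated h C ->
  cmod (cint G h) <= 2 * C * \int[G]_(t in pos) slm_weight t.
Proof.
move=> Gw [[m1 m2] hC]; rewrite (le_trans (cmod_le _))//= -mulrA mulr_natl mulr2n.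
by apply: lerD; apply: slm_Rintegral_bound => // t t0;
  [exact: le_trans (Re_le_cmod _) (hC _ t0)|exact: le_trans (Im_le_cmod _) (hC _ t0)].
Qed.

Lemma eq_cint G h k : (forall t, 0 < t -> h t = k t) -> cint G h = cint G k.
Proof.
move=> hk; rewrite /cint; congr (_ +i* _); apply: eq_Rintegral => t /set_mem;
  by rewrite pos_itv => t0; rewrite hk.
Qed.

Lemma cintD G h k C D : slm_measure G -> slm_dominated h C -> slm_dominated k D ->
  cint G (fun t => h t + k t) = cint G h + cint G k.
Proof.
move=> Gw hC kD.
rewrite /cint; apply/eqP; rewrite eq_complex/=; apply/andP; split; apply/eqP.
  rewrite -RintegralD//; last 2 first.
    exact: slm_dominated_Re hC.
    exact: slm_dominated_Re kD.
  by apply: eq_Rintegral => t _; case: (h t) (k t) => [? ?] [? ?].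
rewrite -RintegralD//; last 2 first.
  exact: slm_dominated_Im hC.
  exact: slm_dominated_Im kD.
by apply: eq_Rintegral => t _; case: (h t) (k t) => [? ?] [? ?].
Qed.

Lemma cintZ G h (c : R[i]) C : slm_measure G -> slm_dominated h C ->
  cint G (fun t => c * h t) = c * cint G h.
Proof.
move=> Gw hC; have iR := slm_dominated_Re _ _ _ Gw hC.
have iI := slm_dominated_Im _ _ _ Gw hC.
case: c => a b; rewrite /cint.
apply/eqP; rewrite eq_complex/=; apply/andP; split; apply/eqP.
  rewrite -!RintegralZl// -RintegralB//; last 2 first.
    by have := integrableZl _ a iR; apply.
    by have := integrableZl _ b iI; apply.
  by apply: eq_Rintegral => t _; case: (h t) => [? ?].
rewrite -!RintegralZl// -RintegralD//; last 2 first.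
  by have := integrableZl _ a iI; apply.
  by have := integrableZl _ b iR; apply.
by apply: eq_Rintegral => t _; case: (h t) => [? ?].
Qed.

Lemma slm_dominatedD h k C D : slm_dominated h C -> slm_dominated k D ->
  slm_dominated (fun t => h t + k t) (C + D).
Proof.
move=> [[h1 h2] hC] [[k1 k2] kD]; split; last first.
  move=> t t0; rewrite mulrDl (le_trans (cmodD _ _))// lerD//; [exact: hC|exact: kD].
split.
  rewrite (_ : (fun t => _) = (fun t => complex.Re (h t) + complex.Re (k t))).
    by meas_tac.
  by apply/funext => t; rewrite ReD.
rewrite (_ : (fun t => _) = (fun t => complex.Im (h t) + complex.Im (k t))).
  by meas_tac.
by apply/funext => t; rewrite ImD.
Qed.

Lemma slm_dominatedZ h C (c : R[i]) : slm_dominated h C ->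
  slm_dominated (fun t => c * h t) (cmod c * C).
Proof.
move=> [mh hC]; split; first by apply: cmeasurableM => //; exact: cmeasurable_cst.
by move=> t t0; rewrite cmodM -mulrA ler_wpM2l ?cmod_ge0// hC.
Qed.

Lemma cint_sum G (h : nat -> R -> R[i]) (C : nat -> R) (n : nat) : slm_measure G ->
  (forall j : nat, slm_dominated (h j) (C j)) ->
  cint G (fun t => \sum_(0 <= j < n) h j t) = \sum_(0 <= j < n) cint G (h j).
Proof.
move=> Gw hC.
(* The induction must also carry the domination of the partial sum, which [cintD] requires. *)
suff : slm_dominated (fun t => \sum_(0 <= j < n) h j t) (\sum_(0 <= j < n) C j) /\
  cint G (fun t => \sum_(0 <= j < n) h j t) = \sum_(0 <= j < n) cint G (h j).
  by case.
elim: n => [|n [IH1 IH2]].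
  have -> : (fun t => \sum_(0 <= j < 0) h j t) = (fun=> 0).
    by apply/funext => t; rewrite big_geq.
  rewrite !big_geq//; split.
    by split; [exact: cmeasurable_cst|move=> t _; rewrite cmod0 mul0r].
  by rewrite /cint/= /Rintegral integral0.
have -> : (fun t => \sum_(0 <= j < n.+1) h j t) =
    (fun t => \sum_(0 <= j < n) h j t + h n t).
  by apply/funext => t; rewrite big_nat_recr.
rewrite !big_nat_recr//=; split; first exact: slm_dominatedD.
by rewrite (cintD _ _ _ _ _ Gw IH1 (hC n)) IH2.
Qed.

End ComplexIntegral.

(** * Analyticity of the Stieltjes transform off the imaginary axis *)

Section StieltjesTransform.
Context {R : realType}.
Notation meas := {measure set (measurableTypeR R) -> \bar R}.
Notation pos := (`]0%R, +oo[%classic : set (measurableTypeR R)).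
Implicit Types (G : meas) (t : R) (z : R[i]).
Local Notation I := ((0 : R) +i* (1 : R)).

(** The Cauchy kernel 1 / (t - i z) alone decays too slowly for [slm_weight]; the factor 1 / (1 +
    t^2), free of z, supplies the missing two powers. *)
Definition stieltjes_kernel z t : R[i] := ((1 + t ^+ 2)^-1)%:C * (t%:C - I * z)^-1.

Definition stieltjes G z : R[i] := cint G (stieltjes_kernel z).

(** For real z, the Laplace transform at t of x |-> 1 - exp (i z x) + i z sin x. *)
Definition slm_kernel z t : R[i] :=
  (t^-1)%:C - (t%:C - I * z)^-1 + I * z * ((1 + t ^+ 2)^-1)%:C.

(* cint G (slm_kernel z), written so as to be well defined for every z *)
Definition slm_exponent G z : R[i] :=
  cint G (fun t => ((t * (1 + t ^+ 2))^-1)%:C) - (1 - z ^+ 2) * stieltjes G z.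

(** Used with w = i z, where 1 + w^2 = 1 - z^2: it moves the dependence of [slm_kernel] on z into a
    polynomial factor and the simple pole of [stieltjes_kernel], so that only the latter has to be
    expanded. *)
Lemma partial_fraction (F : fieldType) (T w : F) :
  T != 0 -> 1 + T ^+ 2 != 0 -> T - w != 0 ->
  (T * (1 + T ^+ 2))^-1 + - (1 + w ^+ 2) * ((1 + T ^+ 2)^-1 * (T - w)^-1) =
  T^-1 - (T - w)^-1 + w * (1 + T ^+ 2)^-1.
Proof. by move=> T0 T1 Tw; field; rewrite T0 T1 Tw. Qed.

Lemma denom_ReIm t z :
  t%:C - I * z = (t + complex.Im z) +i* (- complex.Re z).
Proof.
by case: z => x y; apply/eqP; rewrite eq_complex/=; apply/andP; split; apply/eqP; ring.
Qed.

Lemma cmod_denom_ge t z : `|complex.Re z| <= cmod (t%:C - I * z).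
Proof. by rewrite denom_ReIm -(normrN (complex.Re z)) (Im_le_cmod (_ +i* _)). Qed.

Lemma denom_neq0 t z : complex.Re z != 0 -> t%:C - I * z != 0.
Proof.
by move=> z0; rewrite -cmod_gt0 (lt_le_trans _ (cmod_denom_ge _ _))// normr_gt0.
Qed.

(** A bound for (1 + t) / |t - i z|, obtained from 1 + t <= |t + Im z| + (1 + |Im z|) and |t - i z|
    >= |Re z|. *)
Definition denom_cst z : R := 1 + (1 + `|complex.Im z|) / `|complex.Re z|.

Lemma denom_cst_gt0 z : 0 < denom_cst z.
Proof. by rewrite ltr_pwDl// divr_ge0// addr_ge0. Qed.

Lemma cmod_denomV_le t z : complex.Re z != 0 -> 0 < t ->
  cmod (t%:C - I * z)^-1 <= denom_cst z / (1 + t).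
Proof.
move=> z0 t0.
have x0 : 0 < `|complex.Re z| by rewrite normr_gt0.
have c0 : 0 < cmod (t%:C - I * z) by rewrite cmod_gt0 denom_neq0.
rewrite cmodV ler_pdivlMr ?addr_gt0// ler_pdivrMl// mulrC /denom_cst mulrDl mul1r.
have h1 : t + complex.Im z <= cmod (t%:C - I * z).
  by rewrite (le_trans (ler_norm _))// denom_ReIm (Re_le_cmod (_ +i* _)).
have h2 : 1 + `|complex.Im z| <=
    (1 + `|complex.Im z|) / `|complex.Re z| * cmod (t%:C - I * z).
  rewrite -mulrA ler_peMr ?addr_ge0// mulrC ler_pdivlMr// mul1r.
  exact: cmod_denom_ge.
have h3 := ler_norm (- complex.Im z); rewrite normrN in h3.
lra.
Qed.

Lemma cmod_realV_le t : cmod ((1 + t ^+ 2)^-1)%:C = (1 + t ^+ 2)^-1.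
Proof. by rewrite cmod_real ger0_norm// invr_ge0 addr_ge0 ?sqr_ge0. Qed.

Lemma onesqr_le t : 0 < t -> (1 + t ^+ 2)^-1 / (1 + t) <= 2 * slm_weight t.
Proof.
move=> t0; rewrite /slm_weight -invfM.
have A0 : 0 < (1 + t ^+ 2) * (1 + t) by rewrite mulr_gt0 ?addr_gt0 ?exprn_gt0.
have B0 : 0 < t * (1 + t) ^+ 2 by rewrite mulr_gt0 ?exprn_gt0 ?addr_gt0.
rewrite ler_pdivlMr// mulrC ler_pdivrMr//.
(* This is the difference 2 (1 + t^2) (1 + t) - t (1 + t)^2. *)
have : 0 <= (1 + t) * ((t - 1) ^+ 2 + t + 1).
  by rewrite mulr_ge0 ?addr_ge0 ?sqr_ge0// ltW.
nra.
Qed.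

Lemma stieltjes_kernel_dominated z : complex.Re z != 0 ->
  slm_dominated (stieltjes_kernel z) (2 * denom_cst z).
Proof.
move=> z0; split.
  apply: cmeasurableM; first by apply: cmeasurable_real; meas_tac.
  by apply: cmeasurableV; exact: cmeasurable_affine.
move=> t t0; rewrite cmodM cmod_realV_le.
apply: (@le_trans _ _ ((1 + t ^+ 2)^-1 * (denom_cst z / (1 + t)))).
  by rewrite ler_wpM2l ?invr_ge0 ?addr_ge0 ?sqr_ge0// cmod_denomV_le.
rewrite mulrCA [leRHS]mulrAC [leRHS]mulrC ler_wpM2l ?(ltW (denom_cst_gt0 _))//.
exact: onesqr_le.
Qed.

Lemma geometric_remainder (u h : R[i]) n : 1 - h * u != 0 ->
  \sum_(0 <= k < n) h ^+ k * u ^+ k.+1 = (1 - (h * u) ^+ n) * (u / (1 - h * u)).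
Proof.
move=> q1; elim: n => [|n IH]; first by rewrite big_geq// expr0 subrr mul0r.
rewrite big_nat_recr//= IH; apply: (mulIf q1).
rewrite mulrDl -!mulrA (mulVf q1) !exprMn !exprS !mulr1; ring.
Qed.

(** Around [z] the kernel is a geometric series of ratio [q t] = i (x - z) / (t - i z). For |x - z|
    < |Re z| / 2 the ratio has modulus at most 1/2 for all [t] at once, so the series may be
    integrated term by term. *)
Lemma analytic_stieltjes G z : slm_measure G -> complex.Re z != 0 ->
  analytic_at (stieltjes G) z.
Proof.
move=> Gw z0.
pose u t := (t%:C - I * z)^-1.
pose b k t : R[i] := ((1 + t ^+ 2)^-1)%:C * (I ^+ k * u t ^+ k.+1).
have cI : cmod I = 1 by rewrite cmod_imag normr1.
have nx0 : 0 < `|complex.Re z| by rewrite normr_gt0.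
have uE t : cmod (u t) <= `|complex.Re z|^-1.
  rewrite cmodV lef_pV2 ?posrE//; first exact: cmod_denom_ge.
  by rewrite cmod_gt0 denom_neq0.
have bk k : slm_dominated (b k) (2 * denom_cst z * `|complex.Re z|^-1 ^+ k).
  split.
    apply: cmeasurableM; first by apply: cmeasurable_real; meas_tac.
    apply: cmeasurableM; first exact: cmeasurable_cst.
    by apply: cmeasurableX; apply: cmeasurableV; exact: cmeasurable_affine.
  move=> t t0; rewrite /b cmodM cmodM cmodX cI expr1n mul1r (exprS (u t)) cmodM mulrA.
  rewrite [leRHS]mulrAC; apply: ler_pM; rewrite ?mulr_ge0 ?cmod_ge0//.
    have [_ /(_ _ t0)] := stieltjes_kernel_dominated _ z0.
    by rewrite /stieltjes_kernel cmodM; apply.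
  by rewrite cmodX lerXn2r ?nnegrE ?cmod_ge0 ?invr_ge0.
exists (fun k => cint G (b k)), (`|complex.Re z| / 2).
split; [by rewrite divr_gt0|move=> x].
rewrite cmodE ltcR => xr.
have x0 : complex.Re x != 0.
  apply/eqP => x0; have := Re_le_cmod (x - z); rewrite ReD x0 add0r.
  rewrite (_ : complex.Re (- z) = - complex.Re z); last by case: (z).
  by rewrite normrN; lra.
pose q t := I * (x - z) * u t.
have q2 t : cmod (q t) <= 2^-1.
  rewrite /q cmodM cmodM cI mul1r (@le_trans _ _ (`|complex.Re z| / 2 / `|complex.Re z|))//.
    by apply: ler_pM; rewrite ?cmod_ge0// ltW.
  by rewrite mulrAC mulfV ?gt_eqF// mul1r.
have E t : t%:C - I * x = (t%:C - I * z) * (1 - q t).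
  rewrite mulrBr mulr1 /q mulrCA mulfV ?denom_neq0// mulr1; ring.
have q1 t : 1 - q t != 0.
  by apply/eqP => q0; move/eqP: (E t); rewrite q0 mulr0; apply/negP; exact: denom_neq0.
(* The remainder of a finite geometric sum is exact: it is the kernel at [x] multiplied by
   [q t ^+ n], hence of order 2^-n. *)
have sE n : series (fun k => cint G (b k) * (x - z) ^+ k : R[i]^o) n - stieltjes G x =
   - cint G (fun t => q t ^+ n * stieltjes_kernel x t).
  rewrite /series/=.
  rewrite (eq_bigr (fun k => cint G (fun t => (x - z) ^+ k * b k t))); last first.
    by move=> k _; rewrite mulrC (cintZ _ _ _ _ Gw (bk k)).
  rewrite -(@cint_sum _ _ (fun k t => (x - z) ^+ k * b k t)
    (fun k => cmod ((x - z) ^+ k) * (2 * denom_cst z * `|complex.Re z|^-1 ^+ k)))//;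
    last by move=> k; exact: slm_dominatedZ.
  have qd : slm_dominated (fun t => q t ^+ n * stieltjes_kernel x t) (2 * denom_cst x).
    have [ms sd] := stieltjes_kernel_dominated _ x0.
    split.
      apply: cmeasurableM => //; apply: cmeasurableX.
      apply: cmeasurableM; first exact: cmeasurable_cst.
      by apply: cmeasurableV; exact: cmeasurable_affine.
    move=> t t0; rewrite cmodM (le_trans _ (sd _ t0))// ler_piMl ?cmod_ge0//.
    by rewrite cmodX exprn_ile1 ?cmod_ge0// (le_trans (q2 _))//; lra.
  rewrite -[RHS]mulN1r -(cintZ _ _ _ _ Gw qd) /stieltjes.
  apply/eqP; rewrite subr_eq; apply/eqP.
  rewrite -(cintD _ _ _ _ _ Gw (slm_dominatedZ _ _ (- 1) qd)
    (stieltjes_kernel_dominated _ x0)).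
  apply: eq_cint => t t0.
  rewrite (eq_bigr (fun k => ((1 + t ^+ 2)^-1)%:C *
    ((I * (x - z)) ^+ k * u t ^+ k.+1))); last first.
    by move=> k _; rewrite /b exprMn; ring.
  rewrite -mulr_sumr geometric_remainder; last exact: q1.
  rewrite /stieltjes_kernel E invfM -/(u t) -/(q t); ring.
apply/cvg_cmodP.
pose W := \int[G]_(t in pos) slm_weight t.
have W0 : 0 <= W.
  by apply: Rintegral_ge0 => t; rewrite pos_itv => /slm_weight_gt0/ltW.
have bnd n : cmod (series (fun k => cint G (b k) * (x - z) ^+ k : R[i]^o) n - stieltjes G x)
    <= 2 * (2 * denom_cst x) * W * 2^-1 ^+ n.
  rewrite sE cmodN.
  have qn : slm_dominated (fun t => q t ^+ n * stieltjes_kernel x t) (2^-1 ^+ n * (2 * denom_cst x)).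
    have [ms sd] := stieltjes_kernel_dominated _ x0.
    split.
      apply: cmeasurableM => //; apply: cmeasurableX.
      apply: cmeasurableM; first exact: cmeasurable_cst.
      by apply: cmeasurableV; exact: cmeasurable_affine.
    move=> t t0; rewrite cmodM -mulrA; apply: ler_pM; rewrite ?cmod_ge0 ?sd//.
    by rewrite cmodX lerXn2r ?nnegrE ?cmod_ge0 ?invr_ge0.
  rewrite (le_trans (cint_bound _ _ _ Gw qn))// -/W.
  by move: (2^-1 ^+ n) => e; rewrite le_eqVlt; apply/orP; left; apply/eqP; ring.
apply: (@squeeze_cvgr _ _ _ _ (cst 0) (fun n => 2 * (2 * denom_cst x) * W * 2^-1 ^+ n)).
- by apply: nearW => n; rewrite /= cmod_ge0 bnd.
- exact: cvg_cst.
- rewrite -[X in _ --> X](mulr0 (2 * (2 * denom_cst x) * W)).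
  apply: cvgMl_tmp; apply: cvg_expr.
  by rewrite ger0_norm ?invr_ge0// invf_lt1// ltr1n.
Qed.

(** Expanding [1 - z ^+ 2] leaves only multiplications by the variable, so [analytic_at_mulX]
    replaces a product theorem for power series. *)
Lemma analytic_slm_exponent G z : slm_measure G -> complex.Re z != 0 ->
  analytic_at (slm_exponent G) z.
Proof.
move=> Gw z0; have aS := analytic_stieltjes _ _ Gw z0.
apply: (@eq_analytic_at _ (fun x =>
  cint G (fun t => ((t * (1 + t ^+ 2))^-1)%:C) + (- stieltjes G x + x * (x * stieltjes G x)))).
  by move=> x; rewrite /slm_exponent; ring.
apply: analytic_atD; first exact: analytic_at_cst.
apply: analytic_atD; first exact: analytic_atN.
by do 2 apply: analytic_at_mulX.
Qed.

Lemma invr_onesqr_dominated :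
  slm_dominated (fun t : R => ((t * (1 + t ^+ 2))^-1)%:C) 2.
Proof.
split; first by apply: cmeasurable_real; meas_tac.
move=> t t0; rewrite cmod_real gtr0_norm; last first.
  by rewrite invr_gt0 mulr_gt0// ltr_wpDr ?sqr_ge0.
rewrite /slm_weight ler_pdivlMr ?mulr_gt0 ?exprn_gt0 ?addr_gt0//.
rewrite ler_pdivrMl ?mulr_gt0 ?addr_gt0 ?exprn_gt0//.
rewrite -mulrA ler_wpM2l ?(ltW t0)//; have := sqr_ge0 (t - 1); nra.
Qed.

Lemma slm_exponentE G z : slm_measure G -> complex.Re z != 0 ->
  slm_exponent G z = cint G (slm_kernel z).
Proof.
move=> Gw z0; have sd := stieltjes_kernel_dominated _ z0.
rewrite /slm_exponent /stieltjes -mulNr -(cintZ _ _ _ _ Gw sd).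
rewrite -(cintD _ _ _ _ _ Gw invr_onesqr_dominated (slm_dominatedZ _ _ _ sd)).
apply: eq_cint => t t0; rewrite /slm_kernel /stieltjes_kernel.
have d0 := denom_neq0 t _ z0.
have t1 : (1 + t ^+ 2)%:C != 0 :> R[i].
  by rewrite fmorph_eq0 gt_eqF// ltr_wpDr ?sqr_ge0.
have t1' : t%:C != 0 :> R[i] by rewrite fmorph_eq0 gt_eqF.
rewrite !fmorphV rmorphM/=.
have -> : (1 + t ^+ 2)%:C = 1 + t%:C ^+ 2 :> R[i] by rewrite rmorphD rmorph1 rmorphXn.
have -> : - (1 - z ^+ 2) = - (1 + (I * z) ^+ 2).
  have -> : (I * z) ^+ 2 = I ^+ 2 * z ^+ 2 by rewrite exprMn.
  have -> : I ^+ 2 = -1 :> R[i]; last by rewrite mulN1r.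
  apply/eqP; rewrite expr2 eq_complex/=.
  by rewrite ?(mulr0, mulr1, mul0r, addr0, sub0r, oppr0, eqxx).
apply: partial_fraction => //.
by move: t1; rewrite rmorphD rmorph1 rmorphXn.
Qed.

End StieltjesTransform.

(** * The Levy-Khintchine formula *)

Section AffineSubstitution.
Context {R : realType}.
Notation mu := (@lebesgue_measure R).
Implicit Types s c : R.

Lemma measurable_affine s c :
  measurable_fun setT (fun x : measurableTypeR R => s + c * x : measurableTypeR R).
Proof. by meas_tac. Qed.

(** The rescaled image measure agrees with Lebesgue measure on half-open intervals, and these
    determine the latter. *)
Lemma lebesgue_measure_affine s c (A : set (measurableTypeR R)) : c != 0 ->
  measurable A ->
  mu A = (`|c|%:E * mu ((fun x : R => s + c * x)%R @^-1` A))%E.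
Proof.
move=> c0 mA.
have nc0 : 0 <= `|c| by [].
pose phi (x : measurableTypeR R) : measurableTypeR R := s + c * x.
have [m mE] : exists m : {measure set (measurableTypeR R) -> \bar R},
    forall B, m B = (`|c|%:E * mu (phi @^-1` B))%E.
  unshelve eexists; first apply: (mscale (NngNum nc0) (pushforward mu phi)).
    exact: measurable_affine.
  by [].
rewrite -[RHS]mE; refine (@lebesgue_measure_unique R m _ A mA) => _ [[a b] _ <-].
rewrite mE lebesgue_measure_itv/=.
have := c0; rewrite neq_lt => /orP[cn|cp].
(* A negative factor also exchanges the open and the closed end; the length does not see it. *)
- have -> : phi @^-1` `]a, b]%classic = `[(b - s) / c, (a - s) / c[%classic.
    apply/seteqP; split => x /=; rewrite !in_itv/= ler_ndivrMr// ltr_ndivlMr//;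
      rewrite ltrBlDl lerBrDl (mulrC x) andbC//.
  rewrite lebesgue_measure_itv/= !lte_fin ltr_nM2r ?invr_lt0// ltrD2r.
  case: ifPn => _; last by rewrite mule0.
  by rewrite -!EFinB -EFinM; congr EFin; rewrite ltr0_norm//; field.
- have -> : phi @^-1` `]a, b]%classic = `](a - s) / c, (b - s) / c]%classic.
    apply/seteqP; split => x /=; rewrite !in_itv/= ltr_pdivrMr// ler_pdivlMr//;
      rewrite ltrBlDl lerBrDl (mulrC x)//.
  rewrite lebesgue_measure_itv/= !lte_fin ltr_pM2r ?invr_gt0// ltrD2r.
  case: ifPn => _; last by rewrite mule0.
  by rewrite -!EFinB -EFinM; congr EFin; rewrite gtr0_norm//; field.
Qed.

Lemma ge0_integral_affine s c (f : R -> \bar R) : c != 0 ->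
  measurable_fun setT f -> (forall x, 0 <= f x)%E ->
  (\int[mu]_x f x = `|c|%:E * \int[mu]_x f (s + c * x)%R)%E.
Proof.
move=> c0 mf f0.
have nc0 : 0 <= `|c| by [].
pose phi (x : measurableTypeR R) : measurableTypeR R := s + c * x.
have mphi : measurable_fun setT phi by exact: measurable_affine.
have [pm pmE] : exists pm : {measure set (measurableTypeR R) -> \bar R},
    (pm : set _ -> \bar R) = pushforward mu phi.
  by unshelve eexists; first apply: (pushforward mu phi).
transitivity (\int[mscale (NngNum nc0) pm]_x f x)%E.
  apply: eq_measure_integral => A mA _.
  transitivity (`|c|%:E * pm A)%E => //.
  by rewrite pmE; exact: lebesgue_measure_affine.
rewrite ge0_integral_mscale//=; congr (_ * _)%E.
by rewrite pmE ge0_integral_pushforward.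
Qed.

Lemma Rintegral_affine s c (f : R -> R) : c != 0 ->
  mu.-integrable setT (EFin \o f) ->
  mu.-integrable setT (EFin \o (fun x => f (s + c * x))) /\
  \int[mu]_x f x = `|c| * \int[mu]_x f (s + c * x).
Proof.
move=> c0 /[dup] intf /integrableP[mf foo].
have nc0 : (0 < `|c|%:E)%E by rewrite lte_fin normr_gt0.
have mphi : measurable_fun setT (EFin \o (fun x => f (s + c * x))).
  exact: (measurableT_comp mf (measurable_affine s c)).
have intg : mu.-integrable setT (EFin \o (fun x => f (s + c * x))).
  apply/integrableP; split => //.
  move: foo; rewrite (ge0_integral_affine s c)//; last exact: measurableT_comp.
  rewrite !ltey; apply: contra => /eqP ->.
  by rewrite gt0_muley.
split => //; rewrite /Rintegral.
suff -> : (\int[mu]_x (f x)%:E = `|c|%:E * \int[mu]_x (f (s + c * x))%:E)%E.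
  by rewrite fineM//; exact: integrable_fin_num.
rewrite [LHS]integralE [in RHS]integralE.
have mp := @ge0_integral_affine s c (fun x => (f x)%:E)^\+%E c0.
have mn := @ge0_integral_affine s c (fun x => (f x)%:E)^\-%E c0.
rewrite mp//; last exact: measurable_funepos.
rewrite mn//; last exact: measurable_funeneg.
have -> : (\int[mu]_x (fun x => (f x)%:E)^\+ (s + c * x)%R =
    \int[mu]_x (fun x => (f (s + c * x))%:E)^\+ x)%E.
  by apply: eq_integral => x _; rewrite !funeposE.
have -> : (\int[mu]_x (fun x => (f x)%:E)^\- (s + c * x)%R =
    \int[mu]_x (fun x => (f (s + c * x))%:E)^\- x)%E.
  by apply: eq_integral => x _; rewrite !funenegE.
apply/esym/muleBr => //; exact: (integrable_add_def measurableT intg).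
Qed.

Lemma Rintegral_reflect (f : R -> R) :
  mu.-integrable setT (EFin \o f) ->
  mu.-integrable setT (EFin \o (fun x => f (- x))) /\
  \int[mu]_x f x = \int[mu]_x f (- x).
Proof.
move=> intf; have [] := Rintegral_affine 0 (-1) f _ intf.
  by rewrite oppr_eq0 oner_eq0.
rewrite normrN1 mul1r.
by under eq_fun do rewrite add0r mulN1r.
Qed.

End AffineSubstitution.

Section TrigLaplace.
Context {R : realType}.
Notation mu := (@lebesgue_measure R).
Notation pos := (`]0%R, +oo[%classic : set (measurableTypeR R)).
Implicit Types (a b c t xi : R).

Definition trig a b c xi (x : R) : R := a + b * cos (xi * x) + c * sin (xi * x).

Lemma continuous_scale c (x : R) : {for x, continuous ( *%R c)}.
Proof. by apply: cvgMl_tmp; exact: cvg_id. Qed.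

Lemma continuous_trig a b c xi : continuous (trig a b c xi).
Proof.
move=> x; rewrite /trig; apply: cvgD; first apply: cvgD; first exact: cvg_cst.
- apply: cvgMl_tmp; apply: (continuous_comp (continuous_scale xi x)).
  exact: continuous_cos.
- apply: cvgMl_tmp; apply: (continuous_comp (continuous_scale xi x)).
  exact: continuous_sin.
Qed.

Lemma continuous_expN t : continuous (fun x : R => expR (- (t * x))).
Proof.
move=> x; apply: (continuous_comp (f := fun x : R => - (t * x))).
  by apply: cvgN; exact: continuous_scale.
exact: continuous_expR.
Qed.

Lemma cvgy_expN t : 0 < t -> expR (- (t * x)) @[x --> +oo] --> (0 : R).
Proof.
move=> t0; apply: (@cvg_comp _ _ _ (fun x => t * x) (fun y => expR (- y)) _ +oo).
  exact: gt0_cvgMry.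
exact: cvgr_expR.
Qed.

(** An explicit primitive [F] vanishes at infinity. Nonnegativity of the integrand permits the
    fundamental theorem on the half line without prior integrability, which then follows from the
    finite value. *)
Lemma trig_laplace a b c xi t : 0 < t -> (forall x, 0 <= trig a b c xi x) ->
  (\int[mu]_(x in pos) (trig a b c xi x * expR (- (t * x)))%:E =
   (a / t + (b * t + c * xi) / (t ^+ 2 + xi ^+ 2))%:E)%E.
Proof.
move=> t0 tr0.
have d0 : 0 < t ^+ 2 + xi ^+ 2 by rewrite ltr_wpDr ?sqr_ge0// exprn_gt0.
(* [A] and [B] solve xi B - t A = b and - xi A - t B = c, the equations that express F' = f. *)
pose A := - ((b * t + c * xi) / (t ^+ 2 + xi ^+ 2)).
pose B := (b * xi - c * t) / (t ^+ 2 + xi ^+ 2).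
pose F (x : R) := expR (- (t * x)) * trig (- (a / t)) A B xi x.
pose f (x : R) := trig a b c xi x * expR (- (t * x)).
have cf : continuous f.
  by move=> x; apply: cvgM; [exact: continuous_trig|exact: continuous_expN].
have dF (x : R) : is_derive x 1 F (f x).
  have d1 : is_derive x 1 (fun y : R => expR (- (t * y))) (expR (- (t * x)) * (- t)).
    apply: (@is_derive1_comp _ expR (fun y => - (t * y))).
    have -> : (fun y : R => - (t * y)) = - (t \*: id) by apply/funext.
    by apply: is_derive_eq; rewrite scaler1.
  have ds : is_derive x 1 (fun y : R => xi * y) xi.
    have -> : (fun y : R => xi * y) = xi \*: id by apply/funext.
    by apply: is_derive_eq; rewrite scaler1.
  have d2 : is_derive x 1 (fun y : R => cos (xi * y)) (- sin (xi * x) * xi).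
    exact: (@is_derive1_comp _ cos (fun y => xi * y)).
  have d3 : is_derive x 1 (fun y : R => sin (xi * y)) (cos (xi * x) * xi).
    exact: (@is_derive1_comp _ sin (fun y => xi * y)).
  have d4 : is_derive x 1 (trig (- (a / t)) A B xi)
      (A * (- sin (xi * x) * xi) + B * (cos (xi * x) * xi)).
    have -> : trig (- (a / t)) A B xi = cst (- (a / t)) +
       A \*: (fun y : R => cos (xi * y)) + B \*: (fun y : R => sin (xi * y)).
      by apply/funext.
    by apply: is_derive_eq; rewrite add0r.
  have -> : F = (fun y : R => expR (- (t * y))) * trig (- (a / t)) A B xi.
    by apply/funext.
  apply: is_derive_eq; rewrite /f /trig /A /B /GRing.scale/=.
  by field; rewrite gt_eqF//= gt_eqF.
rewrite integral_itv_obnd_cbnd; last first.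
  apply/measurable_EFinP/measurable_funTS.
  exact: continuous_measurable_fun.
rewrite (@ge0_continuous_FTC2y _ _ F 0 0).
- by rewrite /F /trig !mulr0 oppr0 expR0 cos0 sin0 /A; congr EFin; ring.
- by move=> x _; rewrite mulr_ge0 ?expR_ge0// tr0.
- exact: continuous_subspaceT.
- pose K := `|a / t| + `|A| + `|B|.
  apply: (@squeeze_cvgr _ _ _ _ (fun x => - (K * expR (- (t * x)))) (fun x => K * expR (- (t * x)))).
  + apply: nearW => x; rewrite -ler_norml /F normrM mulrC [`|expR _|]gtr0_norm ?expR_gt0//.
    rewrite ler_wpM2r ?expR_ge0// /trig /K.
    have hA : `|A * cos (xi * x)| <= `|A|.
      by rewrite normrM ler_piMr// ler_norml cos_geN1 cos_le1.
    have hB : `|B * sin (xi * x)| <= `|B|.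
      by rewrite normrM ler_piMr// ler_norml sin_geN1 sin_le1.
    have h1 := ler_normD (- (a / t) + A * cos (xi * x)) (B * sin (xi * x)).
    have h2 := ler_normD (- (a / t)) (A * cos (xi * x)); rewrite normrN in h2.
    lra.
  + rewrite -[X in _ --> X]oppr0 -[X in - X](mulr0 K).
    by apply: cvgN; apply: cvgMl_tmp; exact: cvgy_expN.
  + rewrite -[X in _ --> X](mulr0 K).
    by apply: cvgMl_tmp; exact: cvgy_expN.
- by move=> x _; exact: ex_derive.
- apply: cvg_at_right_filter; apply: differentiable_continuous.
  by apply/derivable1_diffP.
- by move=> x _; rewrite derive1E derive_val.
Qed.

Lemma trig_laplace_integrable a b c xi t : 0 < t -> (forall x, 0 <= trig a b c xi x) ->
  mu.-integrable pos (EFin \o (fun x => trig a b c xi x * expR (- (t * x)))) /\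
  \int[mu]_(x in pos) (trig a b c xi x * expR (- (t * x))) =
  a / t + (b * t + c * xi) / (t ^+ 2 + xi ^+ 2).
Proof.
move=> t0 tr0; have E := trig_laplace _ _ _ _ _ t0 tr0; split; last first.
  by rewrite /Rintegral E.
apply/integrableP; split.
  have mt : measurable_fun setT (fun x : R => trig a b c xi x * expR (- (t * x))).
    by rewrite /trig; meas_tac.
  by apply/measurable_EFinP; exact: measurable_funTS.
under eq_integral do rewrite /= ger0_norm ?mulr_ge0 ?expR_ge0//.
by rewrite E ltry.
Qed.

Lemma exp_laplace t : 0 < t ->
  mu.-integrable pos (EFin \o (fun x => expR (- (t * x)))) /\
  \int[mu]_(x in pos) expR (- (t * x)) = t^-1.
Proof.
move=> t0; have [] := trig_laplace_integrable 1 0 0 0 _ t0.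
  by move=> x; rewrite /trig !mul0r !addr0.
have -> : (fun x => trig 1 0 0 0 x * expR (- (t * x))) = (fun x => expR (- (t * x))).
  by apply/funext => x; rewrite /trig !mul0r !addr0 mul1r.
by rewrite !mul0r !addr0 mul0r addr0 mul1r.
Qed.

Lemma one_sub_cos_laplace xi t : 0 < t ->
  mu.-integrable pos (EFin \o (fun x => (1 - cos (xi * x)) * expR (- (t * x)))) /\
  \int[mu]_(x in pos) ((1 - cos (xi * x)) * expR (- (t * x))) =
  t^-1 - t / (t ^+ 2 + xi ^+ 2).
Proof.
move=> t0; have [] := trig_laplace_integrable 1 (-1) 0 xi _ t0.
  by move=> x; rewrite /trig mul0r addr0 mulN1r subr_ge0 cos_le1.
have -> : (fun x => trig 1 (-1) 0 xi x * expR (- (t * x))) =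
    (fun x => (1 - cos (xi * x)) * expR (- (t * x))).
  by apply/funext => x; rewrite /trig mul0r addr0 mulN1r.
by rewrite mul0r addr0 mul1r mulN1r mulNr.
Qed.

(** The sine changes sign, so it is treated as the nonnegative function 1 + sin minus 1. *)
Lemma sin_laplace xi t : 0 < t ->
  mu.-integrable pos (EFin \o (fun x => sin (xi * x) * expR (- (t * x)))) /\
  \int[mu]_(x in pos) (sin (xi * x) * expR (- (t * x))) = xi / (t ^+ 2 + xi ^+ 2).
Proof.
move=> t0; have [i1 E1] := exp_laplace _ t0.
have [] := trig_laplace_integrable 1 0 1 xi _ t0.
  by move=> x; rewrite /trig mul0r addr0 mul1r -lerBlDl sub0r sin_geN1.
move=> i2 E2.
have E : (fun x => sin (xi * x) * expR (- (t * x))) =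
  (fun x => trig 1 0 1 xi x * expR (- (t * x)) - expR (- (t * x))).
  by apply/funext => x; rewrite /trig; ring.
rewrite E; split; first exact: (integrableB _ i2 i1).
by rewrite RintegralB// E1 E2; field; rewrite !gt_eqF ?ltr_wpDr ?sqr_ge0 ?exprn_gt0.
Qed.

End TrigLaplace.

Section ElementaryBounds.
Context {R : realType}.
Implicit Types (x y t : R).

Lemma MVT0 (f df : R -> R) y : (forall x, is_derive x 1 f (df x)) -> 0 < y ->
  exists2 c, 0 < c < y & f y - f 0 = df c * y.
Proof.
move=> fdf y0; have [|c] := @MVT R f df 0 y y0 (fun x _ => fdf x).
  apply: continuous_subspaceT => x.
  by apply: differentiable_continuous; apply/derivable1_diffP.
by rewrite in_itv/= => cy; rewrite subr0 => E; exists c.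
Qed.

Lemma normr_sin_le y : `|sin y| <= `|y|.
Proof.
wlog y0 : y / 0 < y => [H|].
  have [|y0|<-] := ltgtP 0 y; [exact: H| |by rewrite sin0 normr0].
  by rewrite -normrN -sinN -[leRHS]normrN H// oppr_gt0.
have [c _] := MVT0 _ _ _ (@is_derive_sin R) y0; rewrite sin0 subr0 => ->.
by rewrite normrM ler_piMl// ler_norml cos_geN1 cos_le1.
Qed.

Lemma one_sub_cos_le_norm y : 1 - cos y <= `|y|.
Proof.
wlog y0 : y / 0 < y => [H|].
  have [|y0|<-] := ltgtP 0 y; [exact: H| |by rewrite cos0 subrr normr0].
  by rewrite -cosN -normrN H// oppr_gt0.
have [c _ E] := MVT0 _ _ _ (@is_derive_cos R) y0.
have -> : 1 - cos y = sin c * y by move: E; rewrite cos0; lra.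
by rewrite (le_trans (ler_norm _))// normrM ler_piMl// ler_norml sin_geN1 sin_le1.
Qed.

Lemma one_sub_cos_le_sqr y : 1 - cos y <= y ^+ 2.
Proof.
wlog y0 : y / 0 < y => [H|].
  have [|y0|<-] := ltgtP 0 y; [exact: H| |by rewrite cos0 subrr sqr_ge0].
  by rewrite -cosN -sqrrN H// oppr_gt0.
have [c /andP[c0 cy] E] := MVT0 _ _ _ (@is_derive_cos R) y0.
have -> : 1 - cos y = sin c * y by move: E; rewrite cos0; lra.
rewrite expr2 ler_wpM2r ?(ltW y0)//.
by rewrite (le_trans (ler_norm _))// (le_trans (normr_sin_le _))// gtr0_norm// ltW.
Qed.

Lemma norm_sub_sin_le y : `|y - sin y| <= y ^+ 2.
Proof.
wlog y0 : y / 0 < y => [H|].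
  have [|y0|<-] := ltgtP 0 y; [exact: H| |by rewrite sin0 subr0 normr0 sqr_ge0].
  have := H (- y); rewrite oppr_gt0 sinN sqrrN => /(_ y0).
  by rewrite -opprD normrN.
have dxs (x : R) : is_derive x 1 (fun y : R => y - sin y) (1 - cos x).
  have -> : (fun y : R => y - sin y) = id - @sin R by [].
  by apply: is_deriveB.
have [c /andP[c0 cy]] := MVT0 _ _ _ dxs y0; rewrite sin0 !subr0 => ->.
rewrite normrM (gtr0_norm y0) expr2 ler_wpM2r ?(ltW y0)//.
rewrite ger0_norm ?subr_ge0 ?cos_le1//.
by rewrite (le_trans (one_sub_cos_le_norm _))// gtr0_norm// ltW.
Qed.

(* The Laplace transform of this majorant of [min 1 (x ^ 2)] (up to a constant)
   is an explicit rational function comparable to [slm_weight]. *)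
Definition levy_majorant x : R := (1 - expR (- x)) ^+ 2.

Lemma levy_majorant_bound (A x h : R) : 0 < x -> `|h| <= A * Num.min 1 (x ^+ 2) ->
  `|h| <= 4 * A * levy_majorant x.
Proof.
move=> x0 hA.
have m0 : 0 < Num.min 1 (x ^+ 2) by rewrite lt_min ltr01 exprn_gt0.
have A0 : 0 <= A by rewrite -(pmulr_lge0 _ m0) (le_trans _ hA).
have h1 : `|h| <= A.
  by rewrite (le_trans hA)// ler_piMr// ge_min lexx.
have h2 : `|h| <= A * x ^+ 2.
  by rewrite (le_trans hA)// ler_wpM2l// ge_min lexx orbT.
(* Equivalent to 1 + x <= exp x. *)
have q : x / (1 + x) <= 1 - expR (- x).
  rewrite expRN lerBrDl -lerBrDr.
  have -> : 1 - x / (1 + x) = (1 + x)^-1 by field; rewrite gt_eqF// addr_gt0.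
  by rewrite lef_pV2 ?posrE ?expR_gt0 ?addr_gt0// expR_ge1Dx.
have q0 : 0 <= x / (1 + x) by rewrite divr_ge0 ?addr_ge0// ltW.
apply: (@le_trans _ _ (4 * A * (x / (1 + x)) ^+ 2)); last first.
  by rewrite ler_wpM2l ?mulr_ge0// /levy_majorant lerXn2r// nnegrE (le_trans q0).
rewrite expr_div_n mulrA ler_pdivlMr ?exprn_gt0 ?addr_gt0//.
(* The constant 4 comes from (1 + x)^2 <= 2 + 2 x^2 combined with |h| <= A x^2 and |h| x^2 <= A
   x^2. *)
have h3 : `|h| * x ^+ 2 <= A * x ^+ 2 by rewrite ler_wpM2r ?sqr_ge0.
have h4 : 0 <= `|h| * (1 - x) ^+ 2 by rewrite mulr_ge0 ?sqr_ge0.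
nra.
Qed.

(** Expanding the square gives the transform 1/t - 2/(t + 1) + 1/(t + 2) = 2 / (t (t + 1) (t +
    2)). *)
Lemma levy_majorant_laplace t : 0 < t ->
  (\int[lebesgue_measure]_(x in `]0%R, +oo[)
     (levy_majorant x * expR (- (t * x)))%:E <= (2 * slm_weight t)%:E)%E.
Proof.
move=> t0.
have t1 : 0 < t + 1 by lra.
have t2 : 0 < t + 2 by lra.
have [i0 E0] := exp_laplace _ t0.
have [i1 E1] := exp_laplace _ t1.
have [i2 E2] := exp_laplace _ t2.
have E x : levy_majorant x * expR (- (t * x)) = expR (- (t * x)) -
    2 * expR (- ((t + 1) * x)) + expR (- ((t + 2) * x)).
  rewrite /levy_majorant.
  have -> : - ((t + 1) * x) = - (t * x) + - x by ring.
  have -> : - ((t + 2) * x) = - (t * x) + (- x + - x) by ring.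
  by rewrite !expRD; ring.
have i1' : lebesgue_measure.-integrable `]0, +oo[
    (EFin \o (fun x : R => 2 * expR (- ((t + 1) * x)))).
  by have := integrableZl _ 2 i1; apply.
have mp : measurable (`]0%R, +oo[%classic : set (measurableTypeR R)) by [].
have i01 := integrableB mp i0 i1'.
have iE : lebesgue_measure.-integrable `]0, +oo[
    (EFin \o (fun x : R => levy_majorant x * expR (- (t * x)))).
  apply: eq_integrable (integrableD mp i01 i2) => // x _.
  by rewrite /= E.
rewrite -[leLHS]fineK; last exact: integrable_fin_num iE.
rewrite lee_fin -[leLHS]/(\int[lebesgue_measure]_(x in `]0, +oo[)
  (levy_majorant x * expR (- (t * x)))).
under eq_Rintegral do rewrite E.
rewrite RintegralD// RintegralB// RintegralZl// E0 E1 E2.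
have -> : t^-1 - 2 * (t + 1)^-1 + (t + 2)^-1 = 2 * (t * (t + 1) * (t + 2))^-1.
  by field; rewrite !gt_eqF.
rewrite ler_wpM2l// /slm_weight lef_pV2 ?posrE ?mulr_gt0 ?exprn_gt0 ?addr_gt0//.
by rewrite expr2 mulrA (addrC 1 t) ler_wpM2l ?mulr_ge0 ?(ltW t0) ?(ltW t1)//; lra.
Qed.

(** The inverse weight is at most (1 + t)^3. A cube of the exponential's linear lower bound beats
    it: exp (t x) >= (1 + t x / 3)^3, while 1 + t <= (1 + 3 / x) (1 + t x / 3). *)
Lemma expR_slm_bound x t : 0 < x -> 0 < t ->
  expR (- (t * x)) <= (1 + 3 / x) ^+ 3 * slm_weight t.
Proof.
move=> x0 t0.
have e1 : 1 + t * x / 3 <= expR (t * x / 3) by exact: expR_ge1Dx.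
have e0 : 0 <= 1 + t * x / 3 by rewrite addr_ge0 ?divr_ge0 ?mulr_ge0// ltW.
have e3 : (1 + t * x / 3) ^+ 3 <= expR (t * x).
  have -> : expR (t * x) = expR (t * x / 3) ^+ 3.
    by rewrite -expRM_natl; congr expR; field.
  by rewrite lerXn2r ?nnegrE ?expR_ge0.
rewrite expRN /slm_weight ler_pdivlMr ?mulr_gt0 ?exprn_gt0 ?addr_gt0//.
rewrite ler_pdivrMl ?expR_gt0//.
have ht : 1 + t <= (1 + 3 / x) * (1 + t * x / 3).
  have -> : (1 + 3 / x) * (1 + t * x / 3) = 1 + t + (t * x / 3 + 3 / x).
    by field; rewrite gt_eqF.
  by rewrite lerDl addr_ge0 ?divr_ge0 ?mulr_ge0// ltW.
have h3 : (1 + t) ^+ 3 <= (1 + 3 / x) ^+ 3 * (1 + t * x / 3) ^+ 3.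
  rewrite -exprMn lerXn2r ?nnegrE ?addr_ge0 ?(ltW t0)//.
  by rewrite mulr_ge0// addr_ge0 ?divr_ge0// ltW.
apply: (@le_trans _ _ ((1 + t) ^+ 3)).
  by rewrite [leRHS]exprS ler_wpM2r ?sqr_ge0// lerDr.
apply: (le_trans h3); rewrite mulrC ler_wpM2r//.
by rewrite exprn_ge0// addr_ge0 ?divr_ge0// ltW.
Qed.

End ElementaryBounds.

Section LaplaceFubini.
Context {R : realType}.
Notation meas := {measure set (measurableTypeR R) -> \bar R}.
Notation mu := (@lebesgue_measure R).
Notation pos := (`]0%R, +oo[%classic : set (measurableTypeR R)).
Implicit Types (G : meas) (h : R -> R).

Definition laplace G (x : R) : R := \int[G]_(t in pos) expR (- (t * x)).

Lemma laplace_integrable G x : slm_measure G -> 0 < x ->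
  G.-integrable pos (EFin \o (fun t => expR (- (t * x)))).
Proof.
move=> Gw x0; apply: (slm_integrable G _ ((1 + 3 / x) ^+ 3)) => //.
  by meas_tac.
by move=> t t0; rewrite ger0_norm ?expR_ge0//; exact: expR_slm_bound.
Qed.

(** The domination of [h] is chosen so that, for fixed [t], the integral of |h x| exp (- t x) over
    [x] is at most 2 A [slm_weight t], which is [G]-integrable. *)
Lemma laplace_Fubini G h (A : R) : slm_measure G -> measurable_fun setT h ->
  (forall x, 0 < x -> `|h x| <= A * levy_majorant x) ->
  [/\ mu.-integrable pos (EFin \o (fun x => h x * laplace G x)),
      G.-integrable pos
        (EFin \o (fun t => \int[mu]_(x in pos) (h x * expR (- (t * x))))) &
      \int[mu]_(x in pos) (h x * laplace G x) =
      \int[G]_(t in pos) \int[mu]_(x in pos) (h x * expR (- (t * x)))].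
Proof.
move=> Gw mh hA.
have A0 : 0 <= A.
  have := hA 1 ltr01; rewrite -(pmulr_lge0 A (x := levy_majorant 1)).
    exact: le_trans.
  by rewrite exprn_gt0// subr_gt0 expRN invf_lt1 ?expR_gt0// expR_gt1.
have [_ iw] := Gw.
have ih x : 0 < x -> G.-integrable pos (fun t => (h x * expR (- (t * x)))%:E).
  by move=> x0; have := integrableZl _ (h x) (laplace_integrable _ _ Gw x0); apply.
have [] := @Rintegral_Fubini _ _ _ _ R mu G pos pos
  (fun x t => h x * expR (- (t * x))) (fun t => A * 2 * slm_weight t).
- exact: sigma_finiteT.
- exact: slm_sigma_finite.
- by [].
- by [].
- apply: measurable_funM; first exact: (measurableT_comp mh measurable_fst).
  by meas_tac.
- by have := integrableZl _ (A * 2) iw; apply.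
- move=> t; rewrite pos_itv => t0.
  apply: (@le_trans _ _ (\int[mu]_(x in pos) (A%:E * (levy_majorant x * expR (- (t * x)))%:E))%E).
    have mm : measurable_fun setT (fun x : R => levy_majorant x * expR (- (t * x))).
      by rewrite /levy_majorant; meas_tac.
    apply: ge0_le_integral => //.
    + apply/measurable_EFinP; apply: measurable_funTS; apply: measurableT_comp => //.
      by apply: measurable_funM => //; meas_tac.
    + apply: measurable_funTS; apply: measurable_funeM.
      exact/measurable_EFinP.
    + move=> x; rewrite pos_itv => x0.
      rewrite -EFinM lee_fin normrM [`|expR _|]ger0_norm ?expR_ge0// mulrA.
      by rewrite ler_wpM2r ?expR_ge0// hA.
  rewrite ge0_integralZl//.
  + by rewrite -mulrA EFinM lee_wpmul2l ?lee_fin// levy_majorant_laplace.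
  + apply: measurable_funTS; apply/measurable_EFinP.
    by rewrite /levy_majorant; meas_tac.
  + by move=> x _; rewrite lee_fin mulr_ge0 ?sqr_ge0 ?expR_ge0.
- by move=> x; rewrite pos_itv; exact: ih.
have E x : 0 < x -> \int[G]_(t in pos) (h x * expR (- (t * x))) = h x * laplace G x.
  by move=> x0; rewrite RintegralZl//; exact: laplace_integrable.
move=> i1 i2 i3; split => //.
  apply: eq_integrable i1 => // x /set_mem; rewrite pos_itv => x0.
  by rewrite /= E.
by rewrite -i3; apply: eq_Rintegral => x /set_mem; rewrite pos_itv => x0; rewrite E.
Qed.

End LaplaceFubini.

Section LevyKhintchine.
Context {R : realType}.
Notation meas := {measure set (measurableTypeR R) -> \bar R}.
Notation mu := (@lebesgue_measure R).
Notation pos := (`]0%R, +oo[%classic : set (measurableTypeR R)).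
Implicit Types (G : meas) (h : R -> R) (Gm Gp : @smeasure R).

Definition slm_smeasure (G : @smeasure R) :=
  slm_measure (spos G) /\ slm_measure (sneg G).

Lemma Rintegral_pos_neg (g : R -> R) : mu.-integrable setT (EFin \o g) ->
  \int[mu]_x g x = \int[mu]_(x in pos) g x + \int[mu]_(x in pos) g (- x).
Proof.
move=> ig.
have mneg : measurable (`]-oo, 0%R[%classic : set (measurableTypeR R)) by [].
have mneg0 : measurable (`]-oo, 0%R]%classic : set (measurableTypeR R)) by [].
have mpos : measurable pos by [].
have E : (setT : set R) = `]-oo, 0%R]%classic `|` `]0%R, +oo[%classic.
  by rewrite -itv_bndbnd_setU// set_itvE.
rewrite {1}E Rintegral_setU//; last 2 first.
- by rewrite -E.
- by apply/disj_set2P/seteqP; split => // x /= []; rewrite !in_itv/= andbT leNgt => /negP.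
rewrite addrC; congr (_ + _).
rewrite -Rintegral_itv_bndo_bndc; last first.
  by apply: (integrableS _ _ _ ig).
have ineg : mu.-integrable setT (EFin \o (g \_ `]-oo, 0%R[%classic)).
  have := integrableS measurableT mneg (@subsetT _ _) ig.
  by move/(integrable_mkcond _ mneg); rewrite restrict_EFin.
rewrite Rintegral_mkcond [RHS]Rintegral_mkcond.
have [_ ->] := Rintegral_reflect _ ineg.
apply: eq_Rintegral => x _; rewrite !patchE.
congr (if _ then _ else _).
by apply/idP/idP; rewrite !inE/= !in_itv/= andbT oppr_lt0.
Qed.

Lemma sSL_density_pos Gm Gp x : 0 < x ->
  sSL_density Gm Gp x = laplace (spos Gp) x - laplace (sneg Gp) x.
Proof.
move=> x0; rewrite /sSL_density.
have -> : \1_`]-oo, 0[ x = 0 :> R.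
  by rewrite indicE memNset//= in_itv/=; apply/negP; rewrite -leNgt ltW.
have -> : \1_`]0, +oo[ x = 1 :> R by rewrite indicE mem_set//= in_itv/= x0.
by rewrite mul0r add0r mul1r.
Qed.

Lemma sSL_density_neg Gm Gp x : 0 < x ->
  sSL_density Gm Gp (- x) = laplace (spos Gm) x - laplace (sneg Gm) x.
Proof.
move=> x0; rewrite /sSL_density.
have -> : \1_`]-oo, 0[ (- x) = 1 :> R by rewrite indicE mem_set//= in_itv/= oppr_lt0.
have -> : \1_`]0, +oo[ (- x) = 0 :> R.
  by rewrite indicE memNset//= in_itv/= andbT; apply/negP; rewrite -leNgt oppr_le0 ltW.
rewrite mul0r addr0 mul1r.
by rewrite /sint /laplace; congr (_ - _); apply: eq_Rintegral => t _; rewrite mulrN.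
Qed.

Definition laplace_of h (t : R) : R := \int[mu]_(x in pos) (h x * expR (- (t * x))).

(** The density splits [nu] into its two half lines, the negative one being reflected. Although only
    the differences of Laplace transforms are densities, the four integrals against their parts
    converge separately because [h] is dominated by [levy_majorant]. *)
Lemma levy_integral Gm Gp (nu : meas) h (A : R) :
  slm_smeasure Gm -> slm_smeasure Gp ->
  measurable_fun setT (sSL_density Gm Gp) ->
  (forall x, 0 <= sSL_density Gm Gp x) ->
  (forall B : set (measurableTypeR R), measurable B ->
     nu B = (\int[mu]_(x in B) (sSL_density Gm Gp x)%:E)%E) ->
  is_levy_measure nu -> measurable_fun setT h ->
  (forall x, `|h x| <= A * Num.min 1 (x ^+ 2)) ->
  nu.-integrable setT (EFin \o h) /\
  \int[nu]_x h x = sint Gp (laplace_of h) + sint Gm (laplace_of (fun x => h (- x))).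
Proof.
move=> [Gmp Gmn] [Gpp Gpn] mf f0 nuE [_ nufin] mh hA.
set f := sSL_density Gm Gp in mf f0 nuE *.
have mmin : measurable_fun setT (fun x : R => Num.min 1 (x ^+ 2)).
  by apply: measurable_minr; meas_tac.
have min0 (x : R) : 0 <= Num.min 1 (x ^+ 2) by rewrite le_min ler01 sqr_ge0.
have imin : nu.-integrable setT (EFin \o (fun x : R => Num.min 1 (x ^+ 2))).
  apply/integrableP; split; first exact/measurable_EFinP.
  by under eq_integral do rewrite /= ger0_norm//.
have ih : nu.-integrable setT (EFin \o h).
  apply: (le_integrable _ _ _ (integrableZl measurableT A imin)) => //.
  - exact/measurable_EFinP.
  - by move=> x _; rewrite /= lee_fin (le_trans (hA x))// ler_norm.
split => //.
have [ihf ->] := @Rintegral_density _ (measurableTypeR R) R mu nu f h mf f0 nuE ih.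
rewrite (Rintegral_pos_neg (fun x => h x * f x) ihf).
have hp x : 0 < x -> `|h x| <= 4 * A * levy_majorant x.
  by move=> x0; exact: levy_majorant_bound.
have hn x : 0 < x -> `|h (- x)| <= 4 * A * levy_majorant x.
  by move=> x0; apply: levy_majorant_bound => //; rewrite -[x ^+ 2]sqrrN.
have mhn : measurable_fun setT (fun x : R => h (- x)).
  by apply: (measurableT_comp mh); meas_tac.
have mpos : measurable pos by [].
have [p1 _ e1] := laplace_Fubini _ _ _ Gpp mh hp.
have [p2 _ e2] := laplace_Fubini _ _ _ Gpn mh hp.
have [p3 _ e3] := laplace_Fubini _ _ _ Gmp mhn hn.
have [p4 _ e4] := laplace_Fubini _ _ _ Gmn mhn hn.
congr (_ + _).
- rewrite /sint /laplace_of -e1 -e2 -RintegralB//.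
  apply: eq_Rintegral => x /set_mem; rewrite pos_itv => x0.
  by rewrite /f sSL_density_pos// mulrBr.
- rewrite /sint /laplace_of -e3 -e4 -RintegralB//.
  apply: eq_Rintegral => x /set_mem; rewrite pos_itv => x0.
  by rewrite /f sSL_density_neg// mulrBr.
Qed.

Lemma slm_kernelE (z : R[i]) (t : R) : slm_kernel z t =
  (t^-1 - (t + complex.Im z) / ((t + complex.Im z) ^+ 2 + complex.Re z ^+ 2)
     - complex.Im z / (1 + t ^+ 2)) +i*
  (complex.Re z / (1 + t ^+ 2)
     - complex.Re z / ((t + complex.Im z) ^+ 2 + complex.Re z ^+ 2)).
Proof.
rewrite /slm_kernel denom_ReIm; case: z => x y /=.
by apply/eqP; rewrite eq_complex/= sqrrN; apply/andP; split; apply/eqP; ring.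
Qed.

Lemma laplace_of_one_sub_cos xi t : 0 < t ->
  laplace_of (fun x => 1 - cos (xi * x)) t = complex.Re (slm_kernel xi%:C t).
Proof.
move=> t0; rewrite slm_kernelE/= addr0 mul0r subr0.
by have [_] := one_sub_cos_laplace xi _ t0.
Qed.

Lemma laplace_of_sin xi t : 0 < t ->
  laplace_of (fun x => xi * sin x - sin (xi * x)) t = complex.Im (slm_kernel xi%:C t).
Proof.
move=> t0; rewrite slm_kernelE/= addr0.
have [i1 E1] := sin_laplace 1 _ t0.
have [i2 E2] := sin_laplace xi _ t0.
rewrite /laplace_of.
under eq_Rintegral => x _.
  have -> : (xi * sin x - sin (xi * x)) * expR (- (t * x)) =
    xi * (sin (1 * x) * expR (- (t * x))) - sin (xi * x) * expR (- (t * x)).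
    by rewrite mul1r; ring.
  over.
rewrite RintegralB//; last by have := integrableZl _ xi i1; apply.
by rewrite RintegralZl// E1 E2 expr1n mul1r (addrC (t ^+ 2) 1).
Qed.

Definition levy_exponent (a b : R) Gm Gp (z : R[i]) : R[i] :=
  a%:C * z ^+ 2 - b *i * z
  + (slm_exponent (spos Gp) z - slm_exponent (sneg Gp) z)
  + (slm_exponent (spos Gm) (- z) - slm_exponent (sneg Gm) (- z)).

End LevyKhintchine.

(** * Identification of the exponent off the imaginary axis *)

Section CharacteristicExponent.
Context {R : realType}.
Notation meas := {measure set (measurableTypeR R) -> \bar R}.
Implicit Types (Gm Gp : @smeasure R) (u v : R[i]).

(** The exponential is not injective, but the whole ray of times removes the ambiguity: moduli give
    equal real parts, and a suitable [t] excludes different imaginary parts. *)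
Lemma cexp_ray_inj u v :
  (forall t : R, 0 <= t -> cexp (- (t%:C * u)) = cexp (- (t%:C * v))) -> u = v.
Proof.
case: u v => [a b] [c d] uv.
have Ht (t : R) : 0 <= t -> expR (- (t * a)) * cos (t * b) = expR (- (t * c)) * cos (t * d)
    /\ expR (- (t * a)) * sin (t * b) = expR (- (t * c)) * sin (t * d).
  move=> t0; have := uv t t0; rewrite /cexp/= !mul0r subr0 !addr0 subr0 => -[E1 E2].
  split; first by move: E1; rewrite !cosN.
  by move: E2; rewrite !sinN !mulrN => /oppr_inj.
have ex (t : R) : 0 <= t -> expR (- (t * a)) = expR (- (t * c)).
  move=> /Ht[E1 E2]; apply/eqP; rewrite -(@eqrXn2 _ 2)// ?expR_ge0//; apply/eqP.
  have := cos2Dsin2 (t * b); have := cos2Dsin2 (t * d) => h1 h2.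
  rewrite -[LHS]mulr1 -[RHS]mulr1 -{1}h2 -{1}h1 !mulrDr -!exprMn E1 E2//.
have ac : a = c.
  by have := ex 1 ler01; rewrite !mul1r => /expR_inj/oppr_inj.
congr (_ +i* _) => //.
have sc (t : R) : 0 <= t -> cos (t * b) = cos (t * d) /\ sin (t * b) = sin (t * d).
  move=> t0; have [E1 E2] := Ht t t0; rewrite (ex t t0) in E1 E2.
  have e0 : expR (- (t * c)) != 0 by rewrite gt_eqF ?expR_gt0.
  by split; [exact: (mulfI e0)|exact: (mulfI e0)].
apply/eqP; rewrite -subr_eq0; apply/eqP; apply: contrapT => /eqP bd0.
(* This makes the phase difference a quarter turn, whose sine is not zero. *)
pose t := (pi / 2) / `|b - d|.
have t0 : 0 <= t by rewrite divr_ge0 ?divr_ge0 ?pi_ge0.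
have [E1 E2] := sc _ t0.
have s0 : sin (t * (b - d)) = 0.
  by rewrite mulrBr sinB E1 E2 mulrC subrr.
have : t * (b - d) = pi / 2 \/ t * (b - d) = - (pi / 2).
  have nb : `|b - d| != 0 by rewrite normr_eq0.
  have [bd|bd] := leP 0 (b - d).
    by left; rewrite /t ger0_norm// -mulrA mulVf// mulr1.
  right; rewrite /t ltr0_norm// invrN mulrN mulNr -mulrA mulVf// mulr1//.
case=> E; move: s0; rewrite E ?sinN sin_pihalf => /eqP; rewrite ?oppr_eq0 oner_eq0//.
Qed.

(** Stated for [xi != 0], where [slm_exponent] is known to be the integral of [slm_kernel]; every
    vertical line off the imaginary axis still contains such a real point. *)
Lemma levy_exponent_real Gm Gp (sigma2 b : R) (nu : meas) :
  slm_smeasure Gm -> slm_smeasure Gp ->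
  measurable_fun setT (sSL_density Gm Gp) ->
  (forall x, 0 <= sSL_density Gm Gp x) ->
  (forall B : set (measurableTypeR R), measurable B ->
     nu B = (\int[lebesgue_measure]_(x in B) (sSL_density Gm Gp x)%:E)%E) ->
  is_levy_measure nu ->
  exists b' : R, forall xi : R, xi != 0 ->
    levy_khintchine sigma2 b nu xi = levy_exponent (sigma2 / 2) b' Gm Gp xi%:C.
Proof.
move=> Gmw Gpw mf f0 nuE lm.
have LI := levy_integral Gm Gp nu _ _ Gmw Gpw mf f0 nuE lm.
have mini (A x y : R) : 0 <= A -> y <= A -> y <= A * x ^+ 2 -> y <= A * Num.min 1 (x ^+ 2).
  by move=> A0 h1 h2; rewrite minr_pMr// mulr1 le_min h1 h2.
(* Trading the truncation for [sin] only changes the drift, by [\int hb dnu]. *)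
pose hb (x : R) := x * \1_`[-1, 1] x - sin x.
have mhb : measurable_fun setT hb.
  apply: measurable_funB; last by meas_tac.
  by apply: measurable_funM => //; exact: measurable_indic.
have [|ihb _] := LI hb 2 mhb.
  move=> x; rewrite /hb indicE.
  case: (boolP (x \in _)) => [/set_mem/=|xn].
    rewrite in_itv/= => /andP[x1 x2]; rewrite mulr1.
    have := norm_sub_sin_le x => sx.
    apply: mini => //; first apply: (le_trans sx).
      nra.
    by rewrite (le_trans sx)// ler_peMl ?sqr_ge0// ler1n.
  rewrite mulr0 sub0r normrN.
  have s1 : `|sin x| <= 1 by rewrite ler_norml sin_geN1 sin_le1.
  apply: mini => //; first by rewrite (le_trans s1)// ler1n.
  have x1 : 1 <= x ^+ 2.
    rewrite leNgt; apply: contra xn => x1; rewrite inE/= in_itv/= -ler_norml.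
    by rewrite -(@ler_pXn2r _ 2)// ?nnegrE// expr1n real_normK ?num_real// ltW.
  lra.
pose beta := \int[nu]_x hb x.
exists (b - beta) => xi xi0.
pose h1 (x : R) := 1 - cos (xi * x).
pose h2 (x : R) := xi * sin x - sin (xi * x).
have mh1 : measurable_fun setT h1 by rewrite /h1; meas_tac.
have mh2 : measurable_fun setT h2 by rewrite /h2; meas_tac.
have c2 (y : R) : 1 - cos y <= 2.
  by have := cos_geN1 y; lra.
have [|ih1 E1] := LI h1 (2 + xi ^+ 2) mh1.
  move=> x; rewrite /h1 ger0_norm ?subr_ge0 ?cos_le1//.
  apply: mini; first by rewrite addr_ge0 ?sqr_ge0.
    by rewrite (le_trans (c2 _))// lerDl sqr_ge0.
  rewrite (le_trans (one_sub_cos_le_sqr _))// exprMn ler_wpM2r ?sqr_ge0//.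
  by rewrite lerDr.
have [|ih2 E2] := LI h2 (`|xi| + 1 + xi ^+ 2) mh2.
  move=> x; rewrite /h2.
  have s1 (y : R) : `|sin y| <= 1 by rewrite ler_norml sin_geN1 sin_le1.
  apply: mini; first by rewrite !addr_ge0 ?sqr_ge0.
    rewrite (le_trans (ler_normB _ _))// -addrA lerD//.
      by rewrite normrM ler_piMr.
    by rewrite (le_trans (s1 _))// lerDl sqr_ge0.
  have -> : xi * sin x - sin (xi * x) = - (xi * (x - sin x)) + (xi * x - sin (xi * x)) by ring.
  rewrite (le_trans (ler_normD _ _))// normrN normrM.
  have a1 : `|xi| * `|x - sin x| <= `|xi| * x ^+ 2.
    by rewrite ler_wpM2l// norm_sub_sin_le.
  have a2 := norm_sub_sin_le (xi * x); rewrite exprMn in a2.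
  have := sqr_ge0 x; lra.
have sI (F : R -> R) (c : R) : nu.-integrable setT (EFin \o F) ->
  nu.-integrable setT (EFin \o (fun x => c * F x)).
  by move=> iF; have := integrableZl measurableT c iF; apply.
have -> : levy_khintchine sigma2 b nu xi =
    (sigma2 / 2 * xi ^+ 2 + \int[nu]_x h1 x) +i* (- ((b - beta) * xi) + \int[nu]_x h2 x).
  rewrite /levy_khintchine; congr (_ +i* _).
  have -> : \int[nu]_x (xi * x * \1_`[-1, 1] x - sin (xi * x)) =
      \int[nu]_x (xi * hb x + h2 x).
    by apply: eq_Rintegral => x _; rewrite /hb /h2; ring.
  rewrite RintegralD//; last exact: sI.
  by rewrite RintegralZl// -/beta; ring.
rewrite E1 E2.
have z0 : complex.Re xi%:C != 0 by [].
have z0' : complex.Re (- xi%:C) != 0 by rewrite /= oppr_eq0.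
have [Gm1 Gm2] := Gmw; have [Gp1 Gp2] := Gpw.
rewrite /levy_exponent (slm_exponentE _ _ Gp1 z0) (slm_exponentE _ _ Gp2 z0).
rewrite (slm_exponentE _ _ Gm1 z0') (slm_exponentE _ _ Gm2 z0').
have S1 (G : @smeasure R) (x : R) : sint G (laplace_of (fun y => 1 - cos (x * y))) =
   sint G (fun t => complex.Re (slm_kernel x%:C t)).
  rewrite /sint; congr (_ - _); apply: eq_Rintegral => t /set_mem; rewrite pos_itv;
    exact: laplace_of_one_sub_cos.
have S2 (G : @smeasure R) (x : R) : sint G (laplace_of (fun y => x * sin y - sin (x * y))) =
   sint G (fun t => complex.Im (slm_kernel x%:C t)).
  rewrite /sint; congr (_ - _); apply: eq_Rintegral => t /set_mem; rewrite pos_itv;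
    exact: laplace_of_sin.
(* Reflecting [x] amounts to replacing [xi] by [- xi], so the same Laplace formulas produce the
   terms of [Gm] at [- z]. *)
have -> : (fun x : R => h1 (- x)) = (fun y => 1 - cos (- xi * y)).
  by apply/funext => x; rewrite /h1 mulrN mulNr.
have -> : (fun x : R => h2 (- x)) = (fun y => - xi * sin y - sin (- xi * y)).
  by apply/funext => x; rewrite /h2 sinN mulrN !mulNr mulrN.
rewrite /h1 /h2 !S1 !S2 /sint /cint.
have -> : - xi%:C = (- xi)%:C by rewrite rmorphN.
by apply/eqP; rewrite eq_complex/= expr2/=; apply/andP; split; apply/eqP; ring.
Qed.

Lemma levy_exponent_analytic (a b : R) Gm Gp (z : R[i]) :
  slm_smeasure Gm -> slm_smeasure Gp -> complex.Re z != 0 ->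
  analytic_at (levy_exponent a b Gm Gp) z.
Proof.
move=> [Gm1 Gm2] [Gp1 Gp2] z0.
have z0' : complex.Re (- z) != 0 by case: (z) z0 => x y /=; rewrite oppr_eq0.
apply: (@eq_analytic_at _ (fun x => x * (x * a%:C) + - (x * b *i)
  + (slm_exponent (spos Gp) x + - slm_exponent (sneg Gp) x)
  + (slm_exponent (spos Gm) (- x) + - slm_exponent (sneg Gm) (- x)))).
  by move=> x; rewrite /levy_exponent expr2; ring.
apply: analytic_atD; first apply: analytic_atD; first apply: analytic_atD.
- by do 2 apply: analytic_at_mulX; exact: analytic_at_cst.
- by apply: analytic_atN; apply: analytic_at_mulX; exact: analytic_at_cst.
- apply: analytic_atD; first exact: analytic_slm_exponent.
  by apply: analytic_atN; exact: analytic_slm_exponent.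
apply: analytic_atD.
  by apply: (@analytic_at_comp_opp _ (slm_exponent (spos Gm))); exact: analytic_slm_exponent.
apply: analytic_atN.
by apply: (@analytic_at_comp_opp _ (slm_exponent (sneg Gm))); exact: analytic_slm_exponent.
Qed.

Lemma sSLM_slm_smeasure (mum : R) (G : @smeasure R) :
  sSLM mum G -> slm_smeasure G.
Proof. by move=> [/SLM_slm_measure[? _] /SLM_slm_measure[? _] _]. Qed.

Lemma char_exponent_off_axis d (Omega : measurableType d)
    (P : probability Omega R) (X : R -> {RV P >-> R}) (mum mup : R) Gm Gp
    (psi : R[i] -> R[i]) :
  is_sSL mum mup X Gm Gp -> is_char_exponent X psi ->
  analytic_on psi (cut_plane mum mup) ->
  exists a b : R, forall z : R[i], complex.Re z != 0 ->
    psi z = levy_exponent a b Gm Gp z.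
Proof.
move=> [_ hGm hGp [mf [f0 [nu [[lm [sigma2 [b [_ LK]]]] nuE]]]]] hpsi hcont.
have Gmw := sSLM_slm_smeasure _ _ hGm.
have Gpw := sSLM_slm_smeasure _ _ hGp.
have [b' LE] := levy_exponent_real _ _ sigma2 b _ Gmw Gpw mf f0 nuE lm.
exists (sigma2 / 2), b' => z z0.
apply/eqP; rewrite -subr_eq0; apply/eqP.
apply: (@half_plane_identity R (fun z => psi z - levy_exponent (sigma2 / 2) b' Gm Gp z)) z0.
  move=> w w0; apply: analytic_atD; last first.
    by apply: analytic_atN; exact: levy_exponent_analytic.
  by apply: hcont => -[/eqP]; rewrite (negbTE w0).
move=> x x0; apply/eqP; rewrite subr_eq0 -LE//; apply/eqP.
by apply: cexp_ray_inj => t t0; rewrite -hpsi// LK.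
Qed.

End CharacteristicExponent.

(** * Boundary values *)

Lemma Rintegral_dominated_cvg d (T : measurableType d) (R : realType)
    (m : {measure set T -> \bar R}) (D : set T) (f : nat -> T -> R) (l B : T -> R) :
  measurable D -> (forall n, measurable_fun D (f n)) -> measurable_fun D l ->
  {ae m, forall x, D x -> f n x @[n --> \oo] --> l x} ->
  m.-integrable D (EFin \o B) -> (forall n x, D x -> `|f n x| <= B x) ->
  m.-integrable D (EFin \o l) /\
  \int[m]_(x in D) f n x @[n --> \oo] --> \int[m]_(x in D) l x.
Proof.
move=> mD mf ml fl iB fB.
have [] := @dominated_convergence _ T R m D mD (fun n x => (f n x)%:E)
  (EFin \o l) (EFin \o B).
- by move=> n; apply/measurable_EFinP; exact: mf.
- exact/measurable_EFinP.
- apply: filterS fl => x xl /xl xl'; exact/cvg_EFin/xl'/nearW.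
- exact: iB.
- by apply: aeW => x n Dx; rewrite /= lee_fin fB.
move=> il _ cvgI; split => //.
rewrite /Rintegral; apply: fine_cvg; rewrite fineK//.
exact: (integrable_fin_num mD il).
Qed.

Section PoissonKernel.
Context {R : realType}.
Notation meas := {measure set (measurableTypeR R) -> \bar R}.
Notation mu := (@lebesgue_measure R).
Notation pos := (`]0%R, +oo[%classic : set (measurableTypeR R)).
Implicit Types (G : meas) (g L : R -> R) (s t e C : R).

Lemma onesqr_gt0 t : 0 < 1 + t ^+ 2.
Proof. by rewrite ltr_wpDr ?sqr_ge0. Qed.

Lemma cauchy_integrable :
  mu.-integrable setT (EFin \o (fun t : R => (1 + t ^+ 2)^-1)).
Proof.
have mc : measurable_fun setT (fun t : R => (1 + t ^+ 2)^-1) by meas_tac.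
have c0 t : 0 <= (1 + t ^+ 2)^-1 by rewrite invr_ge0 ltW ?onesqr_gt0.
apply/integrableP; split; first exact/measurable_EFinP.
under eq_integral do rewrite /= ger0_norm//.
have -> : (setT : set R) = `]-oo, 0[%classic `|` `[0, +oo[%classic.
  by rewrite -itv_bndbnd_setU// set_itvE.
rewrite ge0_integral_setU//; last 3 first.
- by apply/measurable_EFinP; exact: measurable_funTS.
- by move=> t _; rewrite lee_fin.
- by apply/disj_set2P/seteqP; split => // x /= []; rewrite !in_itv/= andbT => x0; rewrite leNgt x0.
have E := @integral0y_oneDsqr R; rewrite /oneDsqr in E.
rewrite E lte_add_pinfty ?ltry//.
apply: (@le_lt_trans _ _ (\int[mu]_(t in `]-oo, 0%R]) ((1 + t ^+ 2)^-1)%:E)%E).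
  apply: ge0_subset_integral => //.
  - by apply/measurable_EFinP; exact: measurable_funTS.
  - by move=> t _; rewrite lee_fin.
  - by apply: subset_itvl; rewrite bnd_simp.
have := @ge0_integration_by_substitution0 R (fun t => ((1 + t ^+ 2)^-1)%:E).
rewrite E => H.
have -> : (\int[mu]_(t in `]-oo, 0%R]) ((1 + t ^+ 2)^-1)%:E = (pi / 2)%:E)%E.
  rewrite H//; last exact/measurable_EFinP.
  by apply: eq_integral => t _; rewrite sqrrN.
exact: ltry.
Qed.

Lemma cauchy_half : \int[mu]_(t in pos) (1 + t ^+ 2)^-1 = pi / 2.
Proof.
have := @integral0y_oneDsqr R; rewrite /oneDsqr => E.
rewrite Rintegral_itv_obnd_cbnd ?/Rintegral ?E//.
by apply: (integrableS measurableT) => //; exact: cauchy_integrable.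
Qed.

Lemma cauchy_total : \int[mu]_t (1 + t ^+ 2)^-1 = pi.
Proof.
rewrite (Rintegral_pos_neg _ cauchy_integrable).
have -> : \int[mu]_(t in pos) (1 + (- t) ^+ 2)^-1 = pi / 2.
  by rewrite -cauchy_half; apply: eq_Rintegral => t _; rewrite sqrrN.
by rewrite cauchy_half; field.
Qed.

Definition poisson e s t := e / ((s - t) ^+ 2 + e ^+ 2).

Lemma poisson_scale e s y : 0 < e -> e * poisson e s (s + e * y) = (1 + y ^+ 2)^-1.
Proof.
move=> e0; rewrite /poisson opprD addrA subrr sub0r sqrrN.
have y0 := onesqr_gt0 y.
have -> : (e * y) ^+ 2 + e ^+ 2 = e ^+ 2 * (1 + y ^+ 2) by ring.
by field; rewrite !gt_eqF.
Qed.

Lemma poisson_ge0 e s t : 0 < e -> 0 <= poisson e s t.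
Proof. by move=> e0; rewrite divr_ge0 ?addr_ge0 ?sqr_ge0// ltW. Qed.

Lemma measurable_poisson e s : measurable_fun setT (poisson e s).
Proof. by rewrite /poisson; meas_tac. Qed.

Lemma poisson_affine e s t : 0 < e ->
  poisson e s t = e^-1 * (1 + (- (s / e) + e^-1 * t) ^+ 2)^-1.
Proof.
move=> e0; have e1 : e^-1 != 0 by rewrite invr_eq0 gt_eqF.
rewrite -(poisson_scale _ s (- (s / e) + e^-1 * t) e0) mulrA mulVf ?gt_eqF// mul1r.
by congr poisson; field; rewrite gt_eqF ?onesqr_gt0.
Qed.

Lemma poisson_total e s : 0 < e ->
  mu.-integrable setT (EFin \o poisson e s) /\ \int[mu]_t poisson e s t = pi.
Proof.
move=> e0; have e1 : e^-1 != 0 by rewrite invr_eq0 gt_eqF.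
have [i1 E1] := Rintegral_affine (- (s / e)) e^-1 _ e1 cauchy_integrable.
have iE : mu.-integrable setT (EFin \o (fun t =>
    e^-1 * (1 + (- (s / e) + e^-1 * t) ^+ 2)^-1)).
  by have := integrableZl measurableT e^-1 i1; apply.
have E : poisson e s = (fun t => e^-1 * (1 + (- (s / e) + e^-1 * t) ^+ 2)^-1).
  by apply/funext => t; exact: poisson_affine.
rewrite E; split => //.
by rewrite RintegralZl// -cauchy_total E1 gtr0_norm// invr_gt0.
Qed.

Lemma poisson_integrable g C e s : 0 < e -> measurable_fun setT g ->
  (forall t, `|g t| <= C) -> mu.-integrable setT (EFin \o (fun t => g t * poisson e s t)).
Proof.
move=> e0 mg gC; have [iP _] := poisson_total _ s e0.
apply: (le_integrable _ _ _ (integrableZl measurableT C iP)) => //.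
  by apply/measurable_EFinP; apply: measurable_funM => //; exact: measurable_poisson.
move=> t _; rewrite /= lee_fin !normrM ler_wpM2r//.
by rewrite (le_trans (gC t))// ler_norm.
Qed.

(** After t = s + e y the kernel becomes 1 / (1 + y^2), and g (s + e y) tends to [r] or [l]
    according to the sign of [y]. Each half line carries mass pi / 2. *)
Lemma poisson_limit g C s l r (e : nat -> R) :
  measurable_fun setT g -> (forall t, `|g t| <= C) ->
  g t @[t --> s^'-] --> l -> g t @[t --> s^'+] --> r ->
  (forall n, 0 < e n) -> e n @[n --> \oo] --> (0 : R) ->
  (\int[mu]_t (g t * poisson (e n) s t)) @[n --> \oo] --> pi * ((l + r) / 2).
Proof.
move=> mg gC gl gr e0 ecvg.
pose f n (y : R) := g (s + e n * y) * (1 + y ^+ 2)^-1.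
pose lim_f (y : R) := (r * \1_`]0, +oo[ y + l * \1_`]-oo, 0[ y) * (1 + y ^+ 2)^-1.
have C0 : 0 <= C by rewrite (le_trans _ (gC 0)).
have fE n : \int[mu]_t (g t * poisson (e n) s t) = \int[mu]_y f n y.
  have en : e n != 0 by rewrite gt_eqF.
  have [i1 ->] := Rintegral_affine s (e n) _ en (poisson_integrable _ _ _ s (e0 n) mg gC).
  rewrite -RintegralZl//; apply: eq_Rintegral => y _.
  by rewrite /f gtr0_norm// mulrCA poisson_scale.
under eq_cvg do rewrite fE.
have cg0 (y : R) : (fun n => s + e n * y) @ \oo --> s.
  rewrite -[X in _ --> X]addr0 -[X in _ + X](mul0r y).
  by apply: cvgD; [exact: cvg_cst|exact: cvgMr_tmp].
have f_cvg (y : R) : y != 0 -> f n y @[n --> \oo] --> lim_f y.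
  rewrite neq_lt => /orP[yn|yp]; apply: cvgMr_tmp.
  - have -> : r * \1_`]0, +oo[ y + l * \1_`]-oo, 0[ y = l :> R.
      rewrite !indicE memNset ?mem_set/= ?in_itv/= ?mulr0 ?mulr1 ?add0r//.
      by rewrite andbT; apply/negP; rewrite -leNgt ltW.
    move/cvg_at_leftP : gl; apply; split => // n.
    by rewrite gtrDl pmulr_rlt0.
  - have -> : r * \1_`]0, +oo[ y + l * \1_`]-oo, 0[ y = r :> R.
      rewrite !indicE mem_set ?memNset/= ?in_itv/= ?mulr0 ?mulr1 ?addr0 ?andbT//.
      by apply/negP; rewrite -leNgt ltW.
    move/cvg_at_rightP : gr; apply; split => // n.
    by rewrite ltrDl mulr_gt0.
have mlim : measurable_fun setT lim_f.
  apply: measurable_funM; last by meas_tac.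
  by apply: measurable_funD; apply: measurable_funM => //; exact: measurable_indic.
have mf n : measurable_fun setT (f n).
  apply: measurable_funM; last by meas_tac.
  by apply: (measurableT_comp mg); meas_tac.
have iB : mu.-integrable setT (EFin \o (fun y : R => C * (1 + y ^+ 2)^-1)).
  by have := integrableZl measurableT C cauchy_integrable; apply.
(* The point y = 0, where the integrand sees g (s) instead of a one-sided limit, is a null set. *)
have fl : {ae mu, forall y : R, setT y -> f n y @[n --> \oo] --> lim_f y}.
  exists [set 0]; split => //; first by rewrite lebesgue_measure_set1.
  move=> y; apply: contra_notP => /eqP y0 _; exact: f_cvg.
have fB n (y : R) : setT y -> `|f n y| <= C * (1 + y ^+ 2)^-1.
  move=> _; rewrite /f normrM [`|_^-1|]ger0_norm ?invr_ge0 ?(ltW (onesqr_gt0 _))//.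
  by rewrite ler_wpM2r ?invr_ge0 ?(ltW (onesqr_gt0 _)).
have [ilim] := @Rintegral_dominated_cvg _ (measurableTypeR R) R mu setT f lim_f
  (fun y => C * (1 + y ^+ 2)^-1) measurableT mf mlim fl iB fB.
have ipos : mu.-integrable pos (EFin \o (fun y : R => (1 + y ^+ 2)^-1)).
  by apply: (integrableS measurableT) => //; exact: cauchy_integrable.
suff -> : \int[mu]_y lim_f y = pi * ((l + r) / 2) by [].
rewrite (Rintegral_pos_neg _ ilim).
have -> : \int[mu]_(y in pos) lim_f y = r * (pi / 2).
  rewrite -cauchy_half -RintegralZl//; apply: eq_Rintegral => y /set_mem.
  rewrite pos_itv => y0; rewrite /lim_f !indicE mem_set ?memNset/= ?in_itv/= ?mulr0 ?mulr1 ?addr0 ?andbT//.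
  by apply/negP; rewrite -leNgt ltW.
have -> : \int[mu]_(y in pos) lim_f (- y) = l * (pi / 2).
  rewrite -cauchy_half -RintegralZl//; apply: eq_Rintegral => y /set_mem.
  rewrite pos_itv => y0; rewrite /lim_f !indicE memNset ?mem_set/= ?in_itv/= ?mulr0 ?mulr1 ?add0r ?sqrrN ?oppr_lt0//.
  by rewrite andbT; apply/negP; rewrite -leNgt oppr_le0 ltW.
by field.
Qed.

(* [Im (slm_kernel (- (e +i* t)) s)] *)
Definition slm_im_kernel e t s := poisson e s t - e / (1 + s ^+ 2).

Definition slm_im G e t := \int[G]_(s in pos) slm_im_kernel e t s.

(** Over a common denominator the s^2 terms of the numerator cancel and a factor linear in [s]
    remains; this gain is what makes [slm_weight s] come out. The condition [e <= 1] keeps the bound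
    on that factor independent of [e]. *)
Lemma slm_im_kernel_bound e t s : 0 < e <= 1 -> 0 < s ->
  `|slm_im_kernel e t s| <= (1 + t ^+ 2) ^+ 2 *
    (4 * slm_weight s * (2 * poisson e s t + 2 * e / (1 + t ^+ 2))).
Proof.
move=> /andP[e0 e1] s0.
have s1 := onesqr_gt0 s; have t1 := onesqr_gt0 t.
have d0 : 0 < (s - t) ^+ 2 + e ^+ 2 by rewrite ltr_wpDl ?sqr_ge0// exprn_gt0.
have P0 := poisson_ge0 _ s t e0.
have -> : slm_im_kernel e t s =
    poisson e s t * (1 - e ^+ 2 + 2 * t * s - t ^+ 2) / (1 + s ^+ 2).
  by rewrite /slm_im_kernel /poisson; field; rewrite !gt_eqF.
have num : `|1 - e ^+ 2 + 2 * t * s - t ^+ 2| <= (1 + t ^+ 2) * (1 + s).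
  rewrite ler_norml; apply/andP; split.
    have : e ^+ 2 <= 1 by rewrite exprn_ile1// ltW.
    have : 0 <= s * (1 + t) ^+ 2 by rewrite mulr_ge0 ?sqr_ge0// ltW.
    nra.
  have : 0 <= s * (1 - t) ^+ 2 by rewrite mulr_ge0 ?sqr_ge0// ltW.
  have := sqr_ge0 t; have := sqr_ge0 e; nra.
(* [1 + s^2 <= 2 (1 + t^2) + 2 (s - t)^2] transfers the decay of [g] in [t] to
   decay in [s]. *)
have PS : poisson e s t * (1 + s ^+ 2) <= (1 + t ^+ 2) * (2 * poisson e s t + 2 * e / (1 + t ^+ 2)).
  have -> : (1 + t ^+ 2) * (2 * poisson e s t + 2 * e / (1 + t ^+ 2)) =
      2 * (1 + t ^+ 2) * poisson e s t + 2 * e by field; rewrite gt_eqF ?onesqr_gt0.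
  have h1 : poisson e s t * (s - t) ^+ 2 <= e.
    rewrite /poisson mulrAC ler_pdivrMr// ler_wpM2l ?(ltW e0)// lerDl sqr_ge0//.
  have h2 : 1 + s ^+ 2 <= 2 * (1 + t ^+ 2) + 2 * (s - t) ^+ 2.
    by have := sqr_ge0 (s - 2 * t); nra.
  have := ler_wpM2l P0 h2; lra.
(* Both s (1 + s) and (1 + s)^2 are at most 2 (1 + s^2); their product gives the 4. *)
have ws : (1 + s) / (1 + s ^+ 2) <= 4 * slm_weight s * (1 + s ^+ 2).
  have B0 : 0 < s * (1 + s) ^+ 2 by rewrite mulr_gt0 ?exprn_gt0 ?addr_gt0.
  rewrite /slm_weight ler_pdivrMr//.
  rewrite -[leRHS]mulrA mulrAC ler_pdivlMr//.
  have -> : (1 + s) * (s * (1 + s) ^+ 2) = (s * (1 + s)) * (1 + s) ^+ 2 by ring.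
  have -> : 4 * ((1 + s ^+ 2) * (1 + s ^+ 2)) = (2 * (1 + s ^+ 2)) * (2 * (1 + s ^+ 2)) by ring.
  have h := sqr_ge0 (1 - s).
  have q1 : s * (1 + s) <= 2 * (1 + s ^+ 2) by nra.
  have q2 : (1 + s) ^+ 2 <= 2 * (1 + s ^+ 2) by nra.
  have q0 : 0 <= s * (1 + s) by rewrite mulr_ge0 ?addr_ge0// ltW.
  exact: ler_pM q0 (sqr_ge0 _) q1 q2.
have ws0 := slm_weight_gt0 _ s0.
rewrite normrM normrM (ger0_norm P0) [`|_^-1|]ger0_norm ?invr_ge0 ?(ltW s1)//.
apply: (@le_trans _ _ ((1 + t ^+ 2) * (4 * slm_weight s) * (poisson e s t * (1 + s ^+ 2)))); last first.
  have W0 : 0 <= (1 + t ^+ 2) * (4 * slm_weight s).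
    by rewrite !mulr_ge0 ?(ltW t1) ?(ltW ws0).
  apply: (le_trans (ler_wpM2l W0 PS)).
  by rewrite le_eqVlt; apply/orP; left; apply/eqP; ring.
apply: (@le_trans _ _ (poisson e s t * ((1 + t ^+ 2) * (1 + s)) / (1 + s ^+ 2))).
  by rewrite ler_wpM2r ?invr_ge0 ?(ltW s1)// ler_wpM2l.
have W0 : 0 <= (1 + t ^+ 2) * poisson e s t by rewrite mulr_ge0// ltW.
have -> : poisson e s t * ((1 + t ^+ 2) * (1 + s)) / (1 + s ^+ 2) =
    (1 + t ^+ 2) * poisson e s t * ((1 + s) / (1 + s ^+ 2)) by ring.
apply: (le_trans (ler_wpM2l W0 ws)).
by rewrite le_eqVlt; apply/orP; left; apply/eqP; ring.
Qed.

(** The square offsets the factor (1 + t^2)^2 of [slm_im_kernel_bound]; what is left is integrable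
    in [t] uniformly in [e]. *)
Definition decay_bounded g C :=
  measurable_fun setT g /\ forall t, 0 <= g t <= C / (1 + t ^+ 2) ^+ 2.

Lemma decay_bounded_ge0 g C : decay_bounded g C -> 0 <= C.
Proof.
move=> [_ /(_ 0)/andP[g0 gC]]; have := le_trans g0 gC.
by rewrite expr0n/= addr0 expr1n divr1.
Qed.

Lemma decay_bounded_cauchy g C : decay_bounded g C ->
  forall t, `|g t| <= C * (1 + t ^+ 2)^-1.
Proof.
move=> gC t; have C0 := decay_bounded_ge0 _ _ gC; have [_ /(_ t)/andP[g0 gC']] := gC.
rewrite ger0_norm// (le_trans gC')// ler_wpM2l// lef_pV2 ?posrE ?exprn_gt0 ?onesqr_gt0//.
by rewrite expr2 ler_peMl ?(ltW (onesqr_gt0 _))// lerDl sqr_ge0.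
Qed.

Lemma decay_bounded_norm g C : decay_bounded g C -> forall t, `|g t| <= C.
Proof.
move=> gC t; rewrite (le_trans (decay_bounded_cauchy _ _ gC t))//.
rewrite ler_piMr ?(decay_bounded_ge0 _ _ gC)// invf_le1 ?onesqr_gt0//.
by rewrite lerDl sqr_ge0.
Qed.

Lemma decay_bounded_integrable g C : decay_bounded g C ->
  mu.-integrable setT (EFin \o g).
Proof.
move=> gC; have [mg _] := gC.
apply: (le_integrable _ _ _ (integrableZl measurableT C cauchy_integrable)) => //.
  exact/measurable_EFinP.
move=> t _; rewrite /= lee_fin (le_trans (decay_bounded_cauchy _ _ gC t))//.
by rewrite ler_norm.
Qed.

Lemma decay_bounded_mulX_integrable g C : decay_bounded g C ->
  mu.-integrable setT (EFin \o (fun t => g t * t)).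
Proof.
move=> gC; have [mg gb] := gC; have C0 := decay_bounded_ge0 _ _ gC.
apply: (le_integrable _ _ _ (integrableZl measurableT C cauchy_integrable)) => //.
  by apply/measurable_EFinP; apply: measurable_funM => //; meas_tac.
move=> t _; rewrite /= lee_fin normrM; have /andP[g0 gt] := gb t.
have t1 := onesqr_gt0 t.
rewrite (ger0_norm g0) [leRHS]ger0_norm ?mulr_ge0 ?invr_ge0 ?(ltW t1)//.
apply: (@le_trans _ _ (C / (1 + t ^+ 2) ^+ 2 * (1 + t ^+ 2))).
  apply: ler_pM => //; rewrite ler_norml; apply/andP; split.
    have := sqr_ge0 (1 + t); nra.
  have := sqr_ge0 (1 - t); nra.
rewrite le_eqVlt; apply/orP; left; apply/eqP; by field; rewrite gt_eqF.
Qed.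

(** The Poisson kernel and 1 / (1 + t^2) both integrate to pi, so the value is at most 4 C (2 pi + 2
    e pi) times the weight. Being free of [e], the bound serves both Fubini and dominated
    convergence. *)
Lemma slm_im_kernel_dominated g C e s : decay_bounded g C -> 0 < e <= 1 -> 0 < s ->
  (\int[mu]_t `|g t * slm_im_kernel e t s|%:E <= (16 * pi * C * slm_weight s)%:E)%E.
Proof.
move=> gC e01 s0; have [mg gb] := gC; have C0 := decay_bounded_ge0 _ _ gC.
have /andP[e0 e1] := e01.
have [iP EP] := poisson_total _ s e0.
have iP' : mu.-integrable setT (EFin \o (fun t => 2 * poisson e s t)).
  by have := integrableZl measurableT 2 iP; apply.
have iQ : mu.-integrable setT (EFin \o (fun t : R => 2 * e * (1 + t ^+ 2)^-1)).
  by have := integrableZl measurableT (2 * e) cauchy_integrable; apply.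
have iPQ := integrableD measurableT iP' iQ.
have iB : mu.-integrable setT (EFin \o (fun t => C * (4 * slm_weight s) *
    (2 * poisson e s t + 2 * e * (1 + t ^+ 2)^-1))).
  by have := integrableZl measurableT (C * (4 * slm_weight s)) iPQ; apply.
apply: (@le_trans _ _ (\int[mu]_t (C * (4 * slm_weight s) *
    (2 * poisson e s t + 2 * e * (1 + t ^+ 2)^-1))%:E)%E).
  apply: ge0_le_integral => //.
  - apply/measurable_EFinP; apply: measurableT_comp => //.
    apply: measurable_funM => //; apply: measurable_funB; last by meas_tac.
    exact: measurable_poisson.
  - exact: measurable_int iB.
  - move=> t _; rewrite lee_fin normrM.
    have /andP[g0 gt] := gb t; rewrite (ger0_norm g0).
    have t1 := onesqr_gt0 t.
    apply: le_trans (ler_pM _ _ gt (slm_im_kernel_bound _ t _ e01 s0)) _ => //.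
    rewrite le_eqVlt; apply/orP; left; apply/eqP; by field; rewrite gt_eqF.
rewrite -[leLHS]fineK; last exact: integrable_fin_num iB.
rewrite lee_fin -[leLHS]/(\int[mu]_t (C * (4 * slm_weight s) *
    (2 * poisson e s t + 2 * e * (1 + t ^+ 2)^-1))).
have E1 : \int[mu]_t (2 * poisson e s t) = 2 * pi by rewrite RintegralZl// EP.
have E2 : \int[mu]_t (2 * e * (1 + t ^+ 2)^-1) = 2 * e * pi.
  by rewrite RintegralZl ?cauchy_total//; exact: cauchy_integrable.
rewrite RintegralZl// RintegralD// E1 E2.
have w0 := slm_weight_gt0 _ s0.
have : C * (4 * slm_weight s) * (2 * pi + 2 * e * pi) <= C * (4 * slm_weight s) * (4 * pi).
  rewrite ler_wpM2l ?mulr_ge0 ?(ltW w0)//.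
  have := pi_ge0 R; nra.
move=> /le_trans; apply; rewrite le_eqVlt; apply/orP; left; apply/eqP; ring.
Qed.

End PoissonKernel.

Section BoundaryLimit.
Context {R : realType}.
Notation meas := {measure set (measurableTypeR R) -> \bar R}.
Notation mu := (@lebesgue_measure R).
Notation pos := (`]0%R, +oo[%classic : set (measurableTypeR R)).
Implicit Types (G : meas) (g L : R -> R) (s t e C : R).

Let mpos : measurable pos. Proof. by []. Qed.

Lemma slm_im_kernel_integrable G e t : slm_measure G -> 0 < e <= 1 ->
  G.-integrable pos (EFin \o slm_im_kernel e t).
Proof.
move=> Gw e01; have /andP[e0 e1] := e01.
apply: (slm_integrable G _ ((1 + t ^+ 2) ^+ 2 * (4 * (2 / e + 2 * e / (1 + t ^+ 2))))) => //.
  by rewrite /slm_im_kernel /poisson; meas_tac.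
move=> s s0; apply: (le_trans (slm_im_kernel_bound _ t _ e01 s0)).
have P1 : poisson e s t <= e^-1.
  rewrite /poisson ler_pdivrMr; last by rewrite ltr_wpDl ?sqr_ge0// exprn_gt0.
  have -> : e^-1 * ((s - t) ^+ 2 + e ^+ 2) = e^-1 * (s - t) ^+ 2 + e.
    by field; rewrite gt_eqF.
  by rewrite lerDr mulr_ge0 ?sqr_ge0// invr_ge0 ltW.
have P2 : 2 * poisson e s t + 2 * e / (1 + t ^+ 2) <= 2 / e + 2 * e / (1 + t ^+ 2).
  by rewrite lerD2r ler_wpM2l.
have W0 : 0 <= (1 + t ^+ 2) ^+ 2 * (4 * slm_weight s).
  by rewrite mulr_ge0 ?sqr_ge0// mulr_ge0// ltW// slm_weight_gt0.
rewrite mulrA; apply: (le_trans (ler_wpM2l W0 P2)).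
by rewrite le_eqVlt; apply/orP; left; apply/eqP; ring.
Qed.

Lemma slm_im_Fubini G g C e : slm_measure G -> decay_bounded g C -> 0 < e <= 1 ->
  [/\ mu.-integrable setT (EFin \o (fun t => g t * slm_im G e t)),
      G.-integrable pos (EFin \o (fun s => \int[mu]_t (g t * slm_im_kernel e t s))) &
      \int[mu]_t (g t * slm_im G e t) =
      \int[G]_(s in pos) \int[mu]_t (g t * slm_im_kernel e t s)].
Proof.
move=> Gw gC e01; have [mg _] := gC; have [_ iw] := Gw.
have ik t : G.-integrable pos (fun s => (g t * slm_im_kernel e t s)%:E).
  by have := integrableZl mpos (g t) (slm_im_kernel_integrable _ _ t Gw e01); apply.
have [] := @Rintegral_Fubini _ _ (measurableTypeR R) (measurableTypeR R) R mu G setT pos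
  (fun t s => g t * slm_im_kernel e t s) (fun s => 16 * pi * C * slm_weight s).
- exact: sigma_finiteT.
- exact: slm_sigma_finite.
- by [].
- by [].
- apply: measurable_funM; first exact: (measurableT_comp mg measurable_fst).
  by rewrite /slm_im_kernel /poisson; meas_tac.
- by have := integrableZl mpos (16 * pi * C) iw; apply.
- move=> s; rewrite pos_itv => s0; exact: slm_im_kernel_dominated.
- by move=> t _.
have E t : \int[G]_(s in pos) (g t * slm_im_kernel e t s) = g t * slm_im G e t.
  by rewrite RintegralZl//; exact: slm_im_kernel_integrable.
move=> i1 i2 E2; split.
- by apply: eq_integrable i1 => // t _; rewrite /= E.
- by [].
- by rewrite -E2; apply: eq_Rintegral => t _; rewrite E.
Qed.

Definition one_sided_mean g L s := exists l r : R,
  [/\ g t @[t --> s^'-] --> l, g t @[t --> s^'+] --> r & L s = (l + r) / 2].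

(** The estimates require [e <= 1]; truncating at 1 does not change the germ at zero and lets the
    sequential criterion use only such [e]. *)
Lemma cvg_at_right_min1 (F : R -> R) (l : R) :
  (forall u : nat -> R, (forall n, 0 < u n <= 1) -> u n @[n --> \oo] --> (0 : R) ->
    F (u n) @[n --> \oo] --> l) -> F e @[e --> 0^'+] --> l.
Proof.
move=> H; have : F (Num.min e 1) @[e --> 0^'+] --> l.
  apply/cvg_at_rightP => u [u0 ucvg]; apply: (H (fun n => Num.min (u n) 1)).
    by move=> n; rewrite lt_min u0 ltr01 ge_min lexx orbT.
  apply: (@squeeze_cvgr _ _ _ _ (cst 0) u) => //; last exact: cvg_cst.
  by apply: nearW => n; rewrite le_min (ltW (u0 n)) ler01 ge_min lexx.
apply: cvg_trans; apply: near_eq_cvg; near=> e.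
by rewrite min_l//; near: e; exact: nbhs_right_le.
Unshelve. all: by end_near. Qed.

(** After Fubini the inner integral tends to pi L by [poisson_limit], its companion term being of
    order [e]; dominated convergence against [G] then applies. *)
Lemma slm_im_limit G g C L : slm_measure G -> decay_bounded g C ->
  measurable_fun setT L ->
  {ae G, forall s, pos s -> one_sided_mean g L s} ->
  G.-integrable pos (EFin \o L) /\
  \int[mu]_t (g t * slm_im G e t) @[e --> 0^'+] --> pi * \int[G]_(s in pos) L s.
Proof.
move=> Gw gC mL hL; have [mg gb] := gC; have [_ iw] := Gw.
have pi0 : (pi : R) != 0 by rewrite gt_eqF ?pi_gt0.
have ig := decay_bounded_integrable _ _ gC.
have iB : G.-integrable pos (EFin \o (fun s => 16 * pi * C * slm_weight s)).
  by have := integrableZl mpos (16 * pi * C) iw; apply.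
have main (u : nat -> R) : (forall n, 0 < u n <= 1) -> u n @[n --> \oo] --> (0 : R) ->
    G.-integrable pos (EFin \o (fun s => pi * L s)) /\
    \int[G]_(s in pos) \int[mu]_t (g t * slm_im_kernel (u n) t s) @[n --> \oo] -->
    \int[G]_(s in pos) (pi * L s).
  move=> u01 ucvg.
  have igk n s : 0 < s -> mu.-integrable setT (EFin \o (fun t => g t * slm_im_kernel (u n) t s)).
    move=> s0; apply/integrableP; split.
      apply/measurable_EFinP; apply: measurable_funM => //.
      by rewrite /slm_im_kernel /poisson; meas_tac.
    exact: le_lt_trans (slm_im_kernel_dominated _ _ _ _ gC (u01 n) s0) (ltry _).
  apply: (@Rintegral_dominated_cvg _ (measurableTypeR R) R G pos
    (fun n s => \int[mu]_t (g t * slm_im_kernel (u n) t s)) (fun s => pi * L s)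
    (fun s => 16 * pi * C * slm_weight s)) => //.
  - move=> n; apply/measurable_EFinP; apply: (measurable_int G).
    by have [_ + _] := slm_im_Fubini _ _ _ _ Gw gC (u01 n).
  - by apply: measurable_funTS; apply: measurable_funM.
  - apply: (@filterS _ _ (ae_filter_ringOfSetsType G) _ _ _ hL) => s hs sp; have [l [r [gl gr ->]]] := hs sp.
    rewrite pos_itv in sp.
    have u0 n : 0 < u n by have /andP[] := u01 n.
    have E n : \int[mu]_t (g t * slm_im_kernel (u n) t s) =
        \int[mu]_t (g t * poisson (u n) s t) - u n * ((1 + s ^+ 2)^-1 * \int[mu]_t g t).
      have iP := poisson_integrable _ _ _ s (u0 n) mg (decay_bounded_norm _ _ gC).
      have ig' : mu.-integrable setT (EFin \o (fun t => u n / (1 + s ^+ 2) * g t)).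
        by have := integrableZl measurableT (u n / (1 + s ^+ 2)) ig; apply.
      rewrite mulrA -RintegralZl// -RintegralB//.
      by apply: eq_Rintegral => t _; rewrite /slm_im_kernel; ring.
    under eq_cvg do rewrite E.
    have -> : pi * ((l + r) / 2) =
      pi * ((l + r) / 2) - 0 * ((1 + s ^+ 2)^-1 * \int[mu]_t g t) by rewrite mul0r subr0.
    apply: cvgB; last exact: cvgMr_tmp.
    by apply: (poisson_limit _ C) => //; exact: decay_bounded_norm gC.
  - move=> n s; rewrite pos_itv => s0.
    rewrite (le_trans (le_normr_Rintegral _ (igk n s s0)))//.
    rewrite -lee_fin /Rintegral fineK; first exact: slm_im_kernel_dominated.
    by apply: integrable_fin_num => //; exact: integrable_norm (igk n s s0).
(* Integrability of the limit comes out of dominated convergence, so one particular sequence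
   suffices. *)
have iL : G.-integrable pos (EFin \o L).
  have [||ipL _] := main (fun n => n.+1%:R^-1).
  - by move=> n; rewrite invr_gt0 ltr0n invf_le1 ?ltr0n// ler1n.
  - exact: cvg_harmonic.
  have := integrableZl mpos pi^-1 ipL => H.
  apply: eq_integrable H => // s _.
  by rewrite /= -EFinM mulrA mulVf// mul1r.
split => //.
apply: cvg_at_right_min1 => u u01 ucvg; have [_] := main u u01 ucvg.
rewrite RintegralZl//.
apply: cvg_trans; apply: near_eq_cvg; apply: nearW => n.
by have [_ _ ->] := slm_im_Fubini _ _ _ _ Gw gC (u01 n).
Qed.

Lemma decay_bounded_opp g C : decay_bounded g C -> decay_bounded (fun t => g (- t)) C.
Proof.
move=> [mg gb]; split; first by apply: (measurableT_comp mg); meas_tac.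
by move=> t; have := gb (- t); rewrite sqrrN.
Qed.

(** Substituting - t for t turns this into [slm_im_limit] for the reflected test function, whose
    mean values vanish on the support. *)
Lemma slm_im_limit_opp G g C : slm_measure G -> decay_bounded g C ->
  {ae G, forall s, pos s -> one_sided_mean (fun t => g (- t)) (cst 0) s} ->
  \int[mu]_t (g t * slm_im G e (- t)) @[e --> 0^'+] --> (0 : R).
Proof.
move=> Gw gC hL; have gCo := decay_bounded_opp _ _ gC.
have [] := slm_im_limit _ _ _ (cst 0) Gw gCo _ hL; first exact: measurable_cst.
move=> _; rewrite [X in pi * X](_ : _ = 0) ?mulr0; last first.
  by rewrite /Rintegral integral0.
apply: cvg_trans; apply: near_eq_cvg; near=> e.
have e01 : 0 < e <= 1 by apply/andP; split; near: e; [exact: nbhs_right_gt|exact: nbhs_right_le].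
have [i1 _ _] := slm_im_Fubini _ _ _ _ Gw gCo e01.
have [_ ->] := Rintegral_reflect _ i1.
by apply: eq_Rintegral => t _; rewrite opprK.
Unshelve. all: by end_near. Qed.

Lemma slm_im_opp_integrable G g C e : slm_measure G -> decay_bounded g C -> 0 < e <= 1 ->
  mu.-integrable setT (EFin \o (fun t => g t * slm_im G e (- t))).
Proof.
move=> Gw gC e01; have [i1 _ _] := slm_im_Fubini _ _ _ _ Gw (decay_bounded_opp _ _ gC) e01.
have [i2 _] := Rintegral_reflect _ i1.
by apply: eq_integrable i2 => // t _; rewrite /= opprK.
Qed.

(** Common form of the imaginary part of the exponent at [- (e +i* t)] and at [e +i* t]: passing
    from one to the other exchanges the two measures and the sign of [b], so one argument serves
    both choices of sign. The Gaussian and drift terms are of order [e]. *)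
Definition boundary_im (a b : R) (G1 G2 : @smeasure R) e t : R :=
  2 * a * e * t + b * e
  + (slm_im (spos G1) e t - slm_im (sneg G1) e t)
  - (slm_im (spos G2) e (- t) - slm_im (sneg G2) e (- t)).

Lemma boundary_limit (a b : R) (G1 G2 : @smeasure R) g C L :
  slm_smeasure G1 -> slm_smeasure G2 -> decay_bounded g C ->
  measurable_fun setT L ->
  {ae spos G1, forall s, pos s -> one_sided_mean g L s} ->
  {ae sneg G1, forall s, pos s -> one_sided_mean g L s} ->
  {ae spos G2, forall s, pos s -> one_sided_mean (fun t => g (- t)) (cst 0) s} ->
  {ae sneg G2, forall s, pos s -> one_sided_mean (fun t => g (- t)) (cst 0) s} ->
  ((pi^-1)%R%:E * \int[mu]_t (g t * boundary_im a b G1 G2 e t)%:E)%E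
     @[e --> 0^'+] --> (sint G1 L)%:E.
Proof.
move=> [w1 w2] [w3 w4] gC mL h1 h2 h3 h4.
have ig := decay_bounded_integrable _ _ gC.
have igX := decay_bounded_mulX_integrable _ _ gC.
have [iL1 c1] := slm_im_limit _ _ _ _ w1 gC mL h1.
have [iL2 c2] := slm_im_limit _ _ _ _ w2 gC mL h2.
have c3 := slm_im_limit_opp _ _ _ w3 gC h3.
have c4 := slm_im_limit_opp _ _ _ w4 gC h4.
pose F e := e * (2 * a * \int[mu]_t (g t * t) + b * \int[mu]_t g t)
  + (\int[mu]_t (g t * slm_im (spos G1) e t) - \int[mu]_t (g t * slm_im (sneg G1) e t))
  - (\int[mu]_t (g t * slm_im (spos G2) e (- t)) - \int[mu]_t (g t * slm_im (sneg G2) e (- t))).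
have Fcvg : F e @[e --> 0^'+] --> pi * sint G1 L.
  have -> : pi * sint G1 L = 0 * (2 * a * \int[mu]_t (g t * t) + b * \int[mu]_t g t)
    + (pi * \int[spos G1]_(s in pos) L s - pi * \int[sneg G1]_(s in pos) L s) - (0 - 0).
    by rewrite /sint; ring.
  apply: cvgB; last exact: cvgB.
  apply: cvgD; last exact: cvgB.
  by apply: cvgMr_tmp; apply: cvg_at_right_filter; exact: cvg_id.
have : (pi^-1 * F e)%:E @[e --> 0^'+] --> (sint G1 L)%:E.
  apply: cvg_EFin; first exact: nearW.
  rewrite -[X in _ --> X](mulKf (x := pi)) ?gt_eqF ?pi_gt0//.
  exact: cvgMl_tmp.
apply: cvg_trans; apply: near_eq_cvg; near=> e.
have e01 : 0 < e <= 1 by apply/andP; split; near: e; [exact: nbhs_right_gt|exact: nbhs_right_le].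
have [j1 _ _] := slm_im_Fubini _ _ _ _ w1 gC e01.
have [j2 _ _] := slm_im_Fubini _ _ _ _ w2 gC e01.
have j3 := slm_im_opp_integrable _ _ _ _ w3 gC e01.
have j4 := slm_im_opp_integrable _ _ _ _ w4 gC e01.
have iZ (c : R) (f : R -> R) : mu.-integrable setT (EFin \o f) ->
    mu.-integrable setT (EFin \o (fun t => c * f t)).
  by move=> jf; have := integrableZl measurableT c jf; apply.
have j12 : mu.-integrable setT (EFin \o (fun t =>
  g t * slm_im (spos G1) e t - g t * slm_im (sneg G1) e t)) by have := integrableB measurableT j1 j2; apply.
have j34 : mu.-integrable setT (EFin \o (fun t =>
  g t * slm_im (spos G2) e (- t) - g t * slm_im (sneg G2) e (- t))) by have := integrableB measurableT j3 j4; apply.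
have k1 := iZ (2 * a * e) _ igX.
have k2 := iZ (b * e) _ ig.
have k12 : mu.-integrable setT (EFin \o (fun t =>
  2 * a * e * (g t * t) + b * e * g t)) by have := integrableD measurableT k1 k2; apply.
have k3 : mu.-integrable setT (EFin \o (fun t =>
  2 * a * e * (g t * t) + b * e * g t +
  (g t * slm_im (spos G1) e t - g t * slm_im (sneg G1) e t))) by have := integrableD measurableT k12 j12; apply.
have k4 : mu.-integrable setT (EFin \o (fun t =>
  2 * a * e * (g t * t) + b * e * g t +
  (g t * slm_im (spos G1) e t - g t * slm_im (sneg G1) e t) -
  (g t * slm_im (spos G2) e (- t) - g t * slm_im (sneg G2) e (- t)))) by have := integrableB measurableT k3 j34; apply.
have E : (fun t => g t * boundary_im a b G1 G2 e t) = (fun t =>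
  2 * a * e * (g t * t) + b * e * g t +
  (g t * slm_im (spos G1) e t - g t * slm_im (sneg G1) e t) -
  (g t * slm_im (spos G2) e (- t) - g t * slm_im (sneg G2) e (- t))).
  by apply/funext => t; rewrite /boundary_im; ring.
have -> : (\int[mu]_t (g t * boundary_im a b G1 G2 e t)%:E)%E = (F e)%:E.
  rewrite -[LHS]fineK; last first.
    by rewrite -E in k4; have := integrable_fin_num measurableT k4; apply.
  congr EFin; rewrite -[LHS]/(\int[mu]_t (g t * boundary_im a b G1 G2 e t)) E.
  rewrite RintegralB// RintegralD// RintegralD// !RintegralZl// !RintegralB// /F.
  by ring.
by rewrite EFinM.
Unshelve. all: by end_near. Qed.

End BoundaryLimit.

(** * Continuity points and atoms *)

Section JordanContinuity.
Context {R : realType}.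
Notation meas := {measure set (measurableTypeR R) -> \bar R}.
Notation pos := (`]0%R, +oo[%classic : set (measurableTypeR R)).
Local Open Scope ereal_scope.

(** For s > u the mass of []-oo, s[] is at least that of []-oo, u[] plus the atom at [u]. Continuity
    from the right removes the excess, and finiteness allows the cancellation. *)
Lemma continuity_point_null (m : meas) (u : R) :
  {for u, continuous (fun s : R => m `]-oo, s[%classic)} ->
  m `]-oo, u[%classic < +oo -> m [set u] = 0.
Proof.
move=> mc mfin.
have mfn : m `]-oo, u[%classic \is a fin_num by rewrite ge0_fin_numE.
have mr : m `]-oo, s[%classic @[s --> u^'+] --> m `]-oo, u[%classic.
  exact: cvg_at_right_filter.
have le : m `]-oo, u[%classic + m [set u] <= m `]-oo, u[%classic.
  have -> : m `]-oo, u[%classic = lim (m `]-oo, s[%classic @[s --> u^'+]) by rewrite (cvg_lim _ mr).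
  rewrite [X in X + _](cvg_lim _ mr)//.
  apply: lime_ge; first by apply/cvg_ex; eexists; exact: mr.
  near=> s; have us : (u < s)%R by near: s; exact: nbhs_right_gt.
  rewrite -measureU//; last first.
    by apply/seteqP; split => // x /= [+ xu]; rewrite xu in_itv/= ltxx.
  apply: le_measure; rewrite ?inE//; first exact: measurableU.
  by move=> x /= [|->]; rewrite !in_itv/= => // /lt_trans; exact.
apply/eqP; rewrite eq_le measure_ge0 andbT.
by move: le; rewrite -[leRHS]adde0 leeD2lE.
Unshelve. all: by end_near. Qed.

(** On each side of the separating set [D] one Jordan part vanishes, and the balance equation bounds
    the other by a part of [G], which is finite on sets bounded above. *)
Lemma jordan_finite (G J : @smeasure R) (A : set (measurableTypeR R)) (v : R) :
  slm_smeasure G -> jordan_decomposition_of G J -> measurable A ->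
  A `<=` `]-oo, v]%classic -> spos J A < +oo /\ sneg J A < +oo.
Proof.
move=> [w1 w2] [[D [mD JD JD']] GJ] mA Av.
have mAD : measurable (A `&` D) by exact: measurableI.
have mAD' : measurable (A `&` ~` D) by apply: measurableI => //; exact: measurableC.
have AE : A = (A `&` D) `|` (A `&` ~` D) by rewrite -setIUr setUv setIT.
have p0 : spos J (A `&` ~` D) = 0.
  by apply: (subset_measure0 _ _ _ JD) => //; exact: measurableC.
have n0 : sneg J (A `&` D) = 0 by apply: (subset_measure0 _ _ _ JD').
split.
- rewrite AE; apply: (le_lt_trans (measureU2 _ _ _)) => //.
  rewrite [X in _ + X]p0 adde0.
  have := GJ _ mAD; rewrite [X in _ + X]n0 adde0 => E.
  apply: (@le_lt_trans _ _ (spos G (A `&` D))); first by rewrite E leeDr.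
  by rewrite -ge0_fin_numE//; apply: (slm_fin_num _ _ v) => // x [/Av].
- rewrite AE; apply: (le_lt_trans (measureU2 _ _ _)) => //.
  rewrite [X in X + _]n0 add0e.
  have := GJ _ mAD'; rewrite [X in _ = _ + X]p0 adde0 => E.
  apply: (@le_lt_trans _ _ (sneg G (A `&` ~` D))); first by rewrite -E leeDr.
  by rewrite -ge0_fin_numE//; apply: (slm_fin_num _ _ v) => // x [/Av].
Qed.

(** The Jordan parts have no atom at [u]. The parts of [G] may have one, since they can share mass,
    but the balance equation forces their atoms to be equal, which is all the end points require. *)
Lemma continuity_points_atom (G J : @smeasure R) (u : R) : slm_smeasure G ->
  jordan_decomposition_of G J -> continuity_points J u ->
  spos G [set u] = sneg G [set u].
Proof.
move=> Gw GJ [cp cn].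
have [fp fn] := jordan_finite _ _ (`]-oo, u[%classic) u Gw GJ (measurable_itv _)
  (fun x => @subset_itvl _ _ _ (BLeft u) (BRight u) (lexx _) x).
have [_ /(_ [set u] (measurable_set1 _))] := GJ.
by rewrite (continuity_point_null _ _ cp fp) (continuity_point_null _ _ cn fn) !adde0.
Qed.

End JordanContinuity.

(** * The inversion formulas *)

Section BoundaryFormulas.
Context {R : realType}.
Notation meas := {measure set (measurableTypeR R) -> \bar R}.
Notation mu := (@lebesgue_measure R).
Notation pos := (`]0%R, +oo[%classic : set (measurableTypeR R)).
Implicit Types (G : meas) (g k L : R -> R) (s t e C : R).

Let mpos : measurable pos. Proof. by []. Qed.

Lemma cvg_at_right_eq g k s (d : R) : {for s, continuous k} -> s < d ->
  (forall t, s < t < d -> g t = k t) -> g t @[t --> s^'+] --> k s.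
Proof.
move=> ck sd gk.
have : k t @[t --> s^'+] --> k s by exact: cvg_at_right_filter.
apply: cvg_trans; apply: near_eq_cvg; near=> t.
by rewrite gk//; apply/andP; split; near: t; [exact: nbhs_right_gt|exact: nbhs_right_lt].
Unshelve. all: by end_near. Qed.

Lemma cvg_at_left_eq g k s (d : R) : {for s, continuous k} -> d < s ->
  (forall t, d < t < s -> g t = k t) -> g t @[t --> s^'-] --> k s.
Proof.
move=> ck sd gk.
have : k t @[t --> s^'-] --> k s by exact: cvg_at_left_filter.
apply: cvg_trans; apply: near_eq_cvg; near=> t.
by rewrite gk//; apply/andP; split; near: t; [exact: nbhs_left_gt|exact: nbhs_left_lt].
Unshelve. all: by end_near. Qed.

Lemma SLM_support (nu : R) G : SLM nu G -> {ae G, forall s, pos s -> nu <= s}.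
Proof.
move=> /SLM_slm_measure[_ G0]; exists `]-oo, nu[%classic; split => // s /=.
by move=> /not_implyP[_ /negP]; rewrite -ltNge in_itv.
Qed.

Lemma Rintegral_indic G (A : set (measurableTypeR R)) : measurable A ->
  \int[G]_(s in pos) \1_A s = fine (G (A `&` pos)).
Proof. by move=> mA; rewrite /Rintegral integral_indic. Qed.

Definition exp_tail (x a t : R) : R := expR (- (t * x)) * \1_`[a, +oo[ t.

Lemma exp_tail_in x a t : a <= t -> exp_tail x a t = expR (- (t * x)).
Proof. by move=> at_; rewrite /exp_tail indicE mem_set ?mulr1//= in_itv/= at_. Qed.

Lemma exp_tail_out x a t : t < a -> exp_tail x a t = 0.
Proof.
move=> ta; rewrite /exp_tail indicE memNset ?mulr0//= in_itv/= andbT.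
by apply/negP; rewrite -ltNge.
Qed.

(** With t = a + u and u >= 0, the factor (1 + t^2)^2 is at most (1 + |a|)^4 (1 + u)^4, and (1 +
    u)^4 is absorbed by exp (u x) at the cost of (1 + 4 / x)^4. *)
Lemma exp_tail_decay x a : 0 < x -> exists C, decay_bounded (exp_tail x a) C.
Proof.
move=> x0; exists (expR (- (a * x)) * (1 + `|a|) ^+ 4 * (1 + 4 / x) ^+ 4); split.
  by apply: measurable_funM; [meas_tac|exact: measurable_indic].
move=> t; have C0 : 0 <= expR (- (a * x)) * (1 + `|a|) ^+ 4 * (1 + 4 / x) ^+ 4.
  by rewrite !mulr_ge0 ?expR_ge0 ?exprn_ge0 ?addr_ge0 ?divr_ge0 ?(ltW x0).
have t1 := onesqr_gt0 t.
have [ta|at_] := ltP t a.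
  by rewrite exp_tail_out// lexx divr_ge0// sqr_ge0.
rewrite exp_tail_in// expR_ge0 /= ler_pdivlMr ?exprn_gt0//.
have [u u0 uE] : exists2 u, 0 <= u & t = a + u.
  by exists (t - a); [rewrite subr_ge0|rewrite addrC subrK].
have h1 : 1 + t ^+ 2 <= ((1 + `|a|) * (1 + u)) ^+ 2.
  have ht : `|t| <= `|a| + u.
    by rewrite uE (le_trans (ler_normD _ _))// (ger0_norm u0).
  have -> : t ^+ 2 = `|t| ^+ 2 by rewrite real_normK ?num_real.
  have a0 : 0 <= `|a| by [].
  have au0 : 0 <= `|a| * u by rewrite mulr_ge0.
  have T2 : `|t| ^+ 2 <= (`|a| + u) ^+ 2.
    rewrite lerXn2r ?nnegrE//; exact: addr_ge0.
  have au1 : 0 <= `|a| * u * (2 + `|a| * u + 2 * `|a| + 2 * u).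
    by rewrite mulr_ge0// !addr_ge0// mulr_ge0.
  nra.
have h2 : (1 + t ^+ 2) ^+ 2 <= (1 + `|a|) ^+ 4 * (1 + u) ^+ 4.
  rewrite -exprMn (exprM _ 2 2) lerXn2r ?nnegrE ?sqr_ge0 ?(ltW t1)//.
have h3 : (1 + u) ^+ 4 <= (1 + 4 / x) ^+ 4 * expR (u * x).
  have -> : expR (u * x) = expR (u * x / 4) ^+ 4.
    by rewrite -expRM_natl; congr expR; field.
  have p1 : 0 <= 1 + 4 / x by rewrite addr_ge0 ?divr_ge0// ltW.
  rewrite -exprMn lerXn2r ?nnegrE ?addr_ge0 ?mulr_ge0 ?expR_ge0//.
  apply: (@le_trans _ _ ((1 + 4 / x) * (1 + u * x / 4))).
    have -> : (1 + 4 / x) * (1 + u * x / 4) = 1 + u + (u * x / 4 + 4 / x).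
      by field; rewrite gt_eqF.
    by rewrite lerDl addr_ge0 ?divr_ge0 ?mulr_ge0// ltW.
  by rewrite ler_wpM2l// expR_ge1Dx.
have eE : expR (- (t * x)) * expR (u * x) = expR (- (a * x)).
  by rewrite -expRD uE; congr expR; ring.
have A0 : 0 <= (1 + `|a|) ^+ 4 by rewrite exprn_ge0// addr_ge0.
apply: (@le_trans _ _ (expR (- (t * x)) * ((1 + `|a|) ^+ 4 * ((1 + 4 / x) ^+ 4 * expR (u * x))))).
  by rewrite ler_wpM2l ?expR_ge0// (le_trans h2)// ler_wpM2l.
by rewrite -eE le_eqVlt; apply/orP; left; apply/eqP; ring.
Qed.

Lemma exp_tail_mean_gt x a s : a < s ->
  one_sided_mean (exp_tail x a) (fun s => expR (- (s * x))) s.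
Proof.
move=> as_; have ce : {for s, continuous (fun t => expR (- (t * x)))}.
  have := @continuous_expN R x s; under eq_fun do rewrite mulrC; apply.
exists (expR (- (s * x))), (expR (- (s * x))); split.
- apply: (cvg_at_left_eq _ _ _ a ce as_) => t /andP[at_ _].
  by rewrite exp_tail_in// ltW.
- have s1 : s < s + 1 by rewrite ltrDl.
  apply: (cvg_at_right_eq _ _ _ _ ce s1) => t /andP[st _].
  by rewrite exp_tail_in// ltW// (lt_trans as_).
- by field.
Qed.

Lemma exp_tail_mean_eq x a :
  one_sided_mean (exp_tail x a) (fun s => expR (- (s * x)) / 2) a.
Proof.
have ce : {for a, continuous (fun t => expR (- (t * x)))}.
  have := @continuous_expN R x a; under eq_fun do rewrite mulrC; apply.
exists 0, (expR (- (a * x))); split.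
- have a1 : a - 1 < a by rewrite ltrBlDr ltrDl.
  apply: (cvg_at_left_eq _ (cst 0) _ _ _ a1); first exact: cst_continuous.
  by move=> t /andP[_ ta]; rewrite exp_tail_out.
- have a1 : a < a + 1 by rewrite ltrDl.
  apply: (cvg_at_right_eq _ _ _ _ ce a1) => t /andP[at_ _].
  by rewrite exp_tail_in// ltW.
- by rewrite add0r.
Qed.

(** The opposite measure sees [g] at [- s]; when this lies below the range of integration, that
    measure contributes nothing. *)
Lemma vanishing_mean_opp g s a : - s < a -> (forall t, t < a -> g t = 0) ->
  one_sided_mean (fun t => g (- t)) (cst 0) s.
Proof.
move=> sa g0; exists 0, 0; split; last by rewrite /cst addr0 mul0r.
- apply: (cvg_at_left_eq _ (cst 0) _ (- a)); [exact: cst_continuous|by rewrite ltrNl|].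
  by move=> t /andP[ta _]; rewrite g0// ltrNl.
- have s1 : s < s + 1 by rewrite ltrDl.
  apply: (cvg_at_right_eq _ (cst 0) _ _ _ s1); first exact: cst_continuous.
  by move=> t /andP[st _]; rewrite g0// (lt_trans _ sa)// ltrN2.
Qed.

Lemma ae_mono G (P Q : R -> Prop) : (forall s, P s -> Q s) ->
  {ae G, forall s, P s} -> {ae G, forall s, Q s}.
Proof. by move=> PQ; apply: (@filterS _ _ (ae_filter_ringOfSetsType G)). Qed.

(** Brings [boundary_limit] to the shape of the final formulas: the integral runs over [I], and the
    almost-everywhere conditions become conditions on the half lines that carry the measures. *)
Lemma boundary_limit_on (a b : R) (G1 G2 : @smeasure R) (F : R -> R -> R)
    (I : set (measurableTypeR R)) (k g : R -> R) C L (nu1 nu2 : R) :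
  sSLM nu1 G1 -> sSLM nu2 G2 ->
  (forall e t, 0 < e <= 1 -> F e t = boundary_im a b G1 G2 e t) ->
  measurable I -> (forall t, g t = k t * \1_I t) ->
  decay_bounded g C -> measurable_fun setT L ->
  (forall s, 0 < s -> nu1 <= s -> one_sided_mean g L s) ->
  (forall s, 0 < s -> nu2 <= s -> one_sided_mean (fun t => g (- t)) (cst 0) s) ->
  ((pi^-1)%R%:E * \int[mu]_(t in I) (k t * F e t)%R%:E)%E
     @[e --> 0^'+] --> (sint G1 L)%:E.
Proof.
move=> h1 h2 hF mI gk gC mL hg hgo.
have [S1 S2 _] := h1; have [S3 S4 _] := h2.
have := boundary_limit a b G1 G2 g C L (sSLM_slm_smeasure _ _ h1) (sSLM_slm_smeasure _ _ h2) gC mL.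
move=> /(_ _ _ _ _)-H.
have {}H : ((pi^-1)%R%:E * \int[mu]_t (g t * boundary_im a b G1 G2 e t)%R%:E)%E
     @[e --> 0^'+] --> (sint G1 L)%:E.
  apply: H.
  - by apply: ae_mono (SLM_support _ _ S1) => s hs sp; apply: hg; [rewrite -pos_itv|exact: hs].
  - by apply: ae_mono (SLM_support _ _ S2) => s hs sp; apply: hg; [rewrite -pos_itv|exact: hs].
  - by apply: ae_mono (SLM_support _ _ S3) => s hs sp; apply: hgo; [rewrite -pos_itv|exact: hs].
  - by apply: ae_mono (SLM_support _ _ S4) => s hs sp; apply: hgo; [rewrite -pos_itv|exact: hs].
apply: cvg_trans H; apply: near_eq_cvg; near=> e.
have e01 : 0 < e <= 1 by apply/andP; split; near: e; [exact: nbhs_right_gt|exact: nbhs_right_le].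
congr (_ * _)%E; rewrite [RHS]integral_mkcond; apply: eq_integral => t _.
rewrite gk patchE indicE hF//; case: ifPn => _; first by rewrite mulr1.
by rewrite mulr0 mul0r.
Unshelve. all: by end_near. Qed.

Section Side.
Context (a b : R) (G1 G2 : @smeasure R) (F : R -> R -> R) (nu1 nu2 : R)
  (h1 : sSLM nu1 G1) (h2 : sSLM nu2 G2)
  (hF : forall e t, 0 < e <= 1 -> F e t = boundary_im a b G1 G2 e t).

(** The first inequality puts the jump of [exp_tail] strictly to the left of the support of [G1],
    the second puts the mirrored support of [G2] strictly to the left of the jump. For [a0] equal to
    minus or plus theta this is the condition that theta lies in the open gap. *)
Lemma density_formula (a0 x : R) : a0 < nu1 -> - a0 < nu2 -> 0 < x ->
  ((pi^-1)%R%:E * \int[mu]_(t in `[a0, +oo[) (expR (- (t * x)) * F e t)%R%:E)%E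
     @[e --> 0^'+] --> (sint G1 (fun s => expR (- (s * x))))%:E.
Proof.
move=> a1 a2 x0; have [C gC] := exp_tail_decay x a0 x0.
apply: (boundary_limit_on a b G1 G2 F _ _ (exp_tail x a0) C) => //.
- exact: h1.
- exact: h2.
- by meas_tac.
- by move=> s s0 s1; apply: exp_tail_mean_gt; exact: lt_le_trans s1.
- move=> s s0 s1; apply: (vanishing_mean_opp _ _ a0); last exact: exp_tail_out.
  by rewrite ltrNl (lt_le_trans a2).
Qed.

(** The jump now sits on the edge of the support, where the limit sees half of the exponential. The
    hypothesis makes the two parts of [G1] have equal atoms there, so the missing halves cancel. *)
Lemma density_formula_edge (x : R) : 0 <= nu1 -> smeas G1 [set nu1] = 0%E -> 0 < x ->
  ((pi^-1)%R%:E * \int[mu]_(t in `[nu1, +oo[) (expR (- (t * x)) * F e t)%R%:E)%E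
     @[e --> 0^'+] --> (sint G1 (fun s => expR (- (s * x))))%:E.
Proof.
move=> nu0 G10 x0; have [C gC] := exp_tail_decay x nu1 x0.
have [w1 w2] := sSLM_slm_smeasure _ _ h1.
pose L (s : R) := expR (- (s * x)) - expR (- (nu1 * x)) / 2 * \1_[set nu1] s.
have m1 : measurable ([set nu1] : set (measurableTypeR R)) by exact: measurable_set1.
have i1 G : slm_measure G -> G.-integrable pos (EFin \o (\1_[set nu1] : R -> R)).
  move=> Gw; apply/integrableP; split.
    by apply/measurable_EFinP; exact: measurable_indic.
  under eq_integral do rewrite /= ger0_norm//.
  rewrite integral_indic//; apply: le_lt_trans (slm_finite_itv _ nu1 Gw).
  apply: le_measure; rewrite ?inE//; first exact: measurableI.
  by move=> y [-> _]; rewrite /= in_itv/=.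
have fin G : slm_measure G -> G [set nu1] \is a fin_num.
  by move=> Gw; apply: (slm_fin_num _ _ nu1) => // y ->; rewrite /= in_itv/=.
have atom : \int[spos G1]_(s in pos) \1_[set nu1] s = \int[sneg G1]_(s in pos) \1_[set nu1] s.
  rewrite !Rintegral_indic//.
  (* An edge at zero lies outside the domain of integration, so both sides vanish. *)
  have [nu1p|nu1n] := ltP 0 nu1; last first.
    rewrite (_ : _ `&` _ = set0) ?measure0//.
    by apply/seteqP; split => // y [->]; rewrite /= in_itv/= andbT ltNge nu1n.
  rewrite (_ : _ `&` _ = [set nu1]); last first.
    by apply/seteqP; split => [y []//|y ->]; split => //; rewrite /= in_itv/= nu1p.
  move: G10; rewrite /smeas; have := fin _ w1; have := fin _ w2.
  by move=> f1 f2 /eqP; rewrite sube_eq// add0e => /eqP ->.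
have -> : sint G1 (fun s => expR (- (s * x))) = sint G1 L.
  have E G : slm_measure G -> \int[G]_(s in pos) L s =
      \int[G]_(s in pos) expR (- (s * x)) - expR (- (nu1 * x)) / 2 * \int[G]_(s in pos) \1_[set nu1] s.
    move=> Gw; rewrite RintegralB//; last 2 first.
      exact: laplace_integrable.
      by have := integrableZl mpos (expR (- (nu1 * x)) / 2) (i1 _ Gw); apply.
    by rewrite RintegralZl//; exact: i1.
  by rewrite /sint !E// atom; ring.
apply: (boundary_limit_on a b G1 G2 F _ _ (exp_tail x nu1) C) => //.
- exact: h1.
- exact: h2.
- apply: measurable_funB; first by meas_tac.
  by apply: measurable_funM => //; exact: measurable_indic.
- move=> s s0; rewrite le_eqVlt => /orP[/eqP <-|s1].
    have [l [r [gl gr lr]]] := exp_tail_mean_eq x nu1.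
    by exists l, r; split => //; rewrite -lr /L indicE mem_set//= mulr1; field.
  have [l [r [gl gr lr]]] := exp_tail_mean_gt x nu1 s s1.
  exists l, r; split => //; rewrite -lr /L indicE memNset/= ?mulr0 ?subr0//.
  by move=> E; rewrite E ltxx in s1.
- move=> s s0 s1; apply: (vanishing_mean_opp _ _ nu1); last exact: exp_tail_out.
  by rewrite (@lt_le_trans _ _ 0)// oppr_lt0.
Qed.

(** The test function is the indicator of [[u, v]]; by [continuity_points_atom] the half masses at
    both ends cancel between the two parts, which leaves the measure of []u, v]]. *)
Lemma measure_formula J (u v : R) : jordan_decomposition_of G1 J ->
  continuity_points J u -> continuity_points J v -> 0 < u -> u < v ->
  ((pi^-1)%R%:E * \int[mu]_(t in `[u, v]) (F e t)%R%:E)%E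
     @[e --> 0^'+] --> smeas G1 `]u, v]%classic.
Proof.
move=> GJ cu cv u0 uv.
have Gw := sSLM_slm_smeasure _ _ h1; have [w1 w2] := Gw.
have atu := continuity_points_atom _ _ _ Gw GJ cu.
have atv := continuity_points_atom _ _ _ Gw GJ cv.
have v0 := lt_trans u0 uv.
pose g (t : R) : R := \1_`[u, v] t.
have gin t : u <= t <= v -> g t = 1.
  by move=> tuv; rewrite /g indicE mem_set//= in_itv.
have gout t : ~~ (u <= t <= v) -> g t = 0.
  by move=> /negP tuv; rewrite /g indicE memNset//= in_itv.
have gC : decay_bounded g ((1 + v ^+ 2) ^+ 2).
  split; first exact: measurable_indic.
  move=> t; have t1 := onesqr_gt0 t.
  case: (boolP (u <= t <= v)) => [tuv|tuv]; last first.
    by rewrite gout// lexx divr_ge0 ?sqr_ge0.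
  rewrite gin// ler01/= ler_pdivlMr ?exprn_gt0// mul1r.
  rewrite lerXn2r ?nnegrE ?(ltW t1) ?(ltW (onesqr_gt0 _))// lerD2l.
  have /andP[ut tv] := tuv.
  by rewrite lerXn2r ?nnegrE ?(ltW v0)// (le_trans (ltW u0)).
(* The mean of the one-sided limits of [g]: 1/2 at both ends, written as a correction of the
   half-open interval in the claim. *)
pose L (s : R) : R := \1_`]u, v] s + 2^-1 * \1_[set u] s - 2^-1 * \1_[set v] s.
have mu1 : measurable ([set u] : set (measurableTypeR R)) by exact: measurable_set1.
have mv1 : measurable ([set v] : set (measurableTypeR R)) by exact: measurable_set1.
have muv : measurable (`]u, v]%classic : set (measurableTypeR R)) by [].
have ind G (A : set (measurableTypeR R)) : slm_measure G -> measurable A ->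
    A `<=` `]0, v]%classic ->
    G.-integrable pos (EFin \o (\1_A : R -> R)) /\
    \int[G]_(s in pos) \1_A s = fine (G A) /\ G A \is a fin_num.
  move=> Gw' mA Av.
  have Ap : A `&` pos = A.
    by apply/setIidPl => y /Av; rewrite /= !in_itv/= andbT => /andP[].
  have fin : G A \is a fin_num.
    by apply: (slm_fin_num _ _ v) => // y /Av; rewrite /= !in_itv/= => /andP[].
  split; last by rewrite Rintegral_indic// Ap.
  apply/integrableP; split.
    by apply/measurable_EFinP; exact: measurable_indic.
  under eq_integral do rewrite /= ger0_norm//.
  by rewrite integral_indic// Ap -ge0_fin_numE.
have su : [set u] `<=` `]0, v]%classic by move=> y ->; rewrite /= in_itv/= u0 ltW.
have sv : [set v] `<=` `]0, v]%classic by move=> y ->; rewrite /= in_itv/= v0 lexx.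
have suv : `]u, v] `<=` `]0, v]%classic.
  by move=> y; rewrite /= !in_itv/= => /andP[uy ->]; rewrite (lt_trans u0).
have E G : slm_measure G -> \int[G]_(s in pos) L s =
    fine (G `]u, v]%classic) + 2^-1 * fine (G [set u]) - 2^-1 * fine (G [set v]).
  move=> Gw'.
  have [i1 [e1 _]] := ind G _ Gw' mu1 su.
  have [i2 [e2 _]] := ind G _ Gw' mv1 sv.
  have [i3 [e3 _]] := ind G _ Gw' muv suv.
  have i1' : G.-integrable pos (EFin \o (fun s : R => 2^-1 * \1_[set u] s)).
    by have := integrableZl mpos 2^-1 i1; apply.
  have i2' : G.-integrable pos (EFin \o (fun s : R => 2^-1 * \1_[set v] s)).
    by have := integrableZl mpos 2^-1 i2; apply.
  have i13 : G.-integrable pos (EFin \o (fun s : R => \1_`]u, v] s + 2^-1 * \1_[set u] s)).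
    by have := integrableD mpos i3 i1'; apply.
  by rewrite RintegralB// RintegralD// !RintegralZl// e1 e2 e3.
have -> : smeas G1 `]u, v]%classic = (sint G1 L)%:E.
  have [_ [_ f1]] := ind _ _ w1 muv suv.
  have [_ [_ f2]] := ind _ _ w2 muv suv.
  rewrite /smeas -(fineK f1) -(fineK f2) -EFinB; congr EFin.
  by rewrite /sint !E// atu atv/=; ring.
suff H : ((pi^-1)%R%:E * \int[mu]_(t in `[u, v]) (cst 1 t * F e t)%R%:E)%E
     @[e --> 0^'+] --> (sint G1 L)%:E.
  apply: cvg_trans H; apply: near_eq_cvg; apply: nearW => e.
  by congr (_ * _)%E; apply: eq_integral => t _; rewrite mul1r.
apply: (boundary_limit_on a b G1 G2 F _ _ g ((1 + v ^+ 2) ^+ 2)) => //.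
- exact: h1.
- exact: h2.
- by move=> t; rewrite mul1r.
- by apply: measurable_funB; [apply: measurable_funD|];
    [exact: measurable_indic|apply: measurable_funM => //; exact: measurable_indic|
     apply: measurable_funM => //; exact: measurable_indic].
- move=> s _ _.
  have cR (c d : R) : s < d -> (forall t, s < t < d -> g t = c) -> g t @[t --> s^'+] --> c.
    by move=> sd gc; apply: (cvg_at_right_eq _ (cst c) _ d) => //; exact: cst_continuous.
  have cL (c d : R) : d < s -> (forall t, d < t < s -> g t = c) -> g t @[t --> s^'-] --> c.
    by move=> sd gc; apply: (cvg_at_left_eq _ (cst c) _ d) => //; exact: cst_continuous.
  have Lval (p q r : bool) : (u < s <= v) = p -> (s == u) = q -> (s == v) = r ->
      L s = p%:R + 2^-1 * q%:R - 2^-1 * r%:R.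
    have E1 : (s \in `]u, v]%classic) = (u < s <= v).
      by apply/idP/idP; rewrite inE/= in_itv.
    have E2 w : (s \in [set w]) = (s == w).
      by apply/idP/idP; rewrite inE/= => /eqP.
    by move=> <- <- <-; rewrite /L !indicE E1 !E2.
  have [su'|us|us] := ltgtP s u.
  + exists 0, 0; split.
    * apply: (cL _ (s - 1)); first by lra.
      by move=> t ts; apply: gout; apply/negP; lra.
    * apply: (cR _ u) => // t ts; apply: gout; apply/negP; lra.
    * rewrite (Lval false false false); first by rewrite /=; field.
      - by apply/negbTE/negP; lra.
      - by rewrite lt_eqF.
      - by rewrite lt_eqF// (lt_trans su').
  + have [sv'|vs|vs] := ltgtP s v.
    * exists 1, 1; split.
      - by apply: (cL _ u) => // t ts; apply: gin; lra.
      - by apply: (cR _ v) => // t ts; apply: gin; lra.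
      - rewrite (Lval true false false); first by rewrite /=; field.
        by rewrite us ltW. by rewrite gt_eqF. by rewrite lt_eqF.
    * exists 0, 0; split.
      - apply: (cL _ v) => // t ts; apply: gout; apply/negP; lra.
      - apply: (cR _ (s + 1)); first by lra.
        by move=> t ts; apply: gout; apply/negP; lra.
      - rewrite (Lval false false false); first by rewrite /=; field.
        by rewrite us/= leNgt vs. by rewrite gt_eqF. by rewrite gt_eqF.
    * exists 1, 0; split.
      - by apply: (cL _ u) => // t ts; apply: gin; lra.
      - apply: (cR _ (s + 1)); first by lra.
        by move=> t ts; apply: gout; apply/negP; lra.
      - rewrite (Lval true false true); first by rewrite /=; field.
        by rewrite us vs lexx. by rewrite gt_eqF. by rewrite vs eqxx.
  + exists 0, 1; split.
    * apply: (cL _ (s - 1)); first by lra.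
      by move=> t ts; apply: gout; apply/negP; lra.
    * by apply: (cR _ v); [rewrite us|move=> t ts; apply: gin; lra].
    * rewrite (Lval false true false); first by rewrite /=; field.
      - by rewrite us ltxx.
      - by rewrite us eqxx.
      - by rewrite us lt_eqF.
- move=> s s0 _; apply: (vanishing_mean_opp _ _ u); first lra.
  by move=> t tu; apply: gout; apply/negP; lra.
Qed.

End Side.
End BoundaryFormulas.

Section BoundaryValues.
Context {R : realType}.
Notation meas := {measure set (measurableTypeR R) -> \bar R}.
Notation pos := (`]0%R, +oo[%classic : set (measurableTypeR R)).
Implicit Types (G : meas) (Gm Gp : @smeasure R) (t e : R).

Lemma Im_slm_exponent_opp G e t : slm_measure G -> 0 < e <= 1 ->
  complex.Im (slm_exponent G (- (e +i* t))) = slm_im G e t.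
Proof.
move=> Gw /andP[e0 _]; have z0 : complex.Re (- (e +i* t)) != 0.
  by rewrite /= oppr_eq0 gt_eqF.
rewrite (slm_exponentE _ _ Gw z0).
apply: eq_Rintegral => s _.
by rewrite slm_kernelE/= /slm_im_kernel /poisson sqrrN; ring.
Qed.

(** The kernel at minus the conjugate of z is the conjugate of the kernel at z, so this mirrors
    [Im_slm_exponent_opp], with a change of sign and of [t] into [- t]. *)
Lemma Im_slm_exponent G e t : slm_measure G -> 0 < e <= 1 ->
  complex.Im (slm_exponent G (e +i* t)) = - slm_im G e (- t).
Proof.
move=> Gw e01; have /andP[e0 _] := e01.
have z0 : complex.Re (e +i* t) != 0 by rewrite /= gt_eqF.
rewrite (slm_exponentE _ _ Gw z0) -mulN1r /slm_im -RintegralZl//; last first.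
  exact: slm_im_kernel_integrable.
apply: eq_Rintegral => s _.
by rewrite slm_kernelE/= /slm_im_kernel /poisson opprK; ring.
Qed.

Lemma Im_sum5 (w0 w1 w2 w3 w4 : R[i]) :
  complex.Im (w0 + (w1 - w2) + (w3 - w4)) = complex.Im w0 +
  (complex.Im w1 - complex.Im w2) + (complex.Im w3 - complex.Im w4).
Proof. by case: w0 w1 w2 w3 w4 => [? ?] [? ?] [? ?] [? ?] [? ?]. Qed.

Lemma Im_levy_exponent_opp a b Gm Gp e t : slm_smeasure Gm -> slm_smeasure Gp ->
  0 < e <= 1 ->
  complex.Im (levy_exponent a b Gm Gp (- (e +i* t))) = boundary_im a b Gp Gm e t.
Proof.
move=> [m1 m2] [p1 p2] e01.
rewrite /levy_exponent opprK /boundary_im Im_sum5 expr2.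
by rewrite !Im_slm_exponent_opp// !Im_slm_exponent//=; ring.
Qed.

Lemma Im_levy_exponent a b Gm Gp e t : slm_smeasure Gm -> slm_smeasure Gp ->
  0 < e <= 1 ->
  complex.Im (levy_exponent a b Gm Gp (e +i* t)) = boundary_im a (- b) Gm Gp e t.
Proof.
move=> [m1 m2] [p1 p2] e01.
rewrite /levy_exponent /boundary_im Im_sum5 expr2.
by rewrite !Im_slm_exponent_opp// !Im_slm_exponent//=; ring.
Qed.

End BoundaryValues.

Theorem theorem3p24 (R : realType) (d : measure_display)
    (Omega : measurableType d) (P : probability Omega R)
    (X : R -> {RV P >-> R}) (mum mup : R) (Gm Gp : @smeasure R)
    (psi : R[i] -> R[i])
    (hmum : mum <= 0) (hmup : 0 <= mup)
    (hX : is_sSL mum mup X Gm Gp)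
    (hpsi : is_char_exponent X psi)
    (hcont : analytic_on psi (cut_plane mum mup)) :
  let f := sSL_density Gm Gp in
  let fp := fun x : R => \1_`]0, +oo[ x * f x in
  let fm := fun x : R => \1_`]-oo, 0[ x * f x in
  (* (a) *)
  (forall theta x : R, mum < theta -> theta < mup -> 0 < x ->
     ((pi^-1)%R%:E * \int[lebesgue_measure]_(t in `[(- theta)%R, +oo[)
        (expR (- (t * x)) * complex.Im (psi (- (eps +i* t))))%R%:E)%E
       @[eps --> (0:R)^'+] --> (fp x)%:E
     /\
     ((pi^-1)%R%:E * \int[lebesgue_measure]_(t in `[theta, +oo[)
        (expR (- (t * x)) * complex.Im (psi (eps +i* t)))%R%:E)%E
       @[eps --> (0:R)^'+] --> (fm (- x))%:E)
  /\
  (* (b) *)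
  ((forall J u v, jordan_decomposition_of Gp J ->
      continuity_points J u -> continuity_points J v -> 0 < u -> u < v ->
      ((pi^-1)%R%:E * \int[lebesgue_measure]_(t in `[u, v])
         (complex.Im (psi (- (eps +i* t))))%R%:E)%E
        @[eps --> (0:R)^'+] --> smeas Gp `]u, v]%classic)
   /\
   (forall J u v, jordan_decomposition_of Gm J ->
      continuity_points J u -> continuity_points J v -> 0 < u -> u < v ->
      ((pi^-1)%R%:E * \int[lebesgue_measure]_(t in `[u, v])
         (complex.Im (psi (eps +i* t)))%R%:E)%E
        @[eps --> (0:R)^'+] --> smeas Gm `]u, v]%classic))
  /\
  (* (c) *)
  ((smeas Gp [set - mum] = 0%E -> forall x : R, 0 < x ->
     ((pi^-1)%R%:E * \int[lebesgue_measure]_(t in `[(- mum)%R, +oo[)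
        (expR (- (t * x)) * complex.Im (psi (- (eps +i* t))))%R%:E)%E
       @[eps --> (0:R)^'+] --> (fp x)%:E)
   /\
   (smeas Gm [set mup] = 0%E -> forall x : R, 0 < x ->
     ((pi^-1)%R%:E * \int[lebesgue_measure]_(t in `[mup, +oo[)
        (expR (- (t * x)) * complex.Im (psi (eps +i* t)))%R%:E)%E
       @[eps --> (0:R)^'+] --> (fm (- x))%:E)).
Proof.
move=> f fp fm.
have [a [b psiE]] := char_exponent_off_axis _ _ _ _ _ _ _ _ _ hX hpsi hcont.
have [_ hGm hGp _] := hX.
have wm := sSLM_slm_smeasure _ _ hGm; have wp := sSLM_slm_smeasure _ _ hGp.
have Fp e t : 0 < e <= 1 -> complex.Im (psi (- (e +i* t))) = boundary_im a b Gp Gm e t.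
  move=> e01; have /andP[e0 _] := e01.
  by rewrite psiE ?Im_levy_exponent_opp//= oppr_eq0 gt_eqF.
have Fm e t : 0 < e <= 1 -> complex.Im (psi (e +i* t)) = boundary_im a (- b) Gm Gp e t.
  move=> e01; have /andP[e0 _] := e01.
  by rewrite psiE ?Im_levy_exponent//= gt_eqF.
have fpE x : 0 < x -> fp x = sint Gp (fun s => expR (- (s * x))).
  by move=> x0; rewrite /fp /f sSL_density_pos// indicE mem_set ?mul1r//= in_itv/= x0.
have fmE x : 0 < x -> fm (- x) = sint Gm (fun s => expR (- (s * x))).
  move=> x0; rewrite /fm /f sSL_density_neg// indicE mem_set ?mul1r//=.
  by rewrite in_itv/= oppr_lt0.
split; [|split; [split|split]].
- move=> theta x t1 t2 x0; split.
    rewrite fpE//; apply: (density_formula a b Gp Gm _ (- mum) mup hGp hGm Fp) => //.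
      by rewrite ltrN2.
    by rewrite opprK.
  rewrite fmE//; apply: (density_formula a (- b) Gm Gp _ mup (- mum) hGm hGp Fm) => //.
  by rewrite ltrN2.
- move=> J u v GJ cu cv u0 uv.
  exact: (measure_formula a b Gp Gm _ (- mum) mup hGp hGm Fp J).
- move=> J u v GJ cu cv u0 uv.
  exact: (measure_formula a (- b) Gm Gp _ mup (- mum) hGm hGp Fm J).
- move=> G0 x x0; rewrite fpE//.
  apply: (density_formula_edge a b Gp Gm _ (- mum) mup hGp hGm Fp) => //.
  by rewrite oppr_ge0.
- move=> G0 x x0; rewrite fmE//.
  exact: (density_formula_edge a (- b) Gm Gp _ mup (- mum) hGm hGp Fm).
Qed.
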